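(* Let $V$ be the rank two fermion vertex operator superalgebra, $\alpha,\beta\in\mathbb R$, $\kappa=\beta+\frac12$, $h=\kappa a$, $f=e^{2\pi i\alpha a(0)}$. Then $$G_{2n,h}(f;x_1,\dots,x_n;y_1,\dots,y_n;\tau)=\frac{e^{2\pi i(\alpha+1/2)(\beta+1/2)}}{\eta(\tau)}\,\vartheta\!\left[\begin{array}{c}-\beta+\frac12\\ \alpha+\frac12\end{array}\right]\!\Big(\sum_{i=1}^n(x_i-y_i),\tau\Big)\cdot\frac{\prod_{1\le i<j\le n}K(x_i-x_j,\tau)K(y_i-y_j,\tau)}{\prod_{1\le i,j\le n}K(x_i-y_j,\tau)}.$$
   Context: The rank two fermion VOSA $V$ is generated by odd vectors $\psi^\pm$ with $Y(\psi^\pm,z)=\sum_{n\in\mathbb Z}\psi^\pm(n)z^{-n-1}$, (anti)commutators $[\psi^+(m),\psi^-(n)]=\delta_{m,-n-1}$, $[\psi^\pm(m),\psi^\pm(n)]=0$, $\psi^\pm(k)\mathbf1=0$ for $k\ge0$, and Fock basis $\psi^+(-k_1)\cdots\psi^+(-k_s)\psi^-(-l_1)\cdots\psi^-(-l_t)\mathbf 1$ with $1\le k_1<\dots<k_s$, $1\le l_1<\dots<l_t$. The conformal vector is $\omega=\frac12[\psi^+(-2)\psi^-(-1)+\psi^-(-2)\psi^+(-1)]\mathbf 1$ (central charge $1$, $wt(\psi^\pm)=\frac12$), with $Y(\omega,z)=\sum_{n\in\mathbb Z}L(n)z^{-n-2}$. The Heisenberg vector is $a=\psi^+(-1)\psi^-(-1)\mathbf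 1$, with $Y(a,z)=\sum_{n\in\mathbb Z}a(n)z^{-n-1}$ and $a(0)\psi^\pm=\pm\psi^\pm$. The $h$-shifted grading operator and central charge are $L_h(0)=L(0)-\kappa a(0)$ and $c_h=1-12\kappa^2$. The supertrace is $\mathrm{STr}_V(X)=\mathrm{Tr}_{V_{\bar 0}}(X)-\mathrm{Tr}_{V_{\bar1}}(X)$, where $V_{\bar 0},V_{\bar 1}$ are the even and odd parts of $V$. With $\tau$ in the upper half plane, $q=e^{2\pi i\tau}$, $q_i=e^{z_i}$, $q_i^{A}=\exp(z_iA)$, $$F_{V,h}(f;(v_1,z_1),\dots,(v_n,z_n);\tau)=\mathrm{STr}_V\!\left(f\,Y(q_1^{L_h(0)}v_1,q_1)\cdots Y(q_n^{L_h(0)}v_n,q_n)\,q^{L_h(0)-c_h/24}\right),$$ $$G_{2n,h}(f;x_1,\dots,x_n;y_1,\dots,y_n;\tau)=F_{V,h}(f;(\psi^+,x_1),(\psi^-,y_1),\dots,(\psi^+,x_n),(\psi^-,y_n);\tau)$$ (alternating order), regarded as a meromorphic function of the insertion points by continuation from the region where the trace converges. Theta function: $\vartheta\!\left[\begin{array}{c}a\\ b\end{array}\right](z,\tau)=\sum_{n\in\mathbb Z}\exp[i\pi(n+a)^2\tau+(n+a)(z+2\pi ib)]$. Prime form: $K(z,\tau)=\exp(-P_0(z,\tau))$ with $P_0(z,\tau)=-\log z+\sum_{k\ge2}\frac1kE_k(\tau)z^k$ (continued to an entire function of $z$); equivalently $K(z,\tau)=\vartheta\!\left[\begin{array}{c}1/2\\1/2\end{array}\right](z,\tau)\big/\partial_z\vartheta\!\left[\begin{array}{c}1/2\\1/2\end{array}\right](0,\tau)$.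 Here $E_k=0$ for odd $k$ and $E_k(\tau)=-\frac{B_k}{k!}+\frac2{(k-1)!}\sum_{r\ge1}\frac{r^{k-1}q^r}{1-q^r}$ for even $k$, $B_k$ Bernoulli numbers. $\eta(\tau)=q^{1/24}\prod_{n\ge1}(1-q^n)$.
   Formalization: The right-hand side carries an extra factor (-1)^{n(n-1)/2}: with alternating insertions ψ⁺,ψ⁻,… the printed formula has the wrong sign for n=2 (let x_i→y_i; K is odd), so the sign is corrected; it is 1 for n≡0,1 mod 4. *)

(* Defs.v *)
From HB Require Import structures.
From mathcomp Require Import all_boot all_order all_algebra.
From mathcomp Require Import finmap.
From mathcomp Require Import monalg.
From mathcomp Require Import all_classical all_reals all_analysis.
From mathcomp Require Import complex summability.

Set Implicit Arguments.
Unset Strict Implicit.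
Unset Printing Implicit Defensive.

Import Order.TTheory GRing.Theory Num.Theory numFieldNormedType.Exports.

Local Open Scope classical_set_scope.
Local Open Scope ring_scope.
Local Open Scope complex_scope.

(* The topology and the normed module structure of R[i] over itself are those *)
(* of its copy R[i]^o.                                                        *)

Section ComplexAnalysis.
Variable R : realType.
Local Notation C := R[i].

Definition cexp (z : C) : C :=
  (expR (complex.Re z))%:C *
  (cos (complex.Im z) +i* sin (complex.Im z)).

Definition twopii : C := 0 +i* (pi *+ 2).

(* q^A = exp (2 pi i tau A) for a scalar A *)
Definition qpow (tau A : C) : C := cexp (twopii * tau * A).

(* Unconditional (hence absolute) convergence of a family indexed by I.       *)
Definition has_sum (I : choiceType) (F : I -> C) (s : C) : Prop :=
  (fun A : {fset I} => \sum_(i <- A) F i : C^o) @ totally --> (s : C^o).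

Definition csum (I : choiceType) (F : I -> C) : C :=
  lim ((fun A : {fset I} => \sum_(i <- A) F i : C^o) @ totally).

Definition theta (a b : R) (z tau : C) : C :=
  csum (fun n : int =>
    cexp ((0 +i* pi) * (n%:~R + a%:C) ^+ 2 * tau
          + (n%:~R + a%:C) * (z + twopii * b%:C))).

Definition prime_form (z tau : C) : C :=
  theta (1 / 2) (1 / 2) z tau
  / derive1 (fun w : C^o => theta (1 / 2) (1 / 2) w tau : C^o) 0.

Definition dedekind_eta (tau : C) : C :=
  qpow tau (1 / 24%:R)
  * lim ((fun N : nat => \prod_(1 <= k < N.+1) (1 - qpow tau k%:R) : C^o) @ \oo).

Definition holomorphic_at (W : normedModType C) (g : W -> C^o) (p : W) : Prop :=
  \forall w \near p, differentiable g w.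

(* G is meromorphic on W: locally a quotient g / h of holomorphic functions   *)
(* with h not identically zero on any nonempty open set. The value of G at    *)
(* the zeros of h is irrelevant.                                              *)
Definition meromorphic (W : normedModType C) (G : W -> C^o) : Prop :=
  forall p : W, exists g h : W -> C^o,
    [/\ holomorphic_at g p, holomorphic_at h p,
        \forall w \near p, ~ (\forall w' \near w, h w' = 0)
      & \forall w \near p, h w != 0 -> G w = g w / h w].

End ComplexAnalysis.

(* (true, i) stands for the creation mode psi^+(-(i+1)), and (false, i) for   *)
(* psi^-(-(i+1)). Since Negz i = - (i+1) in int, no index shift appears in    *)
(* the action [psi] below.                                                    *)
Definition fmode : choiceType := (bool * nat)%type.

(* The order of the factors in a Fock basis monomial: all psi^+ before all    *)
(* psi^-, and increasing k_i, l_j inside each group.                          *)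
Definition fmode_le (p r : fmode) : bool :=
  if p.1 == r.1 then (p.2 <= r.2)%N else p.1.

(* A Fock basis vector is given by the finite set of its creation modes.      *)
Definition fstate : choiceType := {fset fmode}.

Definition monomial (S : fstate) : seq fmode := sort fmode_le S.

Section FermionVOSA.
Variable R : realType.
Local Notation C := R[i].

Definition fock : lmodType C := {malg C[fstate]}.

Definition basis (S : fstate) : fock := << S >>.

Definition linear_ext (F : fstate -> fock) (v : fock) : fock :=
  \sum_(S <- msupp (v : {malg C[fstate]})) (v : {malg C[fstate]})@_S *: F S.

(* The sign picked up when moving a mode past the factors that precede p.     *)
Definition koszul (p : fmode) (S : fstate) : C :=
  (-1) ^+ count [pred r | (r != p) && fmode_le r p] S.

(* psi true n = psi^+(n) and psi false n = psi^-(n)                           *)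
Definition psi (e : bool) (n : int) : fock -> fock :=
  linear_ext (fun S =>
    match n with
    | Negz i => if (e, i) \in S then 0
                else koszul (e, i) S *: basis ((e, i) |` S)%fset
    | Posz i => if (~~ e, i) \in S
                then koszul (~~ e, i) S *: basis (S `\ (~~ e, i))%fset
                else 0
    end).

Definition vac : fock := basis fset0.
Definition psip : fock := psi true (- 1) vac.
Definition psim : fock := psi false (- 1) vac.

(* Modes of the vertex operator of a monomial, by the iterate formula (the    *)
(* m = 0 case of the Borcherds identity) for v = psi^e(-k) u, k = i + 1:      *)
(*   v(n) = \sum_(j >= 0) binom(i+j, j)                                       *)
(*     ( psi^e(-k-j) u(n+j) - (-1)^k (-1)^|u| u(n-k-j) psi^e(j) ),            *)
(* that is Y(v,z) = :(d/dz)^i/i! Y(psi^e,z) Y(u,z): . On a given vector only  *)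
(* finitely many terms are nonzero.                                           *)
Fixpoint monomial_mode (w : seq fmode) (n : int) (x : fock) : fock :=
  match w with
  | [::] => if n == - 1 then x else 0
  | (e, i) :: w' =>
      \sum_(j \in [set: nat])
        (('C(i + j, j))%:R : C) *:
          (psi e (- (i%:Z + 1) - j%:Z) (monomial_mode w' (n + j%:Z) x)
           + ((-1) ^+ (i + size w') : C) *:
               monomial_mode w' (n - (i%:Z + 1) - j%:Z) (psi e j%:Z x))
  end.

(* v(n), where Y(v,z) = \sum_n v(n) z^(-n-1) *)
Definition vmode (v : fock) (n : int) (x : fock) : fock :=
  linear_ext (fun S => monomial_mode (monomial S) n x) v.

Definition heis : fock := psi true (- 1) (psi false (- 1) vac).

Definition conformal : fock :=
  (1 / 2%:R : C) *: (psi true (- 2) (psi false (- 1) vac)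
                     + psi false (- 2) (psi true (- 1) vac)).

Definition a0 : fock -> fock := vmode heis 0.

(* Y(omega,z) = \sum_n L(n) z^(-n-2), whence L(0) = omega(1) *)
Definition L0 : fock -> fock := vmode conformal 1.

Definition Lh0 (kappa : R) (v : fock) : fock := L0 v - kappa%:C *: a0 v.

Definition ch (kappa : R) : R := 1 - 12%:R * kappa ^+ 2.

(* exp(t A) v: the vector whose coordinates in the Fock basis are the limits  *)
(* of those of \sum_(k < N) t^k A^k v / k! (and 0 if there is no such vector).*)
Definition opexp (t : C) (A : fock -> fock) (v : fock) : fock :=
  xget 0 [set w : fock | forall S : fstate,
    (fun N : nat =>
       mcoeff S (\sum_(k < N) (t ^+ k / (k`!)%:R) *: iter k A v
                 : {malg C[fstate]}) : C^o)
      @ \oo --> (mcoeff S (w : {malg C[fstate]}) : C^o)].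

(* The contribution to                                                        *)
(*   STr_V (f Y(q_1^{L_h(0)} v_1, q_1) ... Y(q_n^{L_h(0)} v_n, q_n)           *)
(*          q^{L_h(0) - c_h/24}),      s = [:: (v_1, z_1); ...; (v_n, z_n)],  *)
(* of the diagonal entry at the Fock basis vector p.1 and of the modes        *)
(* p.2 = (m_1, ..., m_n) of the n vertex operators.                           *)
Definition STr_term (f : fock -> fock) (kappa : R) (tau : C)
    (s : seq (fock * C)) (p : fstate * (size s).-tuple int) : C :=
  let qL := opexp (twopii R * tau)
              (fun v => Lh0 kappa v - ((ch kappa)%:C / 24%:R) *: v) in
  let Yterm (vzm : fock * C * int) (w : fock) :=
    let: (v, z, m) := vzm in
    (cexp z ^ (- m - 1)) *: vmode (opexp z (Lh0 kappa) v) m w in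
  (-1) ^+ #|` p.1| *
  mcoeff p.1 (f (foldr Yterm (qL (basis p.1)) (zip s p.2)) : {malg C[fstate]}).

Definition has_STr (f : fock -> fock) (kappa : R) (tau : C)
    (s : seq (fock * C)) (val : C) : Prop :=
  has_sum (@STr_term f kappa tau s) val.

(* |q_1| > |q_2| > ... > |q_n| > |q q_1| *)
Definition convergence_region (tau : C) (zs : seq C) : bool :=
  sorted (fun u v : C => v < u)
    (rcons [seq `|cexp z| | z <- zs] `|qpow tau 1 * cexp (head 0 zs)|).

Definition insertions (n : nat) (x y : 'rV[C]_n) : seq (fock * C) :=
  flatten [seq [:: (psip, x 0 i); (psim, y 0 i)] | i <- enum 'I_n].

(* G is the function G_{2n,h}(f; x; y; tau) of the insertion points: it is    *)
(* meromorphic on C^n x C^n and it is the sum of the supertrace on the        *)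
(* region where the latter converges. (That region is open and nonempty, so   *)
(* this determines G as a meromorphic function.)                              *)
Definition is_G2n (f : fock -> fock) (kappa : R) (tau : C) (n : nat)
    (G : 'rV[C]_n -> 'rV[C]_n -> C) : Prop :=
  meromorphic (fun p : 'rV[C]_n * 'rV[C]_n => G p.1 p.2 : C^o) /\
  (forall x y : 'rV[C]_n,
     convergence_region tau [seq vz.2 | vz <- insertions x y] ->
     has_STr f kappa tau (insertions x y) (G x y)).

End FermionVOSA.

(* Submission.v *)
Require Import Defs.
From HB Require Import structures.
From mathcomp Require Import all_boot all_order all_algebra.
From mathcomp Require Import finmap.
From mathcomp Require Import monalg.
From mathcomp Require Import all_classical all_reals all_analysis.
From mathcomp Require Import complex summability.
From mathcomp Require Import ring lra zify.
Set Implicit Arguments.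
Unset Strict Implicit.
Unset Printing Implicit Defensive.
Import Order.TTheory GRing.Theory Num.Theory numFieldNormedType.Exports.
Local Open Scope ring_scope.
Local Open Scope complex_scope.

(* The trace of a product of fermions is computed by contracting the first one
   with the others and moving it around the trace. This expresses the function of
   a word of insertions as a signed sum, over the letters of opposite charge, of a
   twisted two-point function times the function of a shorter word. The two-point
   function sum_m e^(mu) / (1 - e^A q^m) equals, up to sign,
   th'(0) th(u + A) / (th(u) th(A)) for an odd theta function th, and
   the right-hand side of the theorem obeys the same recursion by the partial
   fraction expansion of products of such quotients, a form of Fay's identity.
   The recursion starts with the partition function, given by the Jacobi triple
   product. It needs the twist to avoid the period lattice, and the general case
   follows by continuity in alpha. *)

(** * Unconditional summability *)

(** No Liouville argument is made: the identities between kernels and theta functions come from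
    rearranging absolutely convergent series. The main analytic obstacle is therefore the absolute
    convergence of the supertrace over all pairs (state, modes) at once. Once it is known, the
    states can be summed first, which gives traces of fixed modes with an algebraic recursion, and
    then the modes, which turns that recursion into one with two-point kernels. Division by theta
    values needs their nonvanishing off the period lattice, and this is read off the infinite
    product. For a given word the recursion imposes finitely many conditions on the twist 2 pi i
    (alpha - tau beta). The values alpha + 1/(n+1) meet them for all large n. Since the modulus of
    each term of the trace does not depend on alpha, the series at alpha dominates all the
    approximating ones, and the limit can be taken term by term. *)

Section Modulus.
Variable R : realType.
Local Notation C := R[i].

(** The norm of [R[i]] takes values in [R[i]], whose order is partial; estimates, suprema and [lra]
    need a modulus in [R]. *)
Definition nm (z : C) : R := complex.Re `|z|.

Lemma nmE (z : C) : `|z| = (nm z)%:C.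
Proof. by case: z. Qed.

Lemma nm0 : nm 0 = 0. Proof. by rewrite /nm normr0. Qed.
Lemma nm1 : nm 1 = 1. Proof. by rewrite /nm normr1. Qed.
Lemma nmN z : nm (- z) = nm z. Proof. by rewrite /nm normrN. Qed.
Lemma nmM z w : nm (z * w) = nm z * nm w.
Proof. by apply: complexI; rewrite -nmE normrM !nmE rmorphM. Qed.
Lemma nmV z : nm z^-1 = (nm z)^-1.
Proof. by apply: complexI; rewrite -nmE normfV nmE fmorphV. Qed.
Lemma nmX z n : nm (z ^+ n) = nm z ^+ n.
Proof. by apply: complexI; rewrite -nmE normrX nmE rmorphXn. Qed.
Lemma nm_ge0 z : 0 <= nm z.
Proof. by rewrite -ler0c -nmE. Qed.
Lemma nm_eq0 z : (nm z == 0) = (z == 0).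
Proof. by rewrite -(normr_eq0 z) nmE -(inj_eq (@complexI R)). Qed.
Lemma nm_gt0 z : (0 < nm z) = (z != 0).
Proof. by rewrite lt_def nm_eq0 nm_ge0 andbT. Qed.
Lemma nmD z w : nm (z + w) <= nm z + nm w.
Proof. by rewrite -lecR -nmE rmorphD /= -!nmE ler_normD. Qed.
Lemma nmB z w : nm (z - w) = nm (w - z).
Proof. by rewrite -nmN opprB. Qed.
Lemma nm_real (x : R) : nm x%:C = `|x|.
Proof. by rewrite /nm normc_def /= expr0n /= addr0 sqrtr_sqr. Qed.
Lemma nm_Re z : `|complex.Re z| <= nm z.
Proof. by rewrite -lecR -nmE normc_ge_Re. Qed.
Lemma nm_Im z : `|complex.Im z| <= nm z.
Proof.
have := nm_Re (z * 'i%C); rewrite ReiNIm normrN nmM => /le_trans -> //.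
by rewrite -[X in _ <= X]mulr1 ler_wpM2l ?nm_ge0 // /nm normc_def /= expr0n /= expr1n add0r sqrtr1.
Qed.
Lemma nm_nat n : nm (n%:R : C) = n%:R.
Proof. by rewrite -[n%:R](rmorph_nat (real_complex R)) nm_real normr_nat. Qed.

Lemma nm_sum (I : Type) (r : seq I) (P : pred I) (F : I -> C) :
  nm (\sum_(i <- r | P i) F i) <= \sum_(i <- r | P i) nm (F i).
Proof.
elim/big_rec2: _ => [|i x y _ le]; first by rewrite nm0.
by apply: le_trans (nmD _ _) _; rewrite lerD2l.
Qed.

Lemma nm_prod (I : Type) (r : seq I) (P : pred I) (F : I -> C) :
  nm (\prod_(i <- r | P i) F i) = \prod_(i <- r | P i) nm (F i).
Proof. by elim/big_rec2: _ => [|i x y _ <-]; rewrite ?nm1 ?nmM. Qed.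

Lemma nm_dist z w : nm z - nm w <= nm (z - w).
Proof. by have := nmD (z - w) w; rewrite subrK => h; rewrite lerBlDr. Qed.

End Modulus.

#[global] Existing Instance totally_filter.

Section Summation.
Variable R : realType.
Local Notation C := R[i].
Implicit Types I J : choiceType.

(** Absolute summability, phrased without any enumeration of [I]. It is the hypothesis under which
    sums may be exchanged, multiplied and bounded termwise. *)
Definition summ I (F : I -> C) :=
  exists M : R, forall A : {fset I}, \sum_(i <- A) nm (F i) <= M.

Lemma near_totally I (P : {fset I} -> Prop) :
  (\forall A \near totally, P A) <->
  exists A0 : {fset I}, forall A : {fset I}, (A0 `<=` A)%fset -> P A.
Proof.
split=> [[A _ h]|[A h]]; first by exists A => B AB; apply: h.
by exists A.
Qed.

Lemma has_sumP I (F : I -> C) s : has_sum F s <->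
  forall e : R, 0 < e -> exists A0 : {fset I}, forall A : {fset I},
    (A0 `<=` A)%fset -> nm (s - \sum_(i <- A) F i) < e.
Proof.
rewrite /has_sum; split=> [/cvgrPdist_lt h e e0|h].
  have e1 : 0 < e%:C :> C by rewrite ltcR.
  have [A0 hA] := (near_totally _).1 (h _ e1).
  by exists A0 => A /hA; rewrite nmE ltcR.
apply/cvgrPdist_lt => e e0; have [e1 e2] : e = (complex.Re e)%:C /\ 0 < complex.Re e.
  by move: e0; case: e => a b; rewrite ltcE /= => /andP[/eqP-> ->].
apply/near_totally; have [A0 hA] := h _ e2; exists A0 => A /hA.
by rewrite nmE e1 ltcR.
Qed.

Lemma has_sum_unique I (F : I -> C) s t : has_sum F s -> has_sum F t -> s = t.
Proof.
by move=> hs ht; apply: (@cvg_unique C^o (@norm_hausdorff _ _) _ _ s t hs ht).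
Qed.

Lemma csumE I (F : I -> C) s : has_sum F s -> csum F = s.
Proof. by move=> h; apply: (@cvg_lim C^o (@norm_hausdorff _ _) _ _ _ _ s h). Qed.

Lemma fset_sum_split (V : zmodType) I (A B : {fset I}) (F : I -> V) : (A `<=` B)%fset ->
  \sum_(i <- B) F i = \sum_(i <- A) F i + \sum_(i <- (B `\` A)%fset) F i.
Proof.
move=> AB; rewrite (big_fsetID _ (mem A)) /=; congr (_ + _).
  by apply: eq_fbigl => i; rewrite !inE /= andbC; case: (boolP (i \in A)) => //= /(fsubsetP AB) ->.
by apply: eq_fbigl => i; rewrite !inE /= andbC.
Qed.

Lemma sum_fset_le I (A B : {fset I}) (F : I -> R) : (forall i, 0 <= F i) ->
  (A `<=` B)%fset -> \sum_(i <- A) F i <= \sum_(i <- B) F i.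
Proof. by move=> F0 AB; rewrite (fset_sum_split F AB) lerDl sumr_ge0. Qed.

(** Choose [A0] whose sum comes within [e] of the supremum of all finite sums: a set disjoint from
    it cannot add [e] more. *)
Lemma summ_tail I (F : I -> C) : summ F -> forall e : R, 0 < e ->
  exists A0 : {fset I}, forall A : {fset I}, [disjoint A & A0]%fset ->
    \sum_(i <- A) nm (F i) < e.
Proof.
move=> [M hM] e e0.
pose T : set R := [set \sum_(i <- A) nm (F i) | A in [set: {fset I}]]%classic.
have hT : has_sup T.
  split; first by exists (\sum_(i <- (fset0 : {fset I})) nm (F i)), fset0.
  by exists M => _ [A _ <-].
have [_ [A0 _ <-] hA] := sup_adherent e0 hT.
exists A0 => A dA.
have /(sup_upper_bound hT) : T (\sum_(i <- (A0 `|` A)%fset) nm (F i)) by exists (A0 `|` A)%fset.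
rewrite (fset_sum_split _ (fsubsetUl A0 A)) fsetDUl fsetDv fset0U.
have -> : (A `\` A0 = A)%fset by apply/fsetDidPl.
lra.
Qed.

Let has_sum_ex_real I (F : I -> R) (M : R) : (forall i, 0 <= F i) ->
  (forall A : {fset I}, \sum_(i <- A) F i <= M) ->
  exists s : R, has_sum (fun i => (F i)%:C) s%:C.
Proof.
move=> F0 hM.
pose T : set R := [set \sum_(i <- A) F i | A in [set: {fset I}]]%classic.
have hT : has_sup T.
  split; first by exists (\sum_(i <- (fset0 : {fset I})) F i), fset0.
  by exists M => _ [A _ <-].
exists (sup T); apply/has_sumP => e e0.
have [_ [A0 _ <-] hA] := sup_adherent e0 hT.
exists A0 => A sA; have h1 := sum_fset_le F0 sA.
have /(sup_upper_bound hT) h2 : T (\sum_(i <- A) F i) by exists A.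
rewrite -(rmorph_sum (real_complex R)) -rmorphB nm_real ger0_norm; lra.
Qed.

Lemma has_sumD I (F G : I -> C) s t : has_sum F s -> has_sum G t ->
  has_sum (fun i => F i + G i) (s + t).
Proof.
move=> hF hG; rewrite /has_sum.
have -> : (fun A : {fset I} => \sum_(i <- A) (F i + G i) : C^o) =
    (fun A : {fset I} => (\sum_(i <- A) F i : C^o) + (\sum_(i <- A) G i : C^o)).
  by apply/funext => A; rewrite big_split.
exact: (@cvgD _ C^o _ _ _ _ _ _ _ hF hG).
Qed.

Lemma has_sumZ I (F : I -> C) s c : has_sum F s -> has_sum (fun i => c * F i) (c * s).
Proof.
move=> hF; rewrite /has_sum.
have -> : (fun A : {fset I} => \sum_(i <- A) (c * F i) : C^o) =
    (fun A : {fset I} => (c : C^o) * (\sum_(i <- A) F i : C^o)).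
  by apply/funext => A; rewrite mulr_sumr.
exact: (@cvgMr _ _ _ _ _ _ _ hF).
Qed.
Arguments has_sumZ {I F s} c.

Lemma eq_has_sum I (F G : I -> C) s : F =1 G -> has_sum F s -> has_sum G s.
Proof. by move=> /funext ->. Qed.

Lemma summ_le I (F G : I -> C) (k : R) : summ G -> (forall i, nm (F i) <= k * nm (G i)) ->
  summ F.
Proof.
move=> [M hM] h; have k0 : 0 <= `|k| by [].
exists (`|k| * M) => A; apply: le_trans (ler_wpM2l k0 (hM A)).
rewrite mulr_sumr; apply: ler_sum => i _; apply: le_trans (h i) _.
by rewrite ler_wpM2r ?nm_ge0 // ler_norm.
Qed.

Lemma has_sum_ex I (F : I -> C) : summ F -> exists s, has_sum F s.
Proof.
move=> [M hM].
have hp (f : C -> R) : (forall z, `|f z| <= nm z) ->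
    exists s : R, has_sum (fun i => (f (F i))%:C) s%:C.
  move=> hf.
  (* A real family is the difference of the nonnegative families |f| + f and |f|, each of which has
     a sum by monotonicity. *)
  have [s hs] : exists s : R, has_sum (fun i => (`|f (F i)| + f (F i))%:C) s%:C.
    apply: (@has_sum_ex_real _ _ (2 * M)) => [i|A].
      by have := ler_norm (- f (F i)); rewrite normrN; lra.
    apply: le_trans (ler_wpM2l _ (hM A)) => //; rewrite mulr_sumr ler_sum // => i _.
    by have := hf (F i); have := ler_norm (f (F i)); lra.
  have [t ht] : exists s : R, has_sum (fun i => (`|f (F i)|)%:C) s%:C.
    apply: (@has_sum_ex_real _ _ M) => [i|A] //.
    by apply: le_trans (hM A); apply: ler_sum.
  exists (s - t).
  have -> : (s - t)%:C = s%:C + -1 * t%:C :> C by rewrite mulN1r rmorphB.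
  apply: eq_has_sum (has_sumD hs (has_sumZ (-1) ht)) => i.
  by rewrite mulN1r rmorphD /= addrAC subrr add0r.
have [a ha] := hp _ (@nm_Re R); have [b hb] := hp _ (@nm_Im R).
exists (a%:C + 'i%C * b%:C).
by have := has_sumD ha (has_sumZ 'i%C hb); apply: eq_has_sum => i; rewrite -complexE.
Qed.

Lemma has_csum I (F : I -> C) : summ F -> has_sum F (csum F).
Proof. by move=> /has_sum_ex[s hs]; rewrite (csumE hs). Qed.

Lemma has_sum0 I : has_sum (fun _ : I => 0 : C) 0.
Proof.
apply/has_sumP => e e0; exists fset0 => A _.
by rewrite big1 ?subr0 ?nm0.
Qed.

Lemma has_sum_sum I (T : Type) (r : seq T) (P : pred T) (F : T -> I -> C) (s : T -> C) :
  (forall j, P j -> has_sum (F j) (s j)) ->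
  has_sum (fun i => \sum_(j <- r | P j) F j i) (\sum_(j <- r | P j) s j).
Proof.
move=> h; elim: r => [|x r IH].
  by rewrite big_nil; apply: eq_has_sum (has_sum0 I) => i; rewrite big_nil.
rewrite big_cons; case: ifPn => Px.
  by apply: eq_has_sum (has_sumD (h x Px) IH) => i; rewrite big_cons Px.
by apply: eq_has_sum IH => i; rewrite big_cons (negPf Px).
Qed.

Lemma summZ I (F : I -> C) c : summ F -> summ (fun i => c * F i).
Proof. by move=> h; apply: (summ_le (k := nm c) h) => i; rewrite nmM. Qed.

Lemma sum_imfset (V : nmodType) I J (h : J -> I) (A : {fset J}) (F : I -> V) : injective h ->
  \sum_(i <- (h @` A)%fset) F i = \sum_(j <- A) F (h j).
Proof. by move=> hi; rewrite big_imfset //= => x y _ _; apply: hi. Qed.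

(** One tool for changes of variables and for extension by zero: only the support of [F] has to lie
    in the image of [h]. *)
Lemma has_sum_inj I J (h : J -> I) (F : I -> C) s : injective h ->
  (forall i, F i != 0 -> exists j, h j = i) ->
  has_sum (fun j => F (h j)) s <-> has_sum F s.
Proof.
move=> hi hF; rewrite !has_sumP; split=> H e e0; have [A0 hA] := H e e0.
  exists (h @` A0)%fset => A sA.
  have hfin : finite_set [set j | h j \in A]%classic.
    apply: (@finite_preimage _ _ [set` A]%classic); last exact: finite_fset.
    by move=> x y _ _; apply: hi.
  pose B := fset_set [set j | h j \in A]%classic.
  have BE j : (j \in B) = (h j \in A) by rewrite /B in_fset_set // mem_setE.
  have -> : \sum_(i <- A) F i = \sum_(j <- B) F (h j).
    rewrite -(sum_imfset B F hi).
    symmetry; apply: big_fset_incl.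
      by apply/fsubsetP => _ /imfsetP[j /= jB ->]; rewrite -BE.
    move=> i iA /negP ni; apply/eqP/negPn/negP => /hF[j ji]; apply: ni.
    by rewrite -ji in_imfset //= BE ji.
  by apply: hA; apply/fsubsetP => j jA; rewrite BE; apply: (fsubsetP sA); rewrite in_imfset.
have hfin : finite_set [set j | h j \in A0]%classic.
  apply: (@finite_preimage _ _ [set` A0]%classic); last exact: finite_fset.
  by move=> x y _ _; apply: hi.
exists (fset_set [set j | h j \in A0]%classic) => B sB.
have -> : \sum_(j <- B) F (h j) = \sum_(i <- (A0 `|` (h @` B))%fset) F i.
  rewrite -(sum_imfset B F hi).
  apply: big_fset_incl; first by rewrite fsubsetUr.
  move=> i iA /negP ni; apply/eqP/negPn/negP => /hF[j ji]; apply: ni.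
  move: iA; rewrite -ji inE => /orP[jA|//]; rewrite in_imfset //=.
  by apply: (fsubsetP sB); rewrite in_fset_set // mem_setE.
by apply: hA; rewrite fsubsetUl.
Qed.

Lemma summ_inj I J (h : J -> I) (F : I -> C) : injective h -> summ F ->
  summ (fun j => F (h j)).
Proof.
move=> hi [M hM]; exists M => A; apply: le_trans (hM (h @` A)%fset).
by rewrite sum_imfset.
Qed.

Lemma summ_inj_inv I J (h : J -> I) (F : I -> C) : injective h ->
  (forall i, F i != 0 -> exists j, h j = i) -> summ (fun j => F (h j)) -> summ F.
Proof.
move=> hi hF [M hM]; exists M => A.
have hfin : finite_set [set j | h j \in A]%classic.
  apply: (@finite_preimage _ _ [set` A]%classic); last exact: finite_fset.
  by move=> x y _ _; apply: hi.
pose B := fset_set [set j | h j \in A]%classic.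
have BE j : (j \in B) = (h j \in A) by rewrite /B in_fset_set // mem_setE.
apply: le_trans (hM B).
rewrite -(sum_imfset B (fun i => nm (F i)) hi).
rewrite (big_fset_incl _ (A := (h @` B)%fset) (B := A)) //.
  by apply/fsubsetP => _ /imfsetP[j /= jB ->]; rewrite -BE.
move=> i iA /negP ni; apply/eqP; rewrite nm_eq0; apply/negPn/negP => /hF[j ji]; apply: ni.
by rewrite -ji in_imfset //= BE ji.
Qed.

Lemma sum_fsetM (V : nmodType) I J (A : {fset I}) (B : {fset J}) (F : I * J -> V) :
  \sum_(p <- (A `*` B)%fset) F p = \sum_(i <- A) \sum_(j <- B) F (i, j).
Proof.
by rewrite /fsetM big_imfset2 //= => -[? ?] [? ?] _ _ /= [-> ->].
Qed.

Lemma summ_pair I J (F : I * J -> C) (g : I -> R) (M : R) :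
  (forall i (B : {fset J}), \sum_(j <- B) nm (F (i, j)) <= g i) ->
  (forall A : {fset I}, \sum_(i <- A) g i <= M) -> summ F.
Proof.
move=> hg hM; exists M => A; pose A1 := [fset p.1 | p in A]%fset; pose A2 := [fset p.2 | p in A]%fset.
apply: (@le_trans _ _ (\sum_(p <- (A1 `*` A2)%fset) nm (F p))).
  apply: sum_fset_le => [i|]; first exact: nm_ge0.
  by apply/fsubsetP => -[i j] ijA; rewrite in_fsetM !in_imfset // /=; apply/andP; split; apply/imfsetP; exists (i, j).
by rewrite sum_fsetM; apply: le_trans (hM A1); apply: ler_sum => i _; apply: hg.
Qed.

Lemma summ_row I J (F : I * J -> C) i : summ F -> summ (fun j => F (i, j)).
Proof. by apply: (@summ_inj _ _ (fun j => (i, j))) => x y []. Qed.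

Lemma nm_has_sum I (F : I -> C) s (A0 : {fset I}) (e : R) : has_sum F s ->
  (forall A : {fset I}, [disjoint A & A0]%fset -> \sum_(i <- A) nm (F i) <= e) ->
  nm (s - \sum_(i <- A0) F i) <= e.
Proof.
move=> /has_sumP hs h; apply/ler_addgt0Pl => d d0.
have [A1 hA] := hs _ d0; have := hA (A0 `|` A1)%fset (fsubsetUr _ _).
rewrite (fset_sum_split _ (fsubsetUl A0 A1)); set X := \sum_(i <- A0) F i; set Y := \sum_(i <- _) F i => h1.
have h2 : nm Y <= e by apply: le_trans (nm_sum _ _ _) _; apply: h; apply/fdisjointP => i; rewrite inE => /andP[].
have -> : s - X = (s - (X + Y)) + Y by rewrite opprD addrA subrK.
apply: le_trans (nmD _ _) _; lra.
Qed.

Lemma nm_has_sum_le I (F : I -> C) s (e : R) : has_sum F s ->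
  (forall A : {fset I}, \sum_(i <- A) nm (F i) <= e) -> nm s <= e.
Proof.
move=> hs h; have := @nm_has_sum _ F s fset0 e hs; rewrite big_seq_fset0 subr0; apply=> A _; exact: h.
Qed.

Lemma fset_uniform I J (A : {fset I}) (P : I -> {fset J} -> Prop) :
  (forall i, exists B0 : {fset J}, forall B : {fset J}, (B0 `<=` B)%fset -> P i B) ->
  exists B0 : {fset J}, forall B : {fset J}, (B0 `<=` B)%fset -> forall i, i \in A -> P i B.
Proof.
move=> /choice[f hf]; exists (\bigcup_(i <- A) f i)%fset => B hB i iA; apply: hf.
by apply: fsubset_trans hB; apply: bigfcup_sup.
Qed.

Lemma fset_budget I (A : {fset I}) (d : R) : 0 < d ->
  exists2 d' : R, 0 < d' & \sum_(i <- A) d' <= d.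
Proof.
(* The summand 1 keeps the denominator positive when [A] is empty. *)
move=> d0; exists (d / (#|` A|%:R + 1)); first by rewrite divr_gt0 // ltr_wpDl.
rewrite big_const_seq count_predT iter_addr_0 -[X in X <= _]mulr_natr -mulrA ler_piMr ?(ltW d0) //.
by rewrite mulrC ler_pdivrMr ?mul1r ?lerDl // ltr_wpDl.
Qed.

Lemma summ_fubini I J (F : I * J -> C) : summ F -> summ (fun i => csum (fun j => F (i, j))).
Proof.
move=> sF; have [M hM] := sF; exists M => A.
apply/ler_addgt0Pl => d d0; have [d' d'0 hd'] := fset_budget A d0.
have [B hB] : exists B0 : {fset J}, forall B : {fset J}, (B0 `<=` B)%fset -> forall i, i \in A ->
    nm (csum (fun j => F (i, j)) - \sum_(j <- B) F (i, j)) < d'.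
  by apply: fset_uniform => i; apply: (has_sumP _ _).1 => //; apply: has_csum; apply: summ_row.
have {}hB := hB _ (fsubset_refl _).
rewrite big_seq; apply: (@le_trans _ _ (\sum_(i <- A | i \in A) (d' + \sum_(j <- B) nm (F (i, j))))).
  apply: ler_sum => i iA; have := hB i iA; have := nm_sum B predT (fun j => F (i, j)).
  by have := nm_dist (csum (fun j => F (i, j))) (\sum_(j <- B) F (i, j)); lra.
by rewrite -big_seq big_split /=; apply: lerD => //; rewrite -(sum_fsetM A B (fun p => nm (F p))).
Qed.

(** A rectangle [A] times [B] that contains [A0] misses at most e/3 of the whole sum, and [B] is
    then enlarged until the truncation errors of the rows in [A] add up to at most e/3. *)
Lemma has_sum_fubini I J (F : I * J -> C) s : summ F -> has_sum F s ->
  has_sum (fun i => csum (fun j => F (i, j))) s.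
Proof.
move=> sF hF; apply/has_sumP => e e0.
have e3 : 0 < e / 3 by rewrite divr_gt0.
have [A0 hA0] := summ_tail sF e3.
exists [fset p.1 | p in A0]%fset => A hA.
have [d d0 hd] := fset_budget A e3.
have [B0 hB] : exists B0 : {fset J}, forall B : {fset J}, (B0 `<=` B)%fset -> forall i, i \in A ->
    nm (csum (fun j => F (i, j)) - \sum_(j <- B) F (i, j)) < d.
  by apply: fset_uniform => i; exact: (has_sumP _ _).1 (has_csum (summ_row i sF)) d d0.
pose B := (B0 `|` [fset p.2 | p in A0])%fset.
have {}hB := hB B (fsubsetUl _ _).
have hs : nm (s - \sum_(p <- (A `*` B)%fset) F p) <= e / 3.
  apply: nm_has_sum => // D /fdisjointP hD; apply/ltW/hA0/fdisjointP => -[i j] /hD.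
  apply: contra => ij; rewrite in_fsetM /=; apply/andP; split.
    by apply: (fsubsetP hA); apply/imfsetP; exists (i, j).
  by rewrite inE; apply/orP; right; apply/imfsetP; exists (i, j).
set X := \sum_(i <- A) _.
have h2 : nm (\sum_(p <- (A `*` B)%fset) F p - X) <= e / 3.
  apply: le_trans hd; rewrite sum_fsetM -sumrB; apply: le_trans (nm_sum _ _ _) _.
  by rewrite big_seq [X in _ <= X]big_seq; apply: ler_sum => i iA; rewrite nmB; apply/ltW/hB.
rewrite -(subrK (\sum_(p <- (A `*` B)%fset) F p) s) -addrA; apply: le_lt_trans (nmD _ _) _; lra.
Qed.

Lemma summM I J (F : I -> C) (G : J -> C) : summ F -> summ G ->
  summ (fun p : I * J => F p.1 * G p.2).
Proof.
move=> [M hM] [N hN].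
apply: (@summ_pair _ _ _ (fun i => nm (F i) * N) (M * N)) => [i B|A] /=.
  under eq_bigr do rewrite nmM; rewrite -mulr_sumr; apply: ler_wpM2l (hN B); exact: nm_ge0.
rewrite -mulr_suml; apply: ler_wpM2r (hM A).
by apply: le_trans (hN fset0); rewrite big_seq_fset0.
Qed.

Lemma has_sumM I J (F : I -> C) (G : J -> C) s t : summ F -> summ G -> has_sum F s ->
  has_sum G t -> has_sum (fun p : I * J => F p.1 * G p.2) (s * t).
Proof.
move=> sF sG hF hG; have sFG := summM sF sG.
have h := has_sum_fubini sFG (has_csum sFG).
suff -> : s * t = csum (fun p : I * J => F p.1 * G p.2) by apply: has_csum.
apply: has_sum_unique h; rewrite mulrC; apply: eq_has_sum (has_sumZ t hF) => i /=.
by rewrite (csumE (has_sumZ (F i) hG)) mulrC.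
Qed.

Lemma cvgsP (u : nat -> C) l : ((u : nat -> C^o) @ \oo --> (l : C^o))%classic <->
  forall e : R, 0 < e -> exists N, forall n, (N <= n)%N -> nm (l - u n) < e.
Proof.
split=> [/cvgrPdist_lt h e e0|h].
  have e1 : 0 < e%:C :> C by rewrite ltcR.
  by have [N _ hN] := h _ e1; exists N => n /hN /=; rewrite nmE ltcR.
apply/cvgrPdist_lt => e e0; have [e1 e2] : e = (complex.Re e)%:C /\ 0 < complex.Re e.
  by move: e0; case: e => a b; rewrite ltcE /= => /andP[/eqP-> ->].
have [N hN] := h _ e2; exists N => // n /= /hN.
by rewrite nmE e1 ltcR.
Qed.

Lemma cvgs_unique (u : nat -> C) (l l' : C) : ((u : nat -> C^o) @ \oo --> (l : C^o))%classic ->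
  ((u : nat -> C^o) @ \oo --> (l' : C^o))%classic -> l = l'.
Proof. by move=> h h'; apply: (@cvg_unique C^o (@norm_hausdorff _ _) _ _ l l' h h'). Qed.

Lemma cvgs_has_sum I (F : I -> C) s (B : nat -> {fset I}) : has_sum F s ->
  (forall A : {fset I}, exists N, forall n, (N <= n)%N -> (A `<=` B n)%fset) ->
  ((fun n => \sum_(i <- B n) F i : C^o) @ \oo --> (s : C^o))%classic.
Proof.
move=> /has_sumP hF hB; apply/cvgsP => e /hF[A hA]; have [N hN] := hB A.
by exists N => n /hN /hA.
Qed.

Lemma cvgs_sum I (r : seq I) (F : nat -> I -> C) (f : I -> C) :
  (forall i, ((fun n => F n i : C^o) @ \oo --> (f i : C^o))%classic) ->
  ((fun n => \sum_(i <- r) F n i : C^o) @ \oo --> (\sum_(i <- r) f i : C^o))%classic.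
Proof.
move=> h; elim: r => [|x r IH].
  rewrite big_nil; under eq_fun do rewrite big_nil; exact: cvg_cst.
have -> : (fun n => \sum_(i <- x :: r) F n i : C^o) = fun n => F n x + \sum_(i <- r) F n i.
  by apply/funext => n; rewrite big_cons.
rewrite big_cons; apply: (@cvgD C C^o _ _ _ _ _ _ _ (h x) IH).
Qed.

(** Dominated convergence for sums. It serves twice: to pass from finite to infinite triple
    products, and to let alpha vary. *)
Lemma tannery I (F : nat -> I -> C) (f : I -> C) (b : I -> R) (M : R) :
  (forall A : {fset I}, \sum_(i <- A) b i <= M) ->
  (forall n i, nm (F n i) <= b i) ->
  (forall i, ((fun n => F n i : C^o) @ \oo --> (f i : C^o))%classic) ->
  summ f /\ ((fun n => csum (F n) : C^o) @ \oo --> (csum f : C^o))%classic.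
Proof.
move=> hM hb hf.
have b0 i : 0 <= b i by apply: le_trans (nm_ge0 _) (hb 0 i).
have sb : summ (fun i => (b i)%:C).
  by exists M => A; apply: le_trans (hM A); apply: ler_sum => i _; rewrite nm_real ger0_norm.
have sF n : summ (F n).
  by apply: (summ_le (k := 1) sb) => i; rewrite mul1r nm_real ger0_norm.
have hfb i : nm (f i) <= b i.
  apply/ler_addgt0Pl => e e0; have [N hN] := (cvgsP _ _).1 (hf i) e e0.
  have := hN N (leqnn _); have := nm_dist (f i) (F N i); have := hb N i; lra.
have sf : summ f.
  by apply: (summ_le (k := 1) sb) => i; rewrite mul1r nm_real ger0_norm.
split=> //; apply/cvgsP => e e0; have e3 : 0 < e / 3 by rewrite divr_gt0.
have [A0 hA0] := summ_tail sb e3.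
have tl (G : I -> C) : (forall i, nm (G i) <= b i) -> summ G ->
    nm (csum G - \sum_(i <- A0) G i) <= e / 3.
  move=> hG sG; apply: nm_has_sum => [|D hD]; first exact: has_csum.
  apply: le_trans (ltW (hA0 D hD)); apply: ler_sum => i _.
  by rewrite nm_real ger0_norm.
have [N hN] := (cvgsP _ _).1 (cvgs_sum (r := A0) hf) _ e3.
exists N => n /hN h1.
have h2 := tl f hfb sf; have := tl _ (hb n) (sF n); rewrite nmB => h3.
set X := csum f in h2 *; set Y := csum (F n) in h3 *.
set x := \sum_(i <- _) f i in h1 h2; set y := \sum_(i <- _) _ in h1 h3.
have -> : X - Y = (X - x) + ((x - y) + (y - Y)) by ring.
apply: le_lt_trans (nmD _ _) _; have := nmD (x - y) (y - Y); lra.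
Qed.

(** Subsets of a set of modes are fermionic states, so this is the factorization of a fermionic
    partition function. In the induction the new subsets are those that contain the added
    element. *)
Lemma prod_fset_expand (V : comNzRingType) I (U : {fset I}) (r : I -> V) :
  \prod_(p <- U) (1 + r p) = \sum_(S <- fpowerset U) \prod_(p <- S) r p.
Proof.
elim/fset1U_rect: U => [|x U xU IH].
  by rewrite fpowerset0 big_seq_fset0 big_seq_fset1 big_seq_fset0.
rewrite big_fsetU1 //= mulrDl mul1r IH.
rewrite (@fset_sum_split _ _ (fpowerset U) (fpowerset (x |` U)%fset)); last by rewrite fpowersetS fsubsetU1.
congr (_ + _); rewrite mulr_sumr.
have hi : {in fpowerset U &, injective (fun S => x |` S)%fset}.
  move=> S T; rewrite !fpowersetE => /fsubsetP sS /fsubsetP sT eST.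
  have nx (W : {fset I}) : {subset W <= U} -> W = ((x |` W) `\ x)%fset.
    by move=> sW; rewrite fsetU1K //; apply/negP => /sW; rewrite (negPf xU).
  by rewrite (nx S) // (nx T) // eST.
have -> : (fpowerset (x |` U) `\` fpowerset U = [fset x |` S | S in fpowerset U])%fset.
  apply/fsetP => S; rewrite in_fsetD !fpowersetE; apply/andP/imfsetP => [[n1 n2]|[T /= + ->]].
    have xS : x \in S.
      apply/negPn/negP => xS; case/negP: n1; apply/fsubsetP => y yS.
      by have := fsubsetP n2 _ yS; rewrite !inE => /orP[/eqP yx|//]; rewrite -yx yS in xS.
    exists (S `\ x)%fset; last by rewrite fsetD1K.
    by rewrite fpowersetE fsubDset.
  rewrite fpowersetE => sT; split; last exact: fsetUS.
  by apply/negP => /fsubsetP/(_ x); rewrite !inE eqxx => /(_ isT); rewrite (negPf xU).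
rewrite [RHS]big_imfset //= big_seq [RHS]big_seq; apply: eq_bigr => S.
rewrite fpowersetE => /fsubsetP sS; rewrite big_fsetU1 //.
by apply/negP => /sS; rewrite (negPf xU).
Qed.

Lemma prod_le_expR (T : Type) (s : seq T) (r : T -> R) : (forall p, 0 <= r p) ->
  \prod_(p <- s) (1 + r p) <= expR (\sum_(p <- s) r p).
Proof.
move=> r0; rewrite expR_sum; elim: s => [|x s IH]; first by rewrite !big_nil.
by rewrite !big_cons; apply: ler_pM => //; [rewrite addr_ge0|rewrite prodr_ge0 // => i _; rewrite addr_ge0|exact: expR_ge1Dx].
Qed.

(** A finite family of subsets lies in the power set of its union, where the sum is the product of
    the 1 + |r p|, at most the exponential of the sum of the |r p|. *)
Lemma summ_subset_prod I (r : I -> C) : summ r -> summ (fun S : {fset I} => \prod_(p <- S) r p).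
Proof.
move=> [M hM]; exists (expR M) => A.
pose U := (\bigcup_(S <- A) S)%fset.
have sA : (A `<=` fpowerset U)%fset.
  by apply/fsubsetP => S SA; rewrite fpowersetE; apply: (@bigfcup_sup _ _ _ _ _ id).
apply: (@le_trans _ _ (\sum_(S <- fpowerset U) \prod_(p <- S) nm (r p))).
  under eq_bigr do rewrite nm_prod; apply: sum_fset_le sA => S.
  by rewrite prodr_ge0 // => i _; apply: nm_ge0.
rewrite -prod_fset_expand; apply: le_trans (prod_le_expR _ _) _ => [p|]; first exact: nm_ge0.
by rewrite ler_expR.
Qed.

End Summation.
Arguments has_sumZ {R I F s} c.

(** * The exponential function *)
Section ComplexExponential.
Variable R : realType.
Local Notation C := R[i].
Implicit Types z w : C.

Lemma has_sum_finite (I : choiceType) (F : I -> C) (A : {fset I}) :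
  (forall i, i \notin A -> F i = 0) -> has_sum F (\sum_(i <- A) F i).
Proof.
move=> h; apply/has_sumP => e e0; exists A => B sB.
by rewrite (big_fset_incl _ sB) ?subrr ?nm0 // => i _; apply: h.
Qed.

Lemma cvgs_real (u : nat -> R) (l : R) : (u @ \oo --> l)%classic ->
  ((fun n => (u n)%:C : C^o) @ \oo --> (l%:C : C^o))%classic.
Proof.
move=> /cvgrPdist_lt h; apply/cvgsP => e /h[N _ hN]; exists N => n /hN.
by rewrite -rmorphB nm_real.
Qed.

Lemma cexpE z : cexp z = (expR (complex.Re z))%:C * ((cos (complex.Im z))%:C + 'i%C * (sin (complex.Im z))%:C).
Proof. by rewrite /cexp; congr (_ * _); rewrite [LHS]complexE. Qed.

Lemma cexpD z w : cexp (z + w) = cexp z * cexp w.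
Proof.
rewrite /cexp !raddfD /= expRD sinD cosD rmorphM /= mulrACA; congr (_ * _).
by simpc; rewrite [sin _ * cos _ + _]addrC.
Qed.

Lemma cexp0 : cexp 0 = 1 :> C.
Proof. by rewrite /cexp /= expR0 cos0 sin0 mul1r. Qed.

Lemma nm_cexp z : nm (cexp z) = expR (complex.Re z).
Proof.
rewrite /cexp nmM nm_real ger0_norm ?expR_ge0 //.
by rewrite /nm normc_def /= cos2Dsin2 sqrtr1 mulr1.
Qed.

Lemma cexp_neq0 z : cexp z != 0.
Proof. by rewrite -nm_gt0 nm_cexp expR_gt0. Qed.

Lemma cexpN z : cexp (- z) = (cexp z)^-1.
Proof. by apply: (mulfI (cexp_neq0 z)); rewrite -cexpD subrr cexp0 mulfV ?cexp_neq0. Qed.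

Lemma cexpB z w : cexp (z - w) = cexp z / cexp w.
Proof. by rewrite cexpD cexpN. Qed.

Lemma cexp_sum (T : Type) (s : seq T) (P : pred T) (F : T -> C) :
  cexp (\sum_(i <- s | P i) F i) = \prod_(i <- s | P i) cexp (F i).
Proof. exact: (big_morph _ cexpD cexp0). Qed.

Lemma cexpMn z n : cexp (n%:R * z) = cexp z ^+ n.
Proof. by elim: n => [|n IH]; rewrite ?mul0r ?cexp0 // exprS -IH -cexpD -[n.+1]add1n natrD mulrDl mul1r. Qed.

Lemma cexpMz z (m : int) : cexp (m%:~R * z) = cexp z ^ m.
Proof.
case: m => n; first by rewrite cexpMn.
by rewrite NegzE mulrNz mulNr cexpN cexpMn.
Qed.

Lemma cexp_2pii (m : int) : cexp (twopii R * m%:~R) = 1.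
Proof.
rewrite mulrC cexpMz.
have -> : cexp (twopii R) = 1; last by rewrite exp1rz.
by rewrite /cexp /= expR0 cos2pi sin2pi mulr1.
Qed.

Lemma cexp_pii : cexp (0 +i* pi : C) = -1.
Proof. by rewrite /cexp /= expR0 cospi sinpi mul1r -[RHS]/((-1) -i* 0) oppr0. Qed.

Let term z k := z ^+ k / (k`!)%:R : C.

Lemma nm_exp_term z k : nm (term z k) = exp_coeff (nm z) k.
Proof. by rewrite /term nmM nmX nmV nm_nat. Qed.

Lemma sum_fset_seq (V : nmodType) (I : choiceType) (r : seq I) (F : I -> V) : uniq r ->
  \sum_(i <- [fset x in r]%fset) F i = \sum_(i <- r) F i.
Proof. by move=> ur; apply: perm_big; apply: uniq_perm; rewrite ?fset_uniq // => x; rewrite !inE. Qed.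

Definition below (n : nat) : {fset nat} := [fset k in iota 0 n]%fset.

Lemma in_below n k : (k \in below n) = (k < n)%N.
Proof. by rewrite !inE mem_iota add0n. Qed.

Lemma sum_below (V : nmodType) n (F : nat -> V) : \sum_(k <- below n) F k = \sum_(k < n) F k.
Proof. by rewrite sum_fset_seq ?iota_uniq // -(big_mkord xpredT F) /index_iota subn0. Qed.

Lemma below_cofinal (A : {fset nat}) : exists N, forall n, (N <= n)%N -> (A `<=` below n)%fset.
Proof.
exists (\max_(k <- A) k).+1 => n hn; apply/fsubsetP => k kA; rewrite in_below.
by apply: leq_trans hn; rewrite ltnS; apply: leq_bigmax_seq.
Qed.

Lemma exp_term_sum_le (x : R) (A : {fset nat}) : 0 <= x ->
  \sum_(k <- A) exp_coeff x k <= expR x.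
Proof.
move=> x0; have [N hN] := below_cofinal A.
apply: (@le_trans _ _ (series (exp_coeff x) N)).
  rewrite /series /= big_mkord -sum_below; apply: sum_fset_le (hN _ (leqnn _)) => k.
  exact: exp_coeff_ge0.
rewrite /expR; apply: nondecreasing_cvgn_le; last exact: is_cvg_series_exp_coeff.
by apply: nondecreasing_series => i _ _; apply: exp_coeff_ge0.
Qed.

Lemma summ_exp z : summ (term z).
Proof.
exists (expR (nm z)) => A; under eq_bigr do rewrite nm_exp_term.
exact/exp_term_sum_le/nm_ge0.
Qed.

Let E z : C := csum (term z).

Let cvgE z : ((fun n => \sum_(k < n) term z k : C^o) @ \oo --> (E z : C^o))%classic.
Proof.
have := cvgs_has_sum (has_csum (summ_exp z)) below_cofinal.
by under [X in (X @ _ --> _)%classic -> _]eq_fun do rewrite sum_below.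
Qed.

Let E_real (x : R) : E x%:C = (expR x)%:C.
Proof.
refine (@cvgs_unique R (fun n => \sum_(k < n) term x%:C k) _ _ (@cvgE x%:C) _).
have -> : (fun n => \sum_(k < n) term x%:C k : C^o) = fun n => (series (exp_coeff x) n)%:C.
  apply/funext => n; rewrite /series /= rmorph_sum big_mkord; apply: eq_bigr => k _.
  by rewrite /term /exp_coeff /= rmorphM rmorphXn fmorphV rmorph_nat.
exact/cvgs_real/is_cvg_series_exp_coeff.
Qed.

Let expri (n : nat) : ('i%C : C) ^+ n = ((~~ odd n)%:R * (-1) ^+ n./2 : R)%:C + 'i%C * ((odd n)%:R * (-1) ^+ n.-1./2)%:C.
Proof.
rewrite -{1}[n]odd_double_half exprD -mul2n exprM sqr_i.
case: (boolP (odd n)) => on /=; rewrite !mul1r !mul0r ?rmorph0 ?mulr0 ?addr0 ?add0r rmorphXn rmorphN1 ?mul1r //.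
by rewrite expr1; case: n on => //= n on; rewrite uphalf_half (negPf on) add0n.
Qed.

Let E_imag (y : R) : E ('i%C * y%:C) = (cos y)%:C + 'i%C * (sin y)%:C.
Proof.
refine (@cvgs_unique R (fun n => \sum_(k < n) term ('i%C * y%:C) k) _ _ (@cvgE _) _).
have -> : (fun n => \sum_(k < n) term ('i%C * y%:C) k : C^o) =
    fun n => (series (cos_coeff y) n)%:C + ('i%C : C^o) * (series (sin_coeff y) n)%:C.
  apply/funext => n; rewrite /series /= !rmorph_sum !big_mkord mulr_sumr -big_split.
  apply: eq_bigr => k _ /=; rewrite /term exprMn expri /cos_coeff /sin_coeff /=.
  by rewrite !rmorphM /= !rmorphXn /= !fmorphV !rmorph_nat; ring.
apply: (@cvgD _ C^o).
  by apply: cvgs_real; rewrite cos.unlock; apply: is_cvg_series_cos_coeff.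
apply: (@cvgMl_tmp C); by apply: cvgs_real; rewrite sin.unlock; apply: is_cvg_series_sin_coeff.
Qed.

Let ED z w : E (z + w) = E z * E w.
Proof.
pose F (p : nat * nat) := term z p.1 * term w p.2.
(* [G] sorts the products by total degree [p.1], so that its row n is the binomial expansion of (z +
   w)^n / n!. *)
pose G (p : nat * nat) := if (p.2 <= p.1)%N then term z (p.1 - p.2) * term w p.2 else 0.
pose h (p : nat * nat) := (p.1 + p.2, p.2)%N.
have hi : injective h by move=> [a b] [c d] [/= e1 e2]; rewrite -e2 in e1 *; move/addIn: e1 => ->.
have hG p : G p != 0 -> exists p', h p' = p.
  case: p => a b; rewrite /G /=; case: ifP => [le _|]; last by rewrite eqxx.
  by exists (a - b, b)%N; rewrite /h /= subnK.
have GF p : G (h p) = F p by case: p => a b; rewrite /G /F /h /= leq_addl addnK.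
have hF : has_sum F (E z * E w) by apply: has_sumM; try exact: summ_exp; exact: has_csum (summ_exp _).
have sG : summ G.
  apply: (summ_inj_inv hi hG); have -> : (fun j => G (h j)) = F by apply/funext.
  exact: summM (summ_exp _) (summ_exp _).
have hG2 : has_sum G (E z * E w).
  by apply/(has_sum_inj _ hi hG); apply: eq_has_sum hF => p; rewrite GF.
apply: has_sum_unique (has_sum_fubini sG hG2).
apply: eq_has_sum (has_csum (summ_exp _)) => n.
rewrite (csumE (has_sum_finite (A := below n.+1) _)) => [|k]; last first.
  by rewrite in_below ltnS /G /= => /negPf ->.
rewrite sum_below /term exprDn mulr_suml; apply: eq_bigr => k _.
have kn : (k <= n)%N by rewrite -ltnS.
rewrite /G /= kn -(bin_fact kn) !natrM -[_ *+ 'C(n, k)]mulr_natr.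
have fn m : (m`!)%:R != 0 :> C by rewrite pnatr_eq0 -lt0n fact_gt0.
have bn : 'C(n, k)%:R != 0 :> C by rewrite pnatr_eq0 -lt0n bin_gt0.
by rewrite /term; field; rewrite !fn bn.
Qed.

(** [cexp] is built from [expR], [cos] and [sin]. The series is multiplicative and agrees with these
    on the real and imaginary axes, hence everywhere, as z = Re z + i Im z. *)
Lemma has_sum_cexp z : has_sum (term z) (cexp z).
Proof.
suff -> : cexp z = E z by apply: has_csum (summ_exp z).
by rewrite cexpE [z in E z]complexE ED E_real E_imag.
Qed.

Lemma cvgs_cexp_series z :
  ((fun n => \sum_(k < n) z ^+ k / (k`!)%:R : C^o) @ \oo --> (cexp z : C^o))%classic.
Proof. by rewrite -(csumE (@has_sum_cexp z)); exact: cvgE. Qed.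

(** After the first two terms a factor z^2 comes out, and 1/(k+2)! <= 1/k! bounds the rest by the
    full series. *)
Lemma cexp_quad z : nm (cexp z - 1 - z) <= nm z ^+ 2 * expR (nm z).
Proof.
have hs := @has_sum_cexp z; have := @nm_has_sum _ _ _ _ (below 2) (nm z ^+ 2 * expR (nm z)) hs.
rewrite sum_below big_ord_recr big_ord1 /= /term expr0 fact0 divr1 expr1 divr1 opprD addrA; apply.
move=> A /fdisjointP dA; under eq_bigr do rewrite nm_exp_term.
have h2 : injective (fun k => k.+2) by move=> ? ? [].
pose B := [fset k.-2 | k in A]%fset.
have -> : \sum_(k <- A) exp_coeff (nm z) k = \sum_(k <- B) exp_coeff (nm z) k.+2.
  rewrite -(sum_imfset B (exp_coeff (nm z)) h2); apply: eq_fbigl => k; apply/idP/imfsetP => [kA|[j /imfsetP[i iA ->] ->]].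
    exists k.-2; first by apply/imfsetP; exists k.
    by have := dA _ kA; rewrite in_below; case: k kA => [|[]].
  by have := dA _ iA; rewrite in_below; case: i iA => [|[]].
apply: le_trans (ler_wpM2l (exprn_ge0 2 (nm_ge0 z)) (exp_term_sum_le B (nm_ge0 z))).
rewrite mulr_sumr; apply: ler_sum => k _; rewrite /exp_coeff /= -addn2 addnC exprD -mulrA.
apply: ler_wpM2l; first exact: exprn_ge0 (nm_ge0 z).
apply: ler_wpM2l; first exact: exprn_ge0 (nm_ge0 z).
by rewrite lef_pV2 ?posrE ?ltr0n ?fact_gt0 // ler_nat !factS mulnA leq_pmull.
Qed.

End ComplexExponential.

(** * Geometric bounds for sums over the integers *)

Section LatticeSums.
Variable R : realType.
Local Notation C := R[i].

Lemma geometric_sum_le (r : R) (A : {fset nat}) : 0 <= r < 1 ->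
  \sum_(k <- A) r ^+ k <= (1 - r)^-1.
Proof.
move=> /andP[r0 r1]; have [N hN] := below_cofinal A.
apply: le_trans (sum_fset_le _ (hN N (leqnn N))) _ => [k|]; first exact: exprn_ge0.
rewrite sum_below; have h : 0 < 1 - r by rewrite subr_gt0.
rewrite -[X in _ <= X]mul1r ler_pdivlMr // mulrC -opprB mulNr -subrX1 opprB.
by rewrite gerBl exprn_ge0.
Qed.

Lemma summ_int_exp (F : int -> C) (K c : R) : 0 < c ->
  (forall n, nm (F n) <= K * expR (- c * `|n%:~R|)) -> summ F.
Proof.
move=> c0 hF; pose r := expR (- c).
have r01 : 0 <= r < 1 by rewrite expR_ge0 expR_lt1 oppr_lt0.
(* Sign and absolute value embed the integers into two copies of the naturals, each carrying a
   geometric series. *)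
pose h (n : int) := (n < 0, absz n).
have hi : injective h by move=> [m|m] [n|n] //= [] -> .
pose G (p : bool * nat) : C := (r ^+ p.2)%:C.
have sG : summ G.
  apply: (@summ_pair _ _ _ _ (fun=> (1 - r)^-1) (2 * (1 - r)^-1)) => [b B|A].
    apply: le_trans (geometric_sum_le B r01); apply: ler_sum => k _.
    by rewrite nm_real ger0_norm // exprn_ge0 // (andP r01).1.
  have r1 : 0 <= (1 - r)^-1 by rewrite invr_ge0 subr_ge0 ltW // (andP r01).2.
  apply: (@le_trans _ _ (\sum_(i <- [fset true; false]%fset) (1 - r)^-1)).
    by apply: sum_fset_le => //; apply/fsubsetP => -[] _; rewrite !inE.
  by rewrite big_fsetU1 ?inE // big_seq_fset1 mulr_natl mulr2n.
apply: (@summ_le _ _ _ (fun n => G (h n)) K); first exact: summ_inj hi sG.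
move=> n; apply: le_trans (hF n) _; rewrite nm_real (ger0_norm (exprn_ge0 _ (andP r01).1)).
by rewrite /r -expRM_natr /= natr_absz intr_norm.
Qed.

Lemma int_sqr_le_exp (n : int) : (n%:~R : R) ^+ 2 <= 2 * expR `|n%:~R|.
Proof.
have := @expR_ge1Dxn R `|n%:~R| 1 (normr_ge0 _); rewrite real_normK ?num_real //.
by have := expR_ge0 (`|n%:~R| : R); have -> : (2`!%:R : R) = 2 by []; lra.
Qed.

Lemma Re_realM (x : R) (z : C) : complex.Re (x%:C * z) = x * complex.Re z.
Proof. by case: z => a b; simpc. Qed.

Lemma Re_intM (n : int) (z : C) : complex.Re (n%:~R * z) = n%:~R * complex.Re z.
Proof. by rewrite -(rmorph_int (real_complex R)) Re_realM. Qed.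

End LatticeSums.

(** * Derivatives through second-order Taylor bounds *)

Section QuadraticApproximation.
Variable R : realType.
Local Notation C := R[i].

(** A quantitative form of differentiability at z with derivative l. It can be checked termwise on
    series, is stable under products, and yields the derivative as well as limits along
    sequences. *)
Definition quad (f : C -> C) (z l : C) := exists K : R, forall h : C,
  nm h <= 1 -> nm (f (z + h) - f z - h * l) <= K * nm h ^+ 2.

Lemma quad_derive f z l : quad f z l -> is_derive (z : C^o) (1 : C^o) (f : C^o -> C^o) (l : C^o).
Proof.
move=> [K hK].
have h : ((fun h : C^o => h^-1 *: (((f : C^o -> C^o) \o shift (z : C^o)) (h *: (1 : C^o)) - f z) : C^o) @ (0 : C^o)^' --> (l : C^o))%classic.
  apply/cvgrPdist_lt => e e0; have [e1 e2] : e = (complex.Re e)%:C /\ 0 < complex.Re e.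
    by move: e0; case: e => a b; rewrite ltcE /= => /andP[/eqP-> ->].
  set d : R := complex.Re e in e1 e2.
  have K1 : 0 < `|K| + 1 by rewrite ltr_wpDl.
  pose d' := Num.min 1 (d / (`|K| + 1)).
  have d'0 : 0 < d' by rewrite lt_min ltr01 divr_gt0.
  have d'C : 0 < d'%:C :> C by rewrite ltcR.
  near=> h; have h0 : h != 0 by near: h; exact: nbhs_dnbhs_neq.
  have hd : nm h < d' by rewrite -ltcR -nmE; near: h; exact: dnbhs0_lt.
  have [h1 h2] : nm h < 1 /\ nm h < d / (`|K| + 1) by move: hd; rewrite lt_min => /andP[].
  rewrite nmE e1 ltcR /=.
  have -> : l - h^-1 *: (f (h *: (1 : C^o) + z) - f z) = - (h^-1 * (f (z + h) - f z - h * l)).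
    have -> : h *: (1 : C^o) = h by exact: mulr1.
    rewrite [z + h]addrC; move: (f _) (f _) => a b; rewrite /GRing.scale /=.
    by field.
  rewrite nmN nmM nmV mulrC ltr_pdivrMr ?nm_gt0 //.
  apply: le_lt_trans (hK h (ltW h1)) _; rewrite expr2 mulrA ltr_pM2r ?nm_gt0 //.
  apply: (@le_lt_trans _ _ ((`|K| + 1) * nm h)).
    by apply: ler_wpM2r; [exact: nm_ge0|have := ler_norm K; lra].
  by rewrite mulrC -ltr_pdivlMr.
by apply: DeriveDef; [apply/cvg_ex; exists l|exact: (@cvg_lim C^o (@norm_hausdorff _ _) _ _ _ _ l h)].
Unshelve. all: by end_near.
Qed.

Lemma quad_cvg f z l (u : nat -> C) : quad f z l -> 
  ((u : nat -> C^o) @ \oo --> (0 : C^o))%classic ->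
  ((fun n => f (z + u n) : C^o) @ \oo --> (f z : C^o))%classic.
Proof.
move=> [K hK] /cvgsP hu; apply/cvgsP => e e0.
have K1 : 0 < `|K| + nm l + 1 by rewrite ltr_wpDl // addr_ge0 // nm_ge0.
pose d' := Num.min 1 (e / (`|K| + nm l + 1)).
have d'0 : 0 < d' by rewrite lt_min ltr01 divr_gt0.
have [N hN] := hu _ d'0; exists N => n /hN; rewrite sub0r nmN lt_min => /andP[h1].
rewrite ltr_pdivlMr // => h2; rewrite nmB.
have -> : f (z + u n) - f z = (f (z + u n) - f z - u n * l) + u n * l by ring.
apply: le_lt_trans (nmD _ _) _; rewrite nmM.
have := hK (u n) (ltW h1); have := nm_ge0 (u n); have := nm_ge0 l; have := ler_norm K.
set x := nm (u n) in h1 h2 *; set y := nm l in h2 *; move: (nm _) => t.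
move=> a1 a2 a3 a4; have : K * x ^+ 2 <= `|K| * x.
  apply: (@le_trans _ _ (`|K| * x ^+ 2)); first by rewrite ler_wpM2r // sqr_ge0.
  by rewrite ler_wpM2l // expr2 ler_piMr // ltW.
nra.
Qed.

Lemma quad_slope f z l (u : nat -> C) : quad f z l -> (forall n, u n != 0) ->
  ((u : nat -> C^o) @ \oo --> (0 : C^o))%classic ->
  ((fun n => (f (z + u n) - f z) / u n : C^o) @ \oo --> (l : C^o))%classic.
Proof.
move=> [K hK] u0 /cvgsP hu; apply/cvgsP => e e0.
have K1 : 0 < `|K| + 1 by rewrite ltr_wpDl.
pose d' := Num.min 1 (e / (`|K| + 1)).
have d'0 : 0 < d' by rewrite lt_min ltr01 divr_gt0.
have [N hN] := hu _ d'0; exists N => n /hN; rewrite sub0r nmN lt_min => /andP[h1].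
rewrite ltr_pdivlMr // => h2; rewrite nmB.
have -> : (f (z + u n) - f z) / u n - l = (f (z + u n) - f z - u n * l) / u n.
  by field; rewrite u0.
rewrite nmM nmV ltr_pdivrMr ?nm_gt0 //.
apply: le_lt_trans (hK _ (ltW h1)) _; rewrite expr2 mulrA ltr_pM2r ?nm_gt0 //.
apply: le_lt_trans h2; rewrite mulrC ler_wpM2l ?nm_ge0 //.
by have := ler_norm K; lra.
Qed.

Lemma quad_cexpM (c z : C) : quad (fun w => cexp (c * w)) z (c * cexp (c * z)).
Proof.
exists (nm (cexp (c * z)) * (nm c ^+ 2 * expR (nm c))) => h h1.
have -> : cexp (c * (z + h)) - cexp (c * z) - h * (c * cexp (c * z)) =
  cexp (c * z) * (cexp (c * h) - 1 - c * h) by rewrite mulrDr cexpD; ring.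
rewrite nmM -[X in _ <= X]mulrA ler_wpM2l ?nm_ge0 //; apply: le_trans (cexp_quad _) _.
rewrite nmM exprMn [X in _ <= X]mulrAC; apply: ler_wpM2l.
  by rewrite mulr_ge0 ?exprn_ge0 ?nm_ge0.
by rewrite ler_expR ler_piMr ?nm_ge0.
Qed.

Lemma quad_cexp (z : C) : quad (@cexp R) z (cexp z).
Proof.
have -> : @cexp R = fun w => cexp (1 * w) by apply/funext => w; rewrite mul1r.
by have := quad_cexpM 1 z; rewrite (mul1r (cexp _)).
Qed.

Lemma quad_cst (c z : C) : quad (fun=> c) z 0.
Proof. by exists 0 => h _; rewrite subrr mulr0 subr0 nm0 mul0r. Qed.

Lemma quadM (f g : C -> C) (z l m : C) : quad f z l -> quad g z m ->
  quad (fun w => f w * g w) z (f z * m + g z * l).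
Proof.
move=> [K hK] [M hM].
exists (nm l * nm m + (nm (f z) + nm l) * `|M| + `|K| * (nm (g z) + nm m + `|M|)) => h h1.
set r := f (z + h) - f z - h * l; set s := g (z + h) - g z - h * m.
have -> : f (z + h) * g (z + h) - f z * g z - h * (f z * m + g z * l) =
  h ^+ 2 * (l * m) + ((f z + h * l) * s + r * (g z + h * m + s)).
  by rewrite /r /s; ring.
have x0 := nm_ge0 h; set x := nm h in h1 x0 *.
have hr : nm r <= `|K| * x ^+ 2.
  by apply: le_trans (hK h h1) _; rewrite ler_wpM2r ?exprn_ge0 // ler_norm.
have hs : nm s <= `|M| * x ^+ 2.
  by apply: le_trans (hM h h1) _; rewrite ler_wpM2r ?exprn_ge0 // ler_norm.
have x2 : x ^+ 2 <= 1 by rewrite expr_le1.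
have hs1 : nm s <= `|M| by apply: le_trans hs _; rewrite ler_piMr.
have hxl t : nm (h * t) <= nm t by rewrite nmM ler_piMl ?nm_ge0.
set B := (nm (f z) + nm l) * `|M|; set D := `|K| * (nm (g z) + nm m + `|M|).
have -> : (nm l * nm m + B + D) * x ^+ 2 = nm l * nm m * x ^+ 2 + (B * x ^+ 2 + D * x ^+ 2) by ring.
apply: le_trans (nmD _ _) _; apply: lerD.
  by rewrite [nm (_ * _)]nmM nmX [nm (l * m)]nmM mulrC.
apply: le_trans (nmD _ _) _; apply: lerD.
  rewrite nmM -mulrA; apply: ler_pM; rewrite ?nm_ge0 //.
  by apply: le_trans (nmD _ _) _; rewrite lerD2l.
rewrite nmM mulrAC; apply: ler_pM; rewrite ?nm_ge0 //.
by do 2!(apply: le_trans (nmD _ _) _; apply: lerD => //).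
Qed.

Lemma cvgs_inv_succ (d : R) : ((fun n => (d / n.+1%:R)%:C : C^o) @ \oo --> (0 : C^o))%classic.
Proof.
rewrite -[0]/((0 : R)%:C); apply: cvgs_real; rewrite -(mulr0 d).
by apply: cvgMl_tmp; exact: (@cvg_harmonic R).
Qed.

Lemma cvgs_cexp (u : nat -> C) (z : C) : ((u : nat -> C^o) @ \oo --> (z : C^o))%classic ->
  ((fun n => cexp (u n) : C^o) @ \oo --> (cexp z : C^o))%classic.
Proof.
move=> hu.
have -> : (fun n => cexp (u n) : C^o) = fun n => cexp (z + (u n - z)).
  by apply/funext => n; rewrite addrC subrK.
apply: (quad_cvg (quad_cexp z)); apply/cvgsP => e /((cvgsP _ _).1 hu)[N hN].
by exists N => n /hN; rewrite sub0r opprB.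
Qed.

End QuadraticApproximation.

(** * Theta series, reflection and quasi-periodicity *)

(** * Theta functions *)
Section Theta.
Variable R : realType.
Local Notation C := R[i].
Variable tau : C.
Hypothesis tau_gt0 : 0 < complex.Im tau.

Definition ipi : C := 0 +i* pi.

Lemma twopiiE : twopii R = 2 * ipi.
Proof. by apply/eqP; rewrite mulr_natl eq_complex !mulr2n /= addr0 !eqxx. Qed.

Lemma cexp_ipi : cexp ipi = -1 :> C. Proof. exact: cexp_pii. Qed.

Lemma cexp_2ipi (m : int) : cexp (2 * ipi * m%:~R) = 1.
Proof. by rewrite -twopiiE cexp_2pii. Qed.

(** Minus the logarithm of |q|, hence the width in Re u of a fundamental annulus. *)
Definition nome_rate : R := 2 * pi * complex.Im tau.
Local Notation L := nome_rate.

Lemma Re_ipi (x : C) : complex.Re (ipi * x) = - pi * complex.Im x.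
Proof. by case: x => a b; rewrite /ipi; simpc. Qed.

Lemma nome_rate_gt0 : 0 < L.
Proof. by rewrite /nome_rate !mulr_gt0 // pi_gt0. Qed.

Lemma Re_2ipitau (m : int) : complex.Re (2 * ipi * tau * m%:~R) = - L * m%:~R.
Proof.
rewrite mulrC Re_intM; have -> : 2 * ipi * tau = ipi * tau + ipi * tau by ring.
by rewrite raddfD /= Re_ipi /nome_rate; ring.
Qed.

(** The term (-1)^n q^(n(n+1)/2) e^(nz). Up to the factor e^(z/2) and a constant its sum is the
    theta function of characteristics (1/2, 1/2), but all exponents of e^z are integers, which suits
    Cauchy products. *)
Definition tht (n : int) (z : C) : C :=
  cexp (n%:~R * ipi + ipi * tau * (n%:~R * (n%:~R + 1)) + n%:~R * z).

Definition th (z : C) : C := csum (tht^~ z).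

Lemma nm_tht n z : nm (tht n z) =
  expR (- (L / 2) * (n%:~R * (n%:~R + 1)) + n%:~R * complex.Re z).
Proof.
rewrite /tht nm_cexp; congr expR; rewrite !raddfD /=.
have -> : complex.Re (n%:~R * ipi) = 0 by rewrite Re_intM /= mulr0.
rewrite add0r; congr (_ + _); last by rewrite Re_intM.
have -> : (n%:~R : C) * (n%:~R + 1) = (n * (n + 1))%:~R by rewrite intrM intrD.
rewrite mulrC Re_intM Re_ipi intrM intrD /nome_rate; by field.
Qed.

Lemma tht_bound (B c : R) : exists K : R, forall (n : int) z, `|complex.Re z| <= B ->
  nm (tht n z) <= K * expR (- c * `|n%:~R|).
Proof.
have a0 : 0 < L / 2 by rewrite divr_gt0 // nome_rate_gt0.
set a := L / 2 in a0 *; exists (expR ((a + B + c) ^+ 2 / (4 * a))) => n z hz.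
rewrite nm_tht -expRD ler_expR -/a.
set x : R := n%:~R; have hx : x * complex.Re z <= B * `|x|.
  apply: le_trans (ler_norm _) _; rewrite normrM mulrC ler_wpM2r //.
have h2 : - a * x <= a * `|x| by have := ler_norm (- x); rewrite normrN; nra.
have h3 : x ^+ 2 = `|x| ^+ 2 by rewrite real_normK ?num_real.
set y := `|x| in hx h2 h3 *.
(* Completing the square in - a y^2 + (a + B + c) y; its maximum is the exponent of the witness
   above. The Gaussian thus beats any linear rate [c]. *)
have h4 : 0 <= a * (y - (a + B + c) / (2 * a)) ^+ 2 by rewrite mulr_ge0 ?sqr_ge0 // ltW.
have h5 : a * (y - (a + B + c) / (2 * a)) ^+ 2 = a * y ^+ 2 - (a + B + c) * y + (a + B + c) ^+ 2 / (4 * a).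
  by field; lra.
have h6 : - a * (x * (x + 1)) = - a * x ^+ 2 - a * x by ring.
rewrite h6 h3; nra.
Qed.

Lemma summ_tht z : summ (tht^~ z).
Proof.
have [K hK] := tht_bound `|complex.Re z| 1.
by apply: (@summ_int_exp _ _ K 1) => // n; apply: hK.
Qed.

Definition dth (z : C) : C := csum (fun n : int => n%:~R * tht n z).

Lemma thtD n z w : tht n (z + w) = tht n z * cexp (n%:~R * w).
Proof. by rewrite /tht -cexpD; congr cexp; ring. Qed.

Lemma nm_int (n : int) : nm (n%:~R : C) = `|n%:~R|.
Proof. by rewrite -(rmorph_int (real_complex R)) nm_real. Qed.

Lemma int_le_exp (n : int) : (`|n%:~R| : R) <= expR `|n%:~R|.
Proof. by have := @expR_ge1Dx R `|n%:~R|; lra. Qed.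

Lemma th_quad z : quad th z (dth z).
Proof.
(* With y = |n|, the rate 4 pays for y^2 <= 2 e^y and for the bound e^(2y) on the exponential
   remainder, and still leaves the summable rate 1. *)
have [K hK] := tht_bound `|complex.Re z| 4.
pose b (n : int) : C := (2 * K * expR (- 1 * `|n%:~R|))%:C.
have K0 : 0 <= K.
  by have := hK 0 z (lexx _); rewrite mulr0z normr0 mulr0 expR0 mulr1; apply: le_trans (nm_ge0 _).
have b0 n : 0 <= 2 * K * expR (- 1 * `|n%:~R|) :> R by rewrite !mulr_ge0 // expR_ge0.
have [M hM] : summ b.
  by apply: (@summ_int_exp _ _ (2 * K) 1) => // n; rewrite nm_real ger0_norm.
exists M => h h1.
have sd : summ (fun n : int => n%:~R * tht n z).
  apply: (@summ_int_exp _ _ K 1) => // n; rewrite nmM nm_int.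
  apply: (@le_trans _ _ (expR `|n%:~R| * (K * expR (- 4 * `|n%:~R|)))).
    by apply: ler_pM; rewrite ?normr_ge0 ?nm_ge0 ?int_le_exp ?hK.
  rewrite mulrCA ler_wpM2l // -expRD ler_expR.
  by have := normr_ge0 (n%:~R : R); lra.
have hs := has_sumD (has_sumD (has_csum (summ_tht (z + h))) (has_sumZ (-1) (has_csum (summ_tht z))))
   (has_sumZ (- h) (has_csum sd)).
have -> : th (z + h) - th z - h * dth z = csum (tht^~ (z + h)) + -1 * csum (tht^~ z) + - h * csum (fun n : int => n%:~R * tht n z).
  by rewrite /th /dth; ring.
apply: (nm_has_sum_le hs) => A; rewrite mulrC.
apply: le_trans (ler_wpM2l (exprn_ge0 2 (nm_ge0 h)) (hM A)); rewrite mulr_sumr.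
apply: ler_sum => n _; rewrite nm_real ger0_norm // thtD.
have -> : tht n z * cexp (n%:~R * h) + -1 * tht n z + - h * (n%:~R * tht n z) = tht n z * (cexp (n%:~R * h) - 1 - n%:~R * h) by ring.
rewrite nmM; apply: le_trans (ler_pM (nm_ge0 _) (nm_ge0 _) (hK n z (lexx _)) (cexp_quad _)) _.
rewrite !nmM nm_int exprMn; set y := `|n%:~R|.
have y0 : 0 <= y by exact: normr_ge0.
have e1 : expR (y * nm h) <= expR y by rewrite ler_expR ler_piMr.
have e2 : y ^+ 2 <= 2 * expR y by have := @int_sqr_le_exp R n; rewrite -real_normK ?num_real.
have -> : expR (-1 * y) = expR (- 4 * y) * (expR y * (expR y * expR y)) by rewrite -!expRD; congr expR; ring.
have e3 := expR_ge0 (- 4 * y); have e4 := expR_ge0 y.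
have -> : K * expR (- 4 * y) * (y ^+ 2 * nm h ^+ 2 * expR (y * nm h)) =
   (K * expR (- 4 * y) * nm h ^+ 2) * (y ^+ 2 * expR (y * nm h)) by ring.
have -> : nm h ^+ 2 * (2 * K * (expR (- 4 * y) * (expR y * (expR y * expR y)))) =
  (K * expR (- 4 * y) * nm h ^+ 2) * ((2 * expR y) * (expR y * expR y)) by ring.
apply: ler_wpM2l; first by rewrite !mulr_ge0 ?exprn_ge0 ?nm_ge0.
apply: ler_pM; rewrite ?exprn_ge0 ?expR_ge0 //.
by apply: le_trans e1 _; rewrite ler_peMr // -expR0 ler_expR.
Qed.

(** The involution n -> -1 - n preserves n(n+1) and reverses the sign (-1)^n. *)
Lemma thN z : th (- z) = - cexp z * th z.
Proof.
pose h (n : int) : int := - 1 - n.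
have hK : involutive h by move=> n; rewrite /h; lia.
have H := has_sumZ (- cexp z) (has_csum (summ_tht z)).
apply: csumE; apply/(has_sum_inj _ (inv_inj hK)) => [i _|]; first by exists (h i).
apply: eq_has_sum H => n; rewrite /tht.
have -> : (h n)%:~R = -1 - n%:~R :> C by rewrite intrB.
have -> : - cexp z = cexp (ipi + z) by rewrite cexpD cexp_ipi mulN1r.
rewrite -!cexpD -[LHS]mulr1 -[X in _ * X = _](cexp_2ipi (- 1 - n)) -cexpD intrB.
by congr cexp; ring.
Qed.

Lemma th0 : th 0 = 0.
Proof. by have := thN 0; rewrite oppr0 cexp0 mulN1r => /eqP; rewrite -addr_eq0 -mulr2n mulrn_eq0 => /eqP. Qed.

Lemma th_quasi z : th (z + 2 * ipi * tau) = - cexp (- z - 2 * ipi * tau) * th z.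
Proof.
pose h (n : int) : int := n + 1.
have hi : injective h by move=> n m; rewrite /h; lia.
have hF (F : int -> C) i : F i != 0 -> exists j, h j = i by exists (i - 1); rewrite /h; lia.
have H : has_sum (fun n => - cexp (- z - 2 * ipi * tau) * tht (h n) z) (- cexp (- z - 2 * ipi * tau) * th z).
  by apply: has_sumZ; apply/(has_sum_inj _ hi (hF (tht^~ z))); apply: has_csum (summ_tht z).
apply: csumE; apply: eq_has_sum H => n; rewrite /tht /h.
have -> : - cexp (- z - 2 * ipi * tau) = cexp (ipi + (- z - 2 * ipi * tau)) by rewrite cexpD cexp_ipi mulN1r.
rewrite -!cexpD -[RHS]mulr1 -[X in _ = _ * X](cexp_2ipi 1) -cexpD intrD.
by congr cexp; ring.
Qed.

Lemma theta_summand (a b : R) (z : C) (n : int) :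
  cexp (ipi * (n%:~R + a%:C) ^+ 2 * tau + (n%:~R + a%:C) * (z + twopii R * b%:C)) =
  cexp (ipi * tau * a%:C ^+ 2 + a%:C * (z + 2 * ipi * b%:C)) *
  tht n (z + 2 * ipi * (b%:C - 1 / 2) + 2 * ipi * tau * (a%:C - 1 / 2)).
Proof. by rewrite /tht -cexpD twopiiE; congr cexp; field. Qed.

Lemma thetaE (a b : R) (z : C) : theta a b z tau =
  cexp (ipi * tau * a%:C ^+ 2 + a%:C * (z + 2 * ipi * b%:C)) *
  th (z + 2 * ipi * (b%:C - 1 / 2) + 2 * ipi * tau * (a%:C - 1 / 2)).
Proof.
apply: csumE; apply: eq_has_sum (has_sumZ _ (has_csum (summ_tht _))) => n.
by rewrite -theta_summand.
Qed.

Lemma theta11E (z : C) : theta (1 / 2) (1 / 2) z tau = cexp (ipi * tau / 4 + ipi / 2) * (cexp (z / 2) * th z).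
Proof.
have h2 : (1 / 2 : R)%:C = 1 / 2 :> C by rewrite rmorphM /= fmorphV rmorph_nat rmorph1.
rewrite thetaE h2 subrr !mulr0 !addr0 mulrA -cexpD; by congr (cexp _ * _); field.
Qed.

Lemma theta11_derive : is_derive (0 : C^o) (1 : C^o)
  (fun w : C^o => theta (1 / 2) (1 / 2) w tau : C^o) (cexp (ipi * tau / 4 + ipi / 2) * dth 0).
Proof.
apply: quad_derive; set c := cexp _.
have -> : (fun w => theta (1 / 2) (1 / 2) w tau) = fun w => c * (cexp (1 / 2 * w) * th w).
  by apply/funext => w; rewrite theta11E mulrC [w / 2]mulrC mul1r mulrC.
have := quadM (quad_cst c 0) (quadM (quad_cexpM (1 / 2) 0) (th_quad 0)).
by rewrite th0 mulr0 cexp0 !(mul1r, mul0r, mulr0, addr0).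
Qed.

Lemma theta11_derive1 : derive1 (fun w : C^o => theta (1 / 2) (1 / 2) w tau : C^o) 0 =
  cexp (ipi * tau / 4 + ipi / 2) * dth 0.
Proof. by have h := theta11_derive; rewrite derive1E derive_val. Qed.

Lemma prime_formE (z : C) : prime_form z tau = cexp (z / 2) * th z / dth 0.
Proof.
rewrite /prime_form theta11_derive1 theta11E; set c := cexp _.
by rewrite invfM mulrACA mulfV ?cexp_neq0 // mul1r.
Qed.

End Theta.

(** * The two-point kernel *)
Section KroneckerKernel.
Variable R : realType.
Local Notation C := R[i].
Variable tau : C.
Hypothesis tau_gt0 : 0 < complex.Im tau.
Local Notation L := (nome_rate tau).
Local Notation ipi := (ipi R).
Local Notation tht := (tht tau).
Local Notation th := (th tau).
Local Notation dth := (dth tau).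

(* [A] lies outside the period lattice [2 pi i (Z + tau Z)]. *)
Definition gen (A : C) := forall m : int, cexp (A + 2 * ipi * tau * m%:~R) != 1.
(** The geometric factor 1/(1 - e^A q^m) that appears when an operator is carried once around the
    trace. *)
Definition kap (A : C) (m : int) : C := (1 - cexp (A + 2 * ipi * tau * m%:~R))^-1.

Lemma nm_cexp_tau A (m : int) : nm (cexp (A + 2 * ipi * tau * m%:~R)) = expR (complex.Re A - L * m%:~R).
Proof. by rewrite nm_cexp raddfD /= Re_2ipitau mulNr. Qed.

Lemma kapE A m : gen A -> kap A m - 1 = cexp (A + 2 * ipi * tau * m%:~R) * kap A m.
Proof.
move=> gA; have h : 1 - cexp (A + 2 * ipi * tau * m%:~R) != 0 by rewrite subr_eq0 eq_sym gA.
by rewrite /kap; field.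
Qed.

Lemma expR1_ge2 : 2 <= expR 1 :> R.
Proof. by have := expR_ge1Dx (1 : R); lra. Qed.

Lemma kap_bounded A : gen A -> exists2 K : R, 0 <= K & forall m, nm (kap A m) <= K.
Proof.
move=> gA; have L0 := nome_rate_gt0 tau_gt0.
have [N hN] : exists N : nat, (`|complex.Re A| + 1) / L < N%:R.
  by exists (Num.bound ((`|complex.Re A| + 1) / L)); apply: archi_boundP; rewrite divr_ge0 ?addr_ge0 // ltW.
move: hN; rewrite ltr_pdivrMr // => hN.
(* Outside these finitely many m, |e^A q^m| is at most 1/2 or at least 2, so that [kap] has modulus
   at most 2. *)
pose A0 := [fset m in [seq Posz k | k <- iota 0 N] ++ [seq - Posz k | k <- iota 0 N]]%fset.
exists (2 + \sum_(m <- A0) nm (kap A m)).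
  by rewrite addr_ge0 // sumr_ge0 // => i _; apply: nm_ge0.
move=> m; case: (boolP (m \in A0)) => mA.
  rewrite (big_fsetD1 m) //= addrA ler_wpDr ?sumr_ge0 // => [i _|]; first exact: nm_ge0.
  by rewrite lerDr.
rewrite ler_wpDr ?sumr_ge0 // => [i _|]; first exact: nm_ge0.
have hm : (m >= N%:Z) || (m <= - N%:Z).
  move: mA; rewrite !inE negb_or => /andP[/mapP h1 /mapP h2].
  case: m h1 h2 => k h1 h2.
    by apply/orP; left; rewrite lez_nat leqNgt; apply/negP => kN; apply: h1; exists k; rewrite ?mem_iota.
  apply/orP; right; rewrite NegzE lerN2 lez_nat leqNgt; apply/negP => kN; apply: h2; exists k.+1 => //.
  by rewrite mem_iota.
have [e1 | e1] : expR (complex.Re A - L * m%:~R) <= 2^-1 \/ 2 <= expR (complex.Re A - L * m%:~R).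
- have hA := ler_norm (complex.Re A); have hA' := ler_norm (- complex.Re A); rewrite normrN in hA'.
  case/orP: hm => hm; [left|right].
    have h2 : (N%:R : R) <= m%:~R by rewrite -[N%:R]/(N%:Z%:~R) ler_int.
    have -> : 2^-1 = (2 : R)^-1 by [].
    apply: (@le_trans _ _ (expR (- 1))); last by rewrite expRN lef_pV2 ?posrE ?expR_gt0 // expR1_ge2.
    have h3 := ler_wpM2l (ltW L0) h2; rewrite [_ * N%:R]mulrC in h3.
    by rewrite ler_expR; lra.
  have h2 : (m%:~R : R) <= - N%:R by rewrite -[N%:R]/(N%:Z%:~R) -rmorphN /= ler_int.
  have h3 := ler_wpM2l (ltW L0) h2; rewrite mulrN [_ * N%:R]mulrC in h3.
  by apply: le_trans expR1_ge2 _; rewrite ler_expR; lra.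
- rewrite /kap nmV -[X in _ <= X]invrK lef_pV2 ?posrE ?invr_gt0 //; last by rewrite nm_gt0 subr_eq0 eq_sym gA.
  by have := nm_dist 1 (cexp (A + 2 * ipi * tau * m%:~R)); rewrite nm_cexp_tau nm1; lra.
- rewrite /kap nmV -[X in _ <= X]invrK lef_pV2 ?posrE ?invr_gt0 //; last by rewrite nm_gt0 subr_eq0 eq_sym gA.
  by have := nm_dist (cexp (A + 2 * ipi * tau * m%:~R)) 1; rewrite nm_cexp_tau nm1 nmB; lra.
Qed.

Lemma kap_decay A : gen A -> exists2 K : R, 0 <= K &
  forall m : int, [/\ nm (kap A m) <= K, nm (kap A m - 1) <= K,
    nm (kap A m - 1) <= K * expR (- L * m%:~R) & nm (kap A m) <= K * expR (L * m%:~R)].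
Proof.
move=> gA; have [K K0 hK] := kap_bounded gA.
have e1 : 1 <= expR `|complex.Re A| by rewrite -expR0 ler_expR.
have hA := ler_norm (complex.Re A); have hA' := ler_norm (- complex.Re A); rewrite normrN in hA'.
have K1 : K <= (K + 1) * expR `|complex.Re A| by nra.
exists ((K + 1) * expR `|complex.Re A|); first by apply: le_trans K1.
move=> m; have h1 : nm (kap A m - 1) <= K + 1.
  by apply: le_trans (nmD _ _) _; rewrite nmN nm1 lerD2r.
split; [exact: le_trans K1|by nra| |].
  rewrite kapE // nmM nm_cexp_tau mulrC -mulrA -expRD; apply: ler_pM; rewrite ?nm_ge0 ?expR_ge0 ?ler_expR //.
    by apply: le_trans (hK m) _; rewrite lerDl.
  by rewrite mulNr lerD2r.
have -> : kap A m = cexp (- A + 2 * ipi * tau * (- m)%:~R) * (kap A m - 1).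
  rewrite kapE // mulrA -cexpD rmorphN /=.
  have -> : - A + 2 * ipi * tau * - m%:~R + (A + 2 * ipi * tau * m%:~R) = 0 by ring.
  by rewrite cexp0 mul1r.
rewrite nmM nm_cexp_tau mulrC -mulrA -expRD; apply: ler_pM; rewrite ?nm_ge0 ?expR_ge0 ?ler_expR //.
by rewrite raddfN rmorphN /=; lra.
Qed.

(** The two annuli adjacent to |e^u| = 1: outside it, up to 1/|q|, for [true], and inside it, down
    to |q|, for [false]. *)
Definition annulus (b : bool) (u : C) :=
  if b then 0 < complex.Re u < L else - L < complex.Re u < 0.

(** [kap A m] tends to 1 at +oo and to 0 at -oo. Subtracting 1 moves the nonvanishing tail from +oo
    to -oo, so that the series converges in the other annulus. *)
Definition kterm (b : bool) (u A : C) (m : int) : C :=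
  cexp (m%:~R * u) * (kap A m - b%:R).
Definition skernel b u A : C := csum (kterm b u A).

Lemma int_abs_cases (m : int) : (`|m%:~R| = m%:~R :> R /\ 0 <= (m%:~R : R)) \/
  (`|m%:~R| = - m%:~R :> R /\ (m%:~R : R) <= 0).
Proof.
have [h|h] := leP 0 (m%:~R : R); first by left; rewrite ger0_norm.
by right; rewrite ltr0_norm // ltW.
Qed.

Lemma summ_kterm b u A : annulus b u -> gen A -> summ (kterm b u A).
Proof.
move=> du gA; have [K K0 hK] := kap_decay gA.
have [c c0 hc] : exists2 c : R, 0 < c & if b then c <= complex.Re u /\ c <= L - complex.Re u
    else c <= - complex.Re u /\ c <= complex.Re u + L.
  case: b du => /andP[h1 h2].
    by exists (Num.min (complex.Re u) (L - complex.Re u)); rewrite ?lt_min ?ge_min ?lexx ?orbT //; apply/andP; split; lra.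
  by exists (Num.min (- complex.Re u) (complex.Re u + L)); rewrite ?lt_min ?ge_min ?lexx ?orbT //; apply/andP; split; lra.
apply: (@summ_int_exp _ _ K c) => // m; rewrite /kterm nmM nm_cexp Re_intM.
have [h1 h2 h3 h4] := hK m.
have key a x : 0 <= x -> x <= K * expR a -> m%:~R * complex.Re u + a <= - c * `|m%:~R| ->
    expR (m%:~R * complex.Re u) * x <= K * expR (- c * `|m%:~R|).
  move=> x0 hx ha; apply: (@le_trans _ _ (expR (m%:~R * complex.Re u) * (K * expR a))).
    by rewrite ler_wpM2l ?expR_ge0.
  by rewrite mulrCA ler_wpM2l // -expRD ler_expR.
case: (int_abs_cases m) => -[-> m0] in key *; case: b du hc {h1 h2} => /= /andP[d1 d2] [hc hc'].
- by apply: (key _ _ (nm_ge0 _) h3); nra.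
- by rewrite subr0; apply: (key 0 _ (nm_ge0 _)); [rewrite expR0 mulr1; have [] := hK m|nra].
- by apply: (key 0 _ (nm_ge0 _)); [rewrite expR0 mulr1; have [] := hK m|nra].
- by rewrite subr0; apply: (key _ _ (nm_ge0 _) h4); nra.
Qed.

Let sub_inj (N : int) : injective (fun m : int => N - m).
Proof. by move=> a b; lia. Qed.

(* The Cauchy product of [th u] and [skernel b u A] is [\sum_N D b A N e^(N u)];
   since [th 0 = 0], [D] obeys a first-order recursion in [N], which makes it
   proportional to the coefficients of [th (u + A)]. *)
Let Dterm (b : bool) A (N m : int) := tht (N - m) 0 * (kap A m - b%:R).
Let D b A N : C := csum (Dterm b A N).

Let summ_D b A N : gen A -> summ (Dterm b A N).
Proof.
move=> gA; have [K K0 hK] := kap_decay gA.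
apply: (@summ_le _ _ _ (fun m : int => tht (N - m) 0) K).
  by apply: (@summ_inj _ _ _ (fun m => N - m) (tht^~ 0)) => //; exact: summ_tht.
move=> m; rewrite nmM mulrC ler_wpM2r ?nm_ge0 //.
by have [h1 h2 _ _] := hK m; case: b; rewrite ?subr0.
Qed.

Let has_sum_shift N z : has_sum (fun m : int => tht (N - m) z) (th z).
Proof.
apply/(@has_sum_inj _ _ _ _ (tht^~ z) (th z) (@sub_inj N)) => [i _|]; first by exists (N - i); lia.
exact: has_csum (summ_tht _ _).
Qed.

(** The two coefficients differ by [th 0], which vanishes; this is why both annuli carry the same
    function. *)
Let D_bool A N : gen A -> D true A N = D false A N.
Proof.
move=> gA; apply: csumE; rewrite -[D false A N]addr0 -[X in has_sum _ (_ + X)](mulr0 (-1)) -[X in _ * X](th0 tau_gt0).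
have := has_sumD (has_csum (summ_D false N gA)) (has_sumZ (-1) (@has_sum_shift N 0)).
by apply: eq_has_sum => m; rewrite /Dterm /= mulr1n subr0; ring.
Qed.

Let D_rec A N : gen A -> D false A N * tht (N - 1) 0 = cexp A * tht N 0 * D false A (N - 1).
Proof.
move=> gA; apply/eqP; rewrite -subr_eq0; apply/eqP.
have := has_sumD (has_sumZ (tht (N - 1) 0) (has_csum (summ_D false N gA)))
   (has_sumZ (- (cexp A * tht N 0)) (has_csum (summ_D false (N - 1) gA))).
have -> : D false A N * tht (N - 1) 0 - cexp A * tht N 0 * D false A (N - 1) =
  tht (N - 1) 0 * csum (Dterm false A N) + - (cexp A * tht N 0) * csum (Dterm false A (N - 1)).
  by rewrite /D; ring.
move=> h; apply: has_sum_unique h _.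
(* Termwise the difference of the two sides is [tht (N - 1) 0 * tht (N - m) 0] times (1 - e^A q^m)
   [kap A m] = 1, so the series sums to a multiple of [th 0]. *)
have e0 : 0 = tht (N - 1) 0 * th 0 by rewrite th0 // mulr0.
rewrite [X in has_sum _ X]e0.
apply: eq_has_sum (has_sumZ (tht (N - 1) 0) (@has_sum_shift N 0)) => m.
rewrite /Dterm /= !subr0.
have e1 : tht N 0 * tht (N - 1 - m) 0 * cexp A = tht (N - 1) 0 * tht (N - m) 0 * cexp (A + 2 * ipi * tau * m%:~R).
  by rewrite /Submission.tht -!cexpD; congr cexp; rewrite !intrB; ring.
have h : 1 - cexp (A + 2 * ipi * tau * m%:~R) != 0 by rewrite subr_eq0 eq_sym gA.
have -> : - (cexp A * tht N 0) * (tht (N - 1 - m) 0 * kap A m) = - (tht N 0 * tht (N - 1 - m) 0 * cexp A) * kap A m by ring.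
by rewrite e1 /kap; field.
Qed.

Let D_closed b A N : gen A -> D b A N = tht N A * D false A 0.
Proof.
move=> gA; have -> : D b A N = D false A N by case: b; rewrite ?D_bool.
have tn0 n z : tht n z != 0 by apply: cexp_neq0.
have trec n : tht n A * tht (n - 1) 0 = cexp A * tht n 0 * tht (n - 1) A.
  by rewrite /Submission.tht -!cexpD; congr cexp; rewrite !intrB; ring.
have step n : D false A n = tht n A * D false A 0 <-> D false A (n - 1) = tht (n - 1) A * D false A 0.
  have := D_rec n gA; have := trec n; have n1 := tn0 (n - 1) 0; have n2 := tn0 n 0.
  have n3 : cexp A * tht n 0 != 0 by rewrite mulf_neq0 ?cexp_neq0.
  move: (D false A n) (D false A (n - 1)) (D false A 0) (tht n A) (tht (n - 1) A) (cexp A * _) n3 => x x1 x0 t t1 k n3.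
  move=> e1 e2; split=> e.
    by apply: (mulfI n3); rewrite -e2 e mulrAC e1 mulrA.
  by apply: (mulIf n1); rewrite e2 e mulrA -e1 mulrAC.
elim/int_rect: N => [|n IH|n IH].
- have -> : tht 0 A = 1 by rewrite /Submission.tht mulr0z !mul0r mulr0 !addr0 cexp0.
  by rewrite mul1r.
- by apply/step; rewrite -addn1 PoszD addrK.
have -> : - n.+1%:Z = - n%:Z - 1 by lia.
exact: (step _).1 IH.
Qed.

Lemma th_kernel b u A : annulus b u -> gen A ->
  th u * skernel b u A = th (u + A) * D false A 0.
Proof.
move=> du gA; have sk := summ_kterm du gA.
have h := has_sumM (summ_tht tau_gt0 u) sk (has_csum (summ_tht tau_gt0 u)) (has_csum sk).
have sF := summM (summ_tht tau_gt0 u) sk.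
set F := (fun p : int * int => _) in h sF.
(* The double series is regrouped by the total exponent N of e^u. *)
pose g (p : int * int) := (p.1 - p.2, p.2).
have gi : injective g by move=> [a b'] [c d] [/= + e]; rewrite -e => /addIr ->.
have gF p : F p != 0 -> exists p', g p' = p.
  by move=> _; exists (p.1 + p.2, p.2); rewrite /g /= addrK; case: p.
have sG := summ_inj gi sF; have hG := (has_sum_inj _ gi gF).2 h.
have := has_sum_fubini sG hG; move=> h1.
apply: has_sum_unique h1 _.
rewrite mulrC; apply: eq_has_sum (has_sumZ (D false A 0) (has_csum (summ_tht tau_gt0 (u + A)))) => N /=.
have <- : cexp (N%:~R * u) * D b A N = csum (fun m => F (g (N, m))).
  apply/esym/csumE; apply: eq_has_sum (has_sumZ _ (has_csum (summ_D b N gA))) => m.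
  rewrite /F /g /Dterm /kterm /= [LHS]mulrA [RHS]mulrA; congr (_ * _).
  by rewrite /Submission.tht -!cexpD; congr cexp; rewrite !intrB; ring.
by rewrite (D_closed b N gA) [u + A]addrC thtD; ring.
Qed.

Let ind (m : int) : R := if 0 <= m then 1 else 0.

Let has_sum_geometric (u : C) : - L < complex.Re u < 0 ->
  exists s : C, has_sum (fun m : int => cexp (m%:~R * u) * (ind m)%:C) s /\ (1 - cexp u) * s = 1.
Proof.
move=> /andP[_ du].
have sg : summ (fun k : nat => cexp u ^+ k).
  exists (1 - expR (complex.Re u))^-1 => A.
  under eq_bigr do rewrite nmX nm_cexp.
  by apply: geometric_sum_le; rewrite expR_ge0 expR_lt1.
have hs := has_csum sg; set s := csum _ in hs; exists s; split.
  have pi' : injective Posz by move=> ? ? [].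
  apply/(has_sum_inj _ pi') => [[k|k]|].
  - by exists k.
  - by rewrite /ind /= mulr0 eqxx.
  by apply: eq_has_sum hs => k; rewrite /ind /= mulr1 -cexpMn.
pose G (k : nat) : C := if k is k'.+1 then cexp u ^+ k else 0.
have hG : has_sum G (cexp u * s).
  apply/(has_sum_inj _ succn_inj) => [[|k]|]; [by rewrite eqxx|by exists k|].
  by apply: eq_has_sum (has_sumZ (cexp u) hs) => k; rewrite /G exprS.
have hd : has_sum (fun k : nat => if k == 0%N then 1 else 0 : C) 1.
  have := @has_sum_finite R nat (fun k => if k == 0%N then 1 else 0) [fset 0%N]%fset.
  by rewrite big_seq_fset1 eqxx; apply=> k; rewrite inE => /negPf ->.
have e : s = 1 + cexp u * s.
  apply: has_sum_unique hs _; apply: eq_has_sum (has_sumD hd hG) => -[|k] /=.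
    by rewrite addr0 expr0.
  by rewrite add0r.
by rewrite mulrBl mul1r {1}e addrK.
Qed.

(** Removing the indicator of m >= 0 from [kap] leaves terms that decay at both ends uniformly near
    u = 0. The pole at 0 is therefore that of the geometric series 1/(1 - e^u). *)
Lemma kernel_pole A : gen A -> exists u : nat -> C,
  [/\ forall n, u n != 0, ((u : nat -> C^o) @ \oo --> (0 : C^o))%classic,
    forall n, annulus false (u n) &
    ((fun n => (1 - cexp (u n)) * skernel false (u n) A : C^o) @ \oo --> (1 : C^o))%classic].
Proof.
move=> gA; have L0 := nome_rate_gt0 tau_gt0.
have [K K0 hK] := kap_decay gA.
(* The points approach 0 from the left within L/2, so e^(mu) consumes at most half of the decay rate
   L for negative m. *)
pose d := Num.min 1 (L / 2); have d0 : 0 < d by rewrite lt_min ltr01 divr_gt0.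
have d1 : d <= 1 by rewrite ge_min lexx.
have d2 : d <= L / 2 by rewrite ge_min lexx orbT.
pose x (n : nat) : R := - d / n.+1%:R.
have x0 n : x n < 0 by rewrite /x mulNr oppr_lt0 divr_gt0.
have xd n : - x n <= d.
  have -> : - x n = d / n.+1%:R by rewrite /x mulNr opprK.
  have n1 : (1 : R) <= n.+1%:R by rewrite ler1n.
  by rewrite ler_pdivrMr ?ltr0n //; nra.
pose u (n : nat) : C := (x n)%:C.
have u0 n : u n != 0 by rewrite -nm_gt0 nm_real normr_gt0 lt_eqF.
have cu : ((u : nat -> C^o) @ \oo --> (0 : C^o))%classic by apply: cvgs_inv_succ.
have du n : annulus false (u n) by rewrite /annulus /u /= x0 andbT; have := xd n; lra.
pose rt n m : C := cexp (m%:~R * u n) * (kap A m - (ind m)%:C).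
have [M hM] : exists M : R, forall n (B : {fset int}), \sum_(m <- B) nm (rt n m) <= M.
  pose b (m : int) : C := (K * expR (- (L / 2) * `|m%:~R|))%:C.
  have [M hM] : summ b.
    apply: (@summ_int_exp _ _ K (L / 2)) => [|m]; first by rewrite divr_gt0.
    by rewrite nm_real ger0_norm // mulr_ge0 // expR_ge0.
  exists M => n B; apply: le_trans (hM B); apply: ler_sum => m _.
  rewrite nm_real ger0_norm; last by rewrite mulr_ge0 // expR_ge0.
  rewrite /rt nmM nm_cexp Re_intM /=; have [h1 h2 h3 h4] := hK m.
  have key a y : 0 <= y -> y <= K * expR a -> m%:~R * x n + a <= - (L / 2) * `|m%:~R| ->
      expR (m%:~R * x n) * y <= K * expR (- (L / 2) * `|m%:~R|).
    move=> y0 hy ha; apply: (@le_trans _ _ (expR (m%:~R * x n) * (K * expR a))).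
      by rewrite ler_wpM2l ?expR_ge0.
    by rewrite mulrCA ler_wpM2l // -expRD ler_expR.
  have hx0 := x0 n; have hxd := xd n.
  rewrite /ind; case: ifP => m0.
    have m1 : 0 <= (m%:~R : R) by rewrite ler0z.
    by apply: (key _ _ (nm_ge0 _) h3); rewrite ger0_norm //; nra.
  have m1 : (m%:~R : R) <= 0 by rewrite lerz0 ltW // ltNge m0.
  by rewrite subr0; apply: (key _ _ (nm_ge0 _) h4); rewrite ler0_norm //; nra.
have srt n : summ (rt n) by exists M => B; apply: hM.
have hk n : (1 - cexp (u n)) * skernel false (u n) A = 1 + (1 - cexp (u n)) * csum (rt n).
  have [s [hs es]] := has_sum_geometric (du n).
  have -> : skernel false (u n) A = s + csum (rt n).
    apply: csumE; apply: eq_has_sum (has_sumD hs (has_csum (srt n))) => m.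
    by rewrite /rt /kterm subr0; ring.
  by rewrite mulrDr es.
have ce : ((fun n => 1 - cexp (u n) : C^o) @ \oo --> (0 : C^o))%classic.
  apply/cvgsP => e /((cvgsP _ _).1 (cvgs_cexp cu))[N hN]; exists N => n /hN.
  by rewrite cexp0 sub0r nmN.
exists u; split; [exact: u0|exact: cu|exact: du|].
apply/cvgsP => e e0; have M1 : 0 < `|M| + 1 by rewrite ltr_wpDl.
have [N hN] := (cvgsP _ _).1 ce _ (divr_gt0 e0 M1); exists N => n /hN.
rewrite sub0r nmN ltr_pdivlMr // hk opprD addrA subrr add0r nmN nmM => h.
apply: le_lt_trans h; apply: ler_wpM2l; first exact: nm_ge0.
apply: le_trans (nm_has_sum_le (has_csum (srt n)) (hM n)) _.
by have := ler_norm M; lra.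
Qed.

(** Multiply [th_kernel] by (1 - e^u)/u and let u tend to 0: one side tends to th'(0), the other to
    minus the constant times [th A]. *)
Lemma th_kernel_const A : gen A -> D false A 0 * th A = - dth 0.
Proof.
move=> gA; have [u [u0 cu du c1]] := kernel_pole gA.
have c2 : ((fun n => (th (0 + u n) - th 0) / u n * ((1 - cexp (u n)) * skernel false (u n) A) : C^o) @ \oo --> (dth 0 * 1 : C^o))%classic.
  exact: (@cvgM C _ _ _ _ _ _ _ (quad_slope (th_quad tau_gt0 0) u0 cu) c1).
have c3 : ((fun n => - ((cexp (0 + u n) - cexp 0) / u n) * (th (A + u n) * D false A 0) : C^o) @ \oo --> (- cexp 0 * (th A * D false A 0) : C^o))%classic.
  apply: (@cvgM C).
    by apply: (@cvgN _ C^o); exact: (quad_slope (quad_cexp 0) u0 cu).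
  apply: (@cvgM C); last exact: cvg_cst.
  exact: (quad_cvg (th_quad tau_gt0 A) cu).
have e : (fun n => (th (0 + u n) - th 0) / u n * ((1 - cexp (u n)) * skernel false (u n) A)) =
   (fun n => - ((cexp (0 + u n) - cexp 0) / u n) * (th (A + u n) * D false A 0)).
  apply/funext => n; rewrite (add0r (u n)) th0 // subr0 cexp0 (addrC A) -(@th_kernel false (u n) A (du n) gA).
  by ring.
rewrite e in c2.
have := cvgs_unique c2 c3; rewrite mulr1 cexp0 mulN1r => ->.
by rewrite opprK mulrC.
Qed.

Definition kron (u A : C) : C := dth 0 * th (u + A) / (th u * th A).

Lemma skernelE b u A : annulus b u -> gen A -> th u != 0 -> th A != 0 ->
  skernel b u A = - kron u A.
Proof.
move=> du gA tu tA; apply: (mulfI tu); rewrite th_kernel //.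
apply: (mulIf tA); rewrite -[LHS]mulrA th_kernel_const // /kron.
move: (th u) (th A) (th (u + A)) (dth 0) tu tA => a b' c d a0 b0.
by field; rewrite a0 b0.
Qed.

Lemma gen_Re A : (forall m : int, complex.Re A != L * m%:~R) -> gen A.
Proof.
move=> h m; apply/negP => /eqP e; have := nm_cexp_tau A m; rewrite e nm1 -[LHS]expR0 => /expR_inj e2.
by move: (h m); rewrite -subr_eq0 -e2 eqxx.
Qed.

Lemma gen_strip A : - L < complex.Re A < L -> complex.Re A != 0 -> gen A.
Proof.
move=> /andP[h1 h2] h3; apply: gen_Re => m; apply/negP => /eqP e; have L0 := nome_rate_gt0 tau_gt0.
have : (m%:~R : R) < 1 by rewrite -(ltr_pM2l L0) -e mulr1.
have : (-1 : R) < m%:~R by rewrite -(ltr_pM2l L0) -e mulrN mulr1.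
rewrite ltrz1 -[-1]/((-1)%:~R) ltr_int => m1 m2.
have m0 : m = 0 by lia.
by rewrite e m0 mulr0 eqxx in h3.
Qed.

Lemma gen_annulus b u : annulus b u -> gen u.
Proof.
have L0 := nome_rate_gt0 tau_gt0.
by case: b => /andP[h1 h2]; apply: gen_strip; rewrite ?(gt_eqF h1) ?(lt_eqF h2) //; apply/andP; split; lra.
Qed.

(** If th'(0) vanished, the constant in [th_kernel] would vanish, hence the kernel too, against its
    pole at 0. Nonvanishing off the lattice is a hypothesis here and is supplied by the triple
    product. *)
Lemma dth0_neq0 : (forall A, gen A -> th A != 0) -> dth 0 != 0.
Proof.
move=> nz; apply/negP => /eqP d0.
have gA : gen (- (L / 2))%:C.
  have L0 := nome_rate_gt0 tau_gt0.
  by apply: (@gen_annulus false); rewrite /annulus /=; apply/andP; split; lra.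
have [u [u0 cu du]] := kernel_pole gA.
have D0 : D false (- (L / 2))%:C 0 = 0.
  by apply: (mulIf (nz _ gA)); rewrite th_kernel_const // d0 oppr0 mul0r.
have k0 n : skernel false (u n) (- (L / 2))%:C = 0.
  by apply: (mulfI (nz _ (gen_annulus (du n)))); rewrite th_kernel // D0 !mulr0.
under eq_fun do rewrite k0 mulr0.
move=> /cvgsP/(_ 1 ltr01)[N /(_ N (leqnn N))].
by rewrite subr0 nm1 ltxx.
Qed.

End KroneckerKernel.

(** * The Jacobi triple product *)
Section QBinomial.
Variables (F : fieldType) (q : F).
Hypothesis q_neq0 : q != 0.
Hypothesis q_reg : forall k, 1 - q ^+ k.+1 != 0.

Definition qfact (n : nat) : F := \prod_(k < n) (1 - q ^+ k.+1).

Lemma qfactS n : qfact n.+1 = qfact n * (1 - q ^+ n.+1).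
Proof. by rewrite /qfact big_ord_recr. Qed.

Lemma qfact_neq0 n : qfact n != 0.
Proof. by rewrite prodf_seq_neq0; apply/allP => k _; rewrite q_reg. Qed.

(** The Gaussian binomial coefficient times q^(j(j-1)/2); the value 0 beyond M lets the Pascal rule
    hold at the edge. *)
Let c (M j : nat) : F := if (j <= M)%N then qfact M / (qfact j * qfact (M - j)) * q ^+ 'C(j, 2) else 0.

Let c_rec M j : c M.+1 j.+1 = c M j.+1 + q ^+ M * c M j.
Proof.
have h n := qfact_neq0 n; have eC : 'C(j.+1, 2) = ('C(j, 2) + j)%N by rewrite binS bin1 addnC addnC.
rewrite /c ltnS; case: (ltngtP j M) => jM; last 2 first.
- by rewrite mulr0 addr0.
- have q0 : qfact 0 = 1 by rewrite /qfact big_ord0.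
  by rewrite -jM add0r !subnn eC exprD q0 !mulr1 !mulfV // !mul1r mulrC.
have [d ->] : exists d, M = (j.+1 + d)%N by exists (M - j.+1)%N; rewrite subnKC.
have -> : ((j.+1 + d).+1 - j.+1 = d.+1)%N by lia.
have -> : (j.+1 + d - j.+1 = d)%N by lia.
have -> : (j.+1 + d - j = d.+1)%N by lia.
rewrite eC addSn !qfactS !exprD !exprS !exprD.
have h1 := q_reg j; have h2 := q_reg d; rewrite !exprS in h1 h2.
by field; rewrite !h h1 h2.
Qed.

Lemma q_binomial M x : \prod_(k < M) (1 + x * q ^+ k) = \sum_(j < M.+1) c M j * x ^+ j.
Proof.
have c00 M' : c M' 0 = 1.
  by rewrite /c subn0 /qfact big_ord0 mul1r mulfV ?qfact_neq0 // mul1r.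
elim: M => [|M IH]; first by rewrite big_ord0 big_ord1 c00 mulr1.
rewrite big_ord_recr /= IH [RHS]big_ord_recl /= c00 mul1r expr0.
have -> : \sum_(i < M.+1) c M.+1 (bump 0 i) * x ^+ bump 0 i =
    \sum_(i < M.+1) c M i.+1 * x ^+ i.+1 + \sum_(i < M.+1) x * q ^+ M * (c M i * x ^+ i).
  by rewrite -big_split; apply: eq_bigr => j _ /=; rewrite /bump /= add1n c_rec exprS; ring.
rewrite addrA mulrDr mulr1 -mulr_sumr [in RHS]mulrC; congr (_ + _).
rewrite big_ord_recl /= c00 mul1r expr0 big_ord_recr /=.
by rewrite {3}/c ltnn mul0r addr0; congr (_ + _); apply: eq_bigr.
Qed.

Lemma finite_triple_product N y : y != 0 ->
  \prod_(k < N) ((1 - y * q ^+ k) * (1 - y^-1 * q ^+ k.+1)) =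
  \sum_(j < N.*2.+1) qfact N.*2 / (qfact j * qfact (N.*2 - j)) *
     (q ^+ ('C(j, 2) + 'C(N.+1, 2)) * (- y) ^+ j / ((- y) ^+ N * q ^+ (N * j))).
Proof.
move=> y0; have qX n : q ^+ n != 0 by rewrite expf_neq0.
have yX n : (- y) ^+ n != 0 by rewrite expf_neq0 ?oppr_eq0.
(* The shift by q^(-N) centres the 2N factors: the upper half gives the factors in y, the lower half
   those in 1/y. *)
have := q_binomial N.*2 (- y / q ^+ N).
rewrite -addnn big_split_ord /=.
have -> : \prod_(i < N) (1 + - y / q ^+ N * q ^+ (N + i)) = \prod_(k < N) (1 - y * q ^+ k).
  by apply: eq_bigr => k _; rewrite exprD; congr (1 + _); field; rewrite qX.
have -> : \prod_(i < N) (1 + - y / q ^+ N * q ^+ i) =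
    (- y) ^+ N / q ^+ 'C(N.+1, 2) * \prod_(k < N) (1 - y^-1 * q ^+ k.+1).
  (* In reversed order each factor 1 - y q^(-k-1) equals - y q^(-k-1) times 1 - y^(-1) q^(k+1),
     which explains the monomial prefactor. *)
  rewrite (reindex_inj rev_ord_inj) /=.
  have -> : (- y) ^+ N / q ^+ 'C(N.+1, 2) = \prod_(k < N) (- y / q ^+ k.+1).
    elim: (N) => [|n IH]; first by rewrite big_ord0 expr0 divr1.
    by rewrite big_ord_recr -IH /= binS bin1 exprD [in RHS]exprS !exprS; field; rewrite !qX q_neq0.
  rewrite -big_split; apply: eq_bigr => k _ /=.
  have -> : q ^+ N = q ^+ k.+1 * q ^+ (N - k.+1) by rewrite -exprD subnKC.
  by field; rewrite !qX y0.
move=> e; rewrite big_split /=.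
have -> : \prod_(k < N) (1 - y * q ^+ k) * \prod_(k < N) (1 - y^-1 * q ^+ k.+1) =
  q ^+ 'C(N.+1, 2) / (- y) ^+ N * ((- y) ^+ N / q ^+ 'C(N.+1, 2) * \prod_(k < N) (1 - y^-1 * q ^+ k.+1) * \prod_(k < N) (1 - y * q ^+ k)).
  by field; rewrite qX yX.
rewrite e mulr_sumr; apply: eq_bigr => j _; rewrite /c -ltnS ltn_ord.
rewrite expr_div_n -exprM exprD.
by field; rewrite !qX !yX !qfact_neq0.
Qed.

End QBinomial.

(** * Convergence and nonvanishing of infinite products *)

Section InfiniteProduct.
Variable R : realType.
Local Notation C := R[i].
Implicit Type a : nat -> C.

Lemma cvgsM (u v : nat -> C) (l m : C) : ((u : nat -> C^o) @ \oo --> (l : C^o))%classic ->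
  ((v : nat -> C^o) @ \oo --> (m : C^o))%classic ->
  ((fun n => u n * v n : C^o) @ \oo --> (l * m : C^o))%classic.
Proof. exact: (@cvgM C). Qed.

(** Partial products telescope with increments [p k * a k], and the [p k] are bounded by e^M, so the
    increments are summable. *)
Lemma cvg_prod a : summ a -> exists P : C,
  ((fun n => \prod_(k < n) (1 + a k) : C^o) @ \oo --> (P : C^o))%classic.
Proof.
move=> sa; have [M hM] := sa; pose p n := \prod_(k < n) (1 + a k).
have pB n : nm (p n) <= expR M.
  rewrite /p nm_prod; apply: (@le_trans _ _ (\prod_(k < n) (1 + nm (a k)))).
    by apply: ler_prod => k _; rewrite nm_ge0 /=; apply: le_trans (nmD _ _) _; rewrite nm1.
  apply: le_trans (prod_le_expR _ (fun k : 'I_n => nm_ge0 (a k))) _.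
  by rewrite ler_expR; apply: le_trans (hM (below n)); rewrite sum_below.
have sd : summ (fun k => p k * a k).
  by apply: (@summ_le _ _ _ a (expR M)) => // k; rewrite nmM ler_wpM2r ?nm_ge0.
have := cvgs_has_sum (has_csum sd) below_cofinal; set s := csum _ => /cvgsP h.
exists (1 + s); apply/cvgsP => e /h[N hN]; exists N => n /hN.
have -> // : s - \sum_(k <- below n) p k * a k = 1 + s - p n.
rewrite sum_below; suff -> : p n = 1 + \sum_(k < n) p k * a k by ring.
elim: n => [|n IH]; first by rewrite /p !big_ord0 addr0.
by rewrite big_ord_recr /= addrA -IH /p big_ord_recr /=; ring.
Qed.

(** The product of the inverses converges as well, and the two limits multiply to 1. *)
Lemma cvg_prod_neq0 a (K : R) : summ a -> (forall k, 1 + a k != 0) ->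
  (forall k, nm (1 + a k)^-1 <= K) ->
  exists2 P : C, P != 0 & ((fun n => \prod_(k < n) (1 + a k) : C^o) @ \oo --> (P : C^o))%classic.
Proof.
move=> sa a0 hK; have [P hP] := cvg_prod sa.
have [Q hQ] : exists Q : C, ((fun n => \prod_(k < n) (1 + ((1 + a k)^-1 - 1)) : C^o) @ \oo --> (Q : C^o))%classic.
  apply: (@cvg_prod (fun k => (1 + a k)^-1 - 1)); apply: (summ_le (k := K) sa) => k.
  have -> : (1 + a k)^-1 - 1 = - ((1 + a k)^-1 * a k) by field.
  by rewrite nmN nmM ler_wpM2r ?nm_ge0.
exists P => //; apply/negP => /eqP P0.
have := cvgsM hP hQ; rewrite P0 mul0r.
have -> : (fun n => \prod_(k < n) (1 + a k) * \prod_(k < n) (1 + ((1 + a k)^-1 - 1))) = fun=> 1 :> C.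
  apply/funext => n; rewrite -big_split big1 // => k _ /=.
  by rewrite [1 + (_ - 1)]addrCA subrr addr0 mulfV.
move=> /cvgsP/(_ 1 ltr01)[N /(_ N (leqnn N))].
by rewrite sub0r nmN nm1 ltxx.
Qed.

Lemma cvgs_subseq (u : nat -> C) l (f : nat -> nat) :
  (forall B, exists N, forall n, (N <= n)%N -> (B <= f n)%N) ->
  ((u : nat -> C^o) @ \oo --> (l : C^o))%classic ->
  ((fun n => u (f n) : C^o) @ \oo --> (l : C^o))%classic.
Proof.
move=> hf /cvgsP hu; apply/cvgsP => e /hu[B hB]; have [N hN] := hf B.
by exists N => n /hN /hB.
Qed.

Lemma cvgs_bounded (u : nat -> C) l : ((u : nat -> C^o) @ \oo --> (l : C^o))%classic ->
  exists K : R, forall n, nm (u n) <= K.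
Proof.
move=> /cvgsP/(_ 1 ltr01)[N hN].
exists (nm l + 1 + \sum_(k < N) nm (u k)) => n.
have S0 : 0 <= \sum_(k < N) nm (u k) by apply: sumr_ge0 => k _; apply: nm_ge0.
case: (ltnP n N) => nN.
  rewrite (bigD1 (Ordinal nN)) //= addrCA lerDl addr_ge0 ?addr_ge0 ?nm_ge0 //.
  by apply: sumr_ge0 => k _; apply: nm_ge0.
by have := hN n nN; have := nm_dist (u n) l; rewrite nmB; lra.
Qed.

End InfiniteProduct.

(** * Theta and eta as infinite products *)

Section TripleProduct.
Variable R : realType.
Local Notation C := R[i].
Variable tau : C.
Hypothesis tau_gt0 : 0 < complex.Im tau.
Local Notation L := (nome_rate tau).
Local Notation ipi := (ipi R).
Local Notation tht := (tht tau).
Local Notation th := (th tau).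

Definition nome : C := cexp (2 * ipi * tau).
Local Notation q := nome.

Lemma nomeX n : q ^+ n = cexp (2 * ipi * tau * n%:R).
Proof. by rewrite [_ * n%:R]mulrC cexpMn. Qed.

Lemma nm_nomeX n : nm (q ^+ n) = expR (- L * n%:R).
Proof. by rewrite nomeX nm_cexp (Re_2ipitau tau n). Qed.

Lemma nome_neq0 : q != 0. Proof. exact: cexp_neq0. Qed.

Lemma nomeX_le k : nm (q ^+ k.+1) <= expR (- L).
Proof.
rewrite nm_nomeX ler_expR mulNr lerN2 ler_peMr ?ler1n // ltW //.
exact: nome_rate_gt0.
Qed.

Lemma nome_lt1 : expR (- L) < 1 :> R.
Proof. by rewrite expR_lt1 oppr_lt0 nome_rate_gt0. Qed.

Lemma nome_reg k : 1 - q ^+ k.+1 != 0.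
Proof.
rewrite -nm_gt0; have := nm_dist 1 (q ^+ k.+1); rewrite nm1.
by have := nomeX_le k; have := nome_lt1; lra.
Qed.

Lemma summ_nomeX c : summ (fun k => c * q ^+ k).
Proof.
apply: summZ; exists (1 - expR (- L))^-1 => A.
under eq_bigr do rewrite nmX /nome nm_cexp -[2 * _ * _]mulr1 (Re_2ipitau tau 1) mulr1.
by apply: geometric_sum_le; rewrite expR_ge0 nome_lt1.
Qed.

Lemma euler_ex : exists2 P : C, P != 0 & (((qfact q : nat -> C^o)) @ \oo --> (P : C^o))%classic.
Proof.
have e : qfact q = fun n => \prod_(k < n) (1 + - q ^+ k.+1) by [].
rewrite e; apply: (@cvg_prod_neq0 R (fun k => - q ^+ k.+1) (1 - expR (- L))^-1) => [|k|k].
- have := summ_nomeX (- q); congr summ; apply/funext => k; rewrite exprS; ring.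
- exact: nome_reg.
rewrite nmV lef_pV2 ?posrE ?subr_gt0 ?nome_lt1 //; last by rewrite nm_gt0 nome_reg.
by have := nm_dist 1 (q ^+ k.+1); rewrite nm1; have := nomeX_le k; lra.
Qed.

Definition euler : C := lim ((qfact q : nat -> C^o) @ \oo)%classic.

Lemma cvg_euler : (((qfact q : nat -> C^o)) @ \oo --> (euler : C^o))%classic.
Proof.
have [P _ h] := euler_ex; suff -> : euler = P by [].
exact: (@cvg_lim C^o (@norm_hausdorff _ _) _ _ _ _ P h).
Qed.

Lemma euler_neq0 : euler != 0.
Proof. by have [P P0 h] := euler_ex; rewrite (cvgs_unique cvg_euler h). Qed.

Lemma dedekind_etaE : dedekind_eta tau = qpow tau (1 / 24%:R) * euler.
Proof.
have e : (fun N : nat => \prod_(1 <= k < N.+1) (1 - qpow tau k%:R) : C^o) = qfact q.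
  apply/funext => N; rewrite /qfact big_add1 /= big_mkord; apply: eq_bigr => k _.
  by rewrite nomeX /qpow twopiiE.
by rewrite /dedekind_eta e.
Qed.

Lemma bin2_double (j : nat) : 'C(j, 2)%:R * 2 = j%:R * (j%:R - 1) :> C.
Proof.
elim: j => [|j IH]; first by rewrite mul0r mul0r.
by rewrite binS bin1 natrD mulrDl IH -[j.+1]addn1 natrD; ring.
Qed.

(** The Gaussian binomial of 2N over N + n. [F] extends the recentred finite sum by zero to all
    integers, so that N may tend to infinity under a sum over a fixed index set. *)
Let Fc (N : int) (n : int) : C := qfact q (absz (N + N)) / (qfact q (absz (N + n)) * qfact q (absz (N - n))).
Let F t (N : nat) (n : int) : C := if (- N%:Z <= n) && (n <= N%:Z) then Fc N n * tht (- n) (- t) else 0.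

Let finite_theta N t : \prod_(k < N) ((1 - cexp t * q ^+ k) * (1 - cexp (- t) * q ^+ k.+1)) = csum (F t N).
Proof.
rewrite cexpN (finite_triple_product nome_neq0 nome_reg) ?cexp_neq0 //.
apply/esym/csumE.
pose h (j : nat) : int := j%:Z - N%:Z.
have hi : injective h by rewrite /h => a b; lia.
apply/(has_sum_inj _ hi) => [n|].
  rewrite /F; case: ifP => [/andP[n1 _] _|_]; last by rewrite eqxx.
  by exists (absz (n + N%:Z)); rewrite /h; lia.
rewrite -(sum_below _ (fun j : nat => qfact q N.*2 / (qfact q j * qfact q (N.*2 - j)) *
     (q ^+ ('C(j, 2) + 'C(N.+1, 2)) * (- cexp t) ^+ j / ((- cexp t) ^+ N * q ^+ (N * j))))).
have -> : \sum_(j <- below N.*2.+1) (qfact q N.*2 / (qfact q j * qfact q (N.*2 - j)) *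
     (q ^+ ('C(j, 2) + 'C(N.+1, 2)) * (- cexp t) ^+ j / ((- cexp t) ^+ N * q ^+ (N * j)))) =
   \sum_(j <- below N.*2.+1) F t N (h j).
  rewrite big_seq [RHS]big_seq; apply: eq_bigr => j; rewrite in_below ltnS => jN.
  have -> : F t N (h j) = Fc N (h j) * tht (- h j) (- t).
    by rewrite /F; case: ifP => //; rewrite /h; lia.
  rewrite /Fc; have -> : absz (N%:Z + N%:Z) = N.*2 by lia.
  have -> : absz (N%:Z + h j) = j by rewrite /h; lia.
  have -> : absz (N%:Z - h j) = (N.*2 - j)%N by rewrite /h; lia.
  congr (_ * _).
  have -> : - cexp t = cexp (ipi + t) by rewrite cexpD cexp_ipi mulN1r.
  rewrite !nomeX -!cexpMn -!cexpD -cexpB /Submission.tht.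
  rewrite -[RHS]mulr1 -[X in _ = _ * X](cexp_2ipi R (h j)) -cexpD; congr cexp.
  rewrite natrD natrM /h rmorphN rmorphB /=.
  have e1 := bin2_double j; have e2 := bin2_double N.+1; rewrite -[N.+1]addn1 natrD in e2.
  rewrite -[N.+1]addn1.
  have -> : 2 * ipi * tau * ('C(j, 2)%:R + 'C(N + 1, 2)%:R) = ipi * tau * ('C(j, 2)%:R * 2 + 'C(N + 1, 2)%:R * 2) by ring.
  by rewrite e1 e2; ring.
apply: has_sum_finite => j; rewrite in_below ltnS -ltnNge => jN.
by rewrite /F; case: ifP => //; rewrite /h; lia.
Qed.

(** The Gaussian binomials are bounded uniformly, because [qfact] and its inverse converge, and each
    tends to 1/[euler]; a multiple of |[tht]| dominates. *)
Lemma triple_product t :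
  ((fun N => \prod_(k < N) ((1 - cexp t * q ^+ k) * (1 - cexp (- t) * q ^+ k.+1)) : C^o) @ \oo
    --> (th (- t) / euler : C^o))%classic.
Proof.
have -> : (fun N => \prod_(k < N) ((1 - cexp t * q ^+ k) * (1 - cexp (- t) * q ^+ k.+1)) : C^o) = (fun N => csum (F t N)).
  by apply/funext => N; apply: finite_theta.
have [K hK] := cvgs_bounded cvg_euler.
have qf0 := qfact_neq0 nome_reg.
have cV : ((fun n => (qfact q n)^-1 : C^o) @ \oo --> (euler^-1 : C^o))%classic.
  exact: (@cvgV C _ _ _ _ _ euler_neq0 cvg_euler).
have [K' hK'] := cvgs_bounded cV.
have Fb N n : nm (Fc N n) <= K * (K' * K').
  by rewrite /Fc invfM !nmM; apply: ler_pM; rewrite ?mulr_ge0 ?nm_ge0 //; apply: ler_pM; rewrite ?nm_ge0.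
have KK0 : 0 <= K * (K' * K') by apply: le_trans (nm_ge0 _) (Fb 0 0).
have Ni : injective (fun n : int => - n) by exact: oppr_inj.
have st : summ (fun n : int => tht (- n) (- t)) by apply: (@summ_inj _ _ _ _ (tht^~ (- t)) Ni); exact: summ_tht.
have [M hM] := st.
have := @tannery R _ (F t) (fun n => euler^-1 * tht (- n) (- t)) (fun n => K * (K' * K') * nm (tht (- n) (- t))) (K * (K' * K') * M).
have -> : csum (fun n => euler^-1 * tht (- n) (- t)) = th (- t) / euler.
  rewrite mulrC; apply: csumE; apply: has_sumZ.
  apply/(@has_sum_inj _ _ _ _ (tht^~ (- t)) _ Ni) => [n _|]; first by exists (- n); rewrite opprK.
  exact: has_csum (summ_tht _ _).
move=> h; apply: (h _ _ _).2.
- by move=> A; rewrite -mulr_sumr ler_wpM2l.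
- move=> N n; rewrite /F; case: ifP => _; last by rewrite nm0 mulr_ge0 ?nm_ge0.
  by rewrite nmM ler_wpM2r ?nm_ge0.
move=> n; have cF : ((fun N : nat => Fc N n * tht (- n) (- t) : C^o) @ \oo --> (euler^-1 * tht (- n) (- t) : C^o))%classic.
  apply: (@cvgM C); last exact: cvg_cst.
  have -> : euler^-1 = euler * (euler^-1 * euler^-1) by rewrite mulrA mulfV ?euler_neq0 // mul1r.
  have -> : (fun N : nat => Fc N n : C^o) = (fun N : nat => qfact q (absz (N%:Z + N%:Z)) * ((qfact q (absz (N%:Z + n)))^-1 * (qfact q (absz (N%:Z - n)))^-1) : C^o).
    by apply/funext => N; rewrite /Fc invfM.
  apply: (@cvgM C); first by apply: (@cvgs_subseq R (qfact q)); [move=> B; exists B => m; lia|exact: cvg_euler].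
  apply: (@cvgM C).
    by apply: (@cvgs_subseq R (fun n => (qfact q n)^-1)); [move=> B; exists (B + absz n)%N => m; lia|].
  by apply: (@cvgs_subseq R (fun n => (qfact q n)^-1)); [move=> B; exists (B + absz n)%N => m; lia|].
apply/cvgsP => e /((cvgsP _ _).1 cF)[N hN]; exists (N + absz n)%N => m hm.
have -> : F t m n = Fc m n * tht (- n) (- t) by rewrite /F; case: ifP => //; lia.
by apply: hN; lia.
Qed.

(** Both halves of the product for [th A] converge to nonzero limits: their factors are inverses of
    values of [kap], which are bounded. *)
Lemma th_neq0 A : gen tau A -> th A != 0.
Proof.
move=> gA; have gN : gen tau (- A).
  move=> m; apply: contra (gA (- m)) => /eqP e.
  have -> : A + 2 * ipi * tau * (- m)%:~R = - (- A + 2 * ipi * tau * m%:~R) by rewrite rmorphN /=; ring.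
  by rewrite cexpN e invr1.
have := @triple_product (- A); rewrite opprK => h.
have [K _ hK] := kap_bounded tau_gt0 gA; have [K' _ hK'] := kap_bounded tau_gt0 gN.
have e1 k : 1 + - (cexp (- A)) * q ^+ k = 1 - cexp (- A + 2 * ipi * tau * k%:~R) by rewrite cexpD nomeX mulNr.
have e2 k : 1 + - (cexp A * q) * q ^+ k = 1 - cexp (A + 2 * ipi * tau * k.+1%:~R) by rewrite mulNr -[cexp A * q * _]mulrA -exprS nomeX cexpD.
have [P P0 hP] := @cvg_prod_neq0 R (fun k => - (cexp (- A)) * q ^+ k) K' (summ_nomeX _)
   (ltac:(by move=> k; rewrite e1 subr_eq0 eq_sym gN)) (ltac:(by move=> k; rewrite e1; apply: hK')).
have [Q Q0 hQ] := @cvg_prod_neq0 R (fun k => - (cexp A * q) * q ^+ k) K (summ_nomeX _)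
   (ltac:(by move=> k; rewrite e2 subr_eq0 eq_sym gA)) (ltac:(by move=> k; rewrite e2; apply: hK)).
have hPQ := cvgsM hP hQ.
have e : (fun N => \prod_(k < N) ((1 - cexp (- A) * q ^+ k) * (1 - cexp A * q ^+ k.+1))) =
  (fun n => \prod_(k < n) (1 + - cexp (- A) * q ^+ k) * \prod_(k < n) (1 + - (cexp A * q) * q ^+ k)).
  apply/funext => N; rewrite -big_split; apply: eq_bigr => k _.
  by rewrite /= !mulNr -[cexp A * q * _]mulrA -exprS.
rewrite e in h; apply/negP => /eqP A0; move: (cvgs_unique h hPQ); rewrite A0 mul0r => /esym/eqP.
by rewrite mulf_eq0 (negPf P0) (negPf Q0).
Qed.

Lemma dth_neq0 : dth tau 0 != 0.
Proof. exact: (dth0_neq0 tau_gt0 th_neq0). Qed.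

End TripleProduct.

(** * Partial fractions of prime forms *)
Section PartialFractions.
Variable R : realType.
Local Notation C := R[i].
Variable tau : C.
Hypothesis tau_gt0 : 0 < complex.Im tau.
Local Notation L := (nome_rate tau).
Local Notation ipi := (ipi R).
Local Notation th := (th tau).
Local Notation dth := (dth tau).
Local Notation gen := (gen tau).
Local Notation kron := (kron tau).
Local Notation annulus := (annulus tau).

Definition ann (u : C) := (- L < complex.Re u < L) && (complex.Re u != 0).

Lemma annP u : ann u -> exists b, annulus b u.
Proof.
move=> /andP[/andP[h1 h2] h3].
have [h|h] := ltP 0 (complex.Re u); first by exists true; rewrite /Submission.annulus h.
by exists false; rewrite /Submission.annulus h1 lt_neqAle h3.
Qed.

Lemma ann_gen u : ann u -> gen u.
Proof. by move=> /annP[b]; apply: gen_annulus. Qed.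

Lemma annN u : ann (- u) = ann u.
Proof. by rewrite /ann raddfN /= ltrNl opprK ltrNl oppr_eq0 [X in X && _]andbC. Qed.

Lemma annB u v : ann (u - v) = ann (v - u).
Proof. by rewrite -annN opprB. Qed.

Lemma kron_kernel b u A : annulus b u -> gen A -> kron u A = - skernel tau b u A.
Proof.
move=> du gA; rewrite skernelE ?opprK //; apply: th_neq0 => //.
exact: gen_annulus du.
Qed.

(* Partial fractions of [1/((1 - a)(1 - c))], [a] and [c] being [exp A1 q^m] and
   [exp A2 q^n], turn the product of the two series into a sum of two products. *)
Lemma fay (u1 u2 A1 A2 : C) : ann u1 -> ann u2 -> ann (u2 - u1) ->
  gen A1 -> gen A2 -> gen (A1 + A2) ->
  kron u1 A1 * kron u2 A2 =
  kron u1 (A1 + A2) * kron (u2 - u1) A2 + kron u2 (A1 + A2) * kron (u1 - u2) A1.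
Proof.
move=> /annP[b1 d1] /annP[b2 d2] /annP[b d] g1 g2 g12.
have d' : annulus (~~ b) (u1 - u2).
  case: b d => /=; rewrite /Submission.annulus !raddfB /= => /andP[h1 h2]; apply/andP; split; lra.
(* The order of Re u1 and Re u2 excludes two of the eight sign patterns. The rational identity holds
   exactly when b1 b2 = b1 b + b2 (1 - b), which is true of the other six. *)
have hb : if b then b1 ==> b2 else b2 ==> b1.
  case: b1 d1 => /andP[x1 x2]; case: b2 d2 => /andP[x3 x4]; case: b d {d'} => //=; rewrite raddfB /= => /andP[x5 x6]; lra.
rewrite (kron_kernel d1 g1) (kron_kernel d2 g2) (kron_kernel d1 g12) (kron_kernel d2 g12).
rewrite (kron_kernel d g2) (kron_kernel d' g1) !mulrNN.
have S b u A (du : annulus b u) (gA : gen A) := summ_kterm tau_gt0 du gA.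
have H b u A (du : annulus b u) (gA : gen A) := has_csum (S b u A du gA).
have P0 := has_sumM (S _ _ _ d1 g1) (S _ _ _ d2 g2) (H _ _ _ d1 g1) (H _ _ _ d2 g2).
have P1 := has_sumM (S _ _ _ d1 g12) (S _ _ _ d g2) (H _ _ _ d1 g12) (H _ _ _ d g2).
have P2 := has_sumM (S _ _ _ d2 g12) (S _ _ _ d' g1) (H _ _ _ d2 g12) (H _ _ _ d' g1).
pose h1 (p : int * int) := (p.1 + p.2, p.2); pose h2 (p : int * int) := (p.1 + p.2, p.1).
have h1i : injective h1 by move=> [x y] [x' y'] [/= + e]; rewrite e => /addIr ->.
have h2i : injective h2 by move=> [x y] [x' y'] [/= + e]; rewrite e => /addrI ->.
have s1 (F : int * int -> C) i : F i != 0 -> exists j, h1 j = i.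
  by move=> _; exists (i.1 - i.2, i.2); rewrite /h1 /= subrK; case: i.
have s2 (F : int * int -> C) i : F i != 0 -> exists j, h2 j = i.
  by move=> _; exists (i.2, i.1 - i.2); rewrite /h2 /= addrC subrK; case: i.
have Q1 := (has_sum_inj _ h1i (s1 _)).2 P1; have Q2 := (has_sum_inj _ h2i (s2 _)).2 P2.
apply: has_sum_unique P0 _; apply: eq_has_sum (has_sumD Q1 Q2) => -[m n] /=.
rewrite /kterm /kap.
set a := cexp (A1 + 2 * ipi * tau * m%:~R); set c := cexp (A2 + 2 * ipi * tau * n%:~R).
have -> : cexp (A1 + A2 + 2 * ipi * tau * (m + n)%:~R) = a * c.
  by rewrite /a /c -cexpD intrD; congr cexp; ring.
have a1 : 1 - a != 0 by rewrite subr_eq0 eq_sym; apply: g1.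
have c1 : 1 - c != 0 by rewrite subr_eq0 eq_sym; apply: g2.
have ac1 : 1 - a * c != 0.
  have -> : a * c = cexp (A1 + A2 + 2 * ipi * tau * (m + n)%:~R).
    by rewrite /a /c -cexpD intrD; congr cexp; ring.
  by rewrite subr_eq0 eq_sym; apply: g12.
have e1 : cexp ((m + n)%:~R * u1) * cexp (n%:~R * (u2 - u1)) = cexp (m%:~R * u1) * cexp (n%:~R * u2).
  by rewrite -!cexpD; congr cexp; rewrite intrD; ring.
have e2 : cexp ((m + n)%:~R * u2) * cexp (m%:~R * (u1 - u2)) = cexp (m%:~R * u1) * cexp (n%:~R * u2).
  by rewrite -!cexpD; congr cexp; rewrite intrD; ring.
rewrite [X in X + _ = _]mulrACA e1 [X in _ + X = _]mulrACA e2 [RHS]mulrACA -mulrDr.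
congr (_ * _); move: a c a1 c1 ac1 {e1 e2} => a c a1 c1 ac1.
move: hb; move: (b1) (b2) (b) => [] [] [] //= _; rewrite ?mulr1n ?mulr0n.
all: by field; rewrite ?a1 ?c1 ?ac1.
Qed.

(** Factors are absorbed one at a time from the left by [fay], which merges the accumulated
    parameter with the next one; hence the genericity of all prefix sums. *)
Lemma kron_prod (s : seq (C * C)) (z : C) : s != [::] ->
  (forall x, x \in s -> ann (z - x.1)) ->
  pairwise (fun x y => ann (x.1 - y.1)) s ->
  (forall x, x \in s -> gen x.2) ->
  (forall k, (0 < k <= size s)%N -> gen (\sum_(y <- take k s) y.2)) ->
  \prod_(x <- s) kron (z - x.1) x.2 =
  \sum_(x <- s) kron (z - x.1) (\sum_(y <- s) y.2) *
     \prod_(y <- s | y.1 != x.1) kron (x.1 - y.1) y.2.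
Proof.
elim/last_ind: s z => // s [p A] IH z _ Hz Hp Hg Hs.
have [->|s0] := eqVneq s [::].
  by rewrite /= !big_seq1 /= big_mkcond big_seq1 /= eqxx mulr1.
move: Hp; rewrite pairwise_rcons => /andP[/allP /= Hsp Hp].
have Hz' x : x \in s -> ann (z - x.1) by move=> xs; apply: Hz; rewrite mem_rcons inE xs orbT.
have Hg' x : x \in s -> gen x.2 by move=> xs; apply: Hg; rewrite mem_rcons inE xs orbT.
have Hs' k : (0 < k <= size s)%N -> gen (\sum_(y <- take k s) y.2).
  move=> /andP[k0 ks]; have := Hs k; rewrite size_rcons k0 leqW // => /(_ isT).
  by rewrite -cats1 takel_cat.
have zp : ann (z - p) by apply: (Hz (p, A)); rewrite mem_rcons inE eqxx.
have gA : gen A by apply: (Hg (p, A)); rewrite mem_rcons inE eqxx.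
set T := \sum_(y <- s) y.2.
have gT : gen T by have := Hs' (size s); rewrite take_size leqnn andbT; apply; rewrite lt0n size_eq0.
have gTA : gen (T + A).
  have := Hs (size s).+1; rewrite size_rcons leqnn /= => /(_ isT).
  by rewrite take_oversize ?size_rcons // big_rcons /=.
have np x : x \in s -> x.1 != p.
  move=> /Hsp; apply: contraL => /eqP ->; by rewrite subrr /ann /= eqxx andbF.
rewrite [LHS]big_rcons /= (IH z) // mulr_suml [RHS]big_rcons /=.
rewrite -/T [X in _ = X + _]big_seq.
have -> : \sum_(y <- rcons s (p, A)) y.2 = T + A by rewrite big_rcons.
(* The second terms produced by [fay] share a factor with pole at z = p; their sum is the induction
   hypothesis read backwards, at the point p. *)
have -> : \prod_(y <- rcons s (p, A) | y.1 != p) kron (p - y.1) y.2 =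
   \sum_(x <- s) kron (p - x.1) T * \prod_(y <- s | y.1 != x.1) kron (x.1 - y.1) y.2.
  rewrite big_rcons /= eqxx mulr1 -(IH p) //; last by move=> x xs; rewrite annB; apply: Hsp.
  rewrite big_seq_cond [RHS]big_seq; apply: eq_bigl => x.
  by case: (boolP (x \in s)) => //= /np ->.
rewrite mulr_sumr [X in _ = _ + X]big_seq -big_split /= big_seq; apply: eq_bigr => x xs.
rewrite big_rcons /= eq_sym np // [X in X * _ = _]mulrC -mulrA -/T.
have e : z - p - (z - x.1) = x.1 - p by ring.
have e' : z - x.1 - (z - p) = p - x.1 by ring.
have := @fay (z - x.1) (z - p) T A (Hz' _ xs) zp; rewrite e e' => -> //; last exact: Hsp.
by ring.
Qed.

Local Notation K u := (prime_form u tau).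

Lemma primeN u : prime_form (- u) tau = - prime_form u tau.
Proof.
rewrite !prime_formE // thN // -[RHS]mulNr; congr (_ / _).
by rewrite [- cexp u * _]mulNr mulrN mulrA -cexpD; congr (- (cexp _ * _)); field.
Qed.

Lemma prime_neq0 u : gen u -> prime_form u tau != 0.
Proof.
move=> gu; rewrite prime_formE //; apply: mulf_neq0; last by rewrite invr_eq0 dth_neq0.
by apply: mulf_neq0; [exact: cexp_neq0|exact: th_neq0].
Qed.

Lemma kron_prime u A : kron u A = prime_form (u + A) tau / (prime_form u tau * prime_form A tau).
Proof.
rewrite !prime_formE // /Submission.kron mulrDl cexpD.
have [->|tu] := eqVneq (th u) 0; first by rewrite !(mul0r, mulr0, invr0).
have [->|tA] := eqVneq (th A) 0; first by rewrite !(mul0r, mulr0, invr0).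
have d0 := dth_neq0 tau_gt0; have c1 := cexp_neq0 (u / 2); have c2 := cexp_neq0 (A / 2).
move: (th u) (th A) (th (u + A)) (dth 0) (cexp (u / 2)) (cexp (A / 2)) tu tA d0 c1 c2.
move=> x y w d c c' x0 y0 d0 c0 c0'.
by field; rewrite x0 y0 d0 c0 c0'.
Qed.

(** As a function of z, the left side has poles at [p0 :: ps] and zeros at [rs] and at -B. The shift
    t' is the multiplier parameter shared by all the terms on the right. *)
Lemma prime_partial_fractions (z t' p0 : C) (ps rs : seq C) : size ps = size rs ->
  (forall p, p \in p0 :: ps -> ann (z - p)) ->
  pairwise (fun x y => ann (x - y)) (p0 :: ps) ->
  (forall k, (k <= size ps)%N ->
     gen (t' - \sum_(y <- drop k (zip ps rs)) (y.1 - y.2))) ->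
  (forall p r, p \in ps -> r \in rs -> ann (p - r)) ->
  let B := \sum_(r <- rs) r - \sum_(p <- p0 :: ps) p + t' in
  K (z + B) * \prod_(r <- rs) K (z - r) / \prod_(p <- p0 :: ps) K (z - p) =
  \sum_(p <- p0 :: ps) K (z - p + t') / (K t' * K (z - p)) * K (p + B) *
    (\prod_(r <- rs) K (p - r) / \prod_(y <- p0 :: ps | y != p) K (p - y)).
Proof.
move=> sz Hz Hp Hg Hpr B.
(* A kernel with pole p and parameter p - r has its zero at r. The pole [p0] receives the extra zero
   -B, and with B as chosen the parameters add up to t'. *)
pose kl := (p0, p0 + B) :: [seq (y.1, y.1 - y.2) | y <- zip ps rs].
have e1 : [seq x.1 | x <- kl] = p0 :: ps.
  by rewrite /kl /= -map_comp; congr (_ :: _); rewrite -[RHS](unzip1_zip (t := rs)) ?sz.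
have sumzip : \sum_(y <- zip ps rs) (y.1 - y.2) = \sum_(p <- ps) p - \sum_(r <- rs) r.
  rewrite sumrB; congr (_ - _).
    by rewrite -[in RHS](unzip1_zip (s := ps) (t := rs)) ?sz // big_map.
  by rewrite -[in RHS](unzip2_zip (s := ps) (t := rs)) ?sz // big_map.
have e2 : \sum_(y <- kl) y.2 = t'.
  rewrite /kl big_cons /= big_map /= sumzip /B big_cons; ring.
have e3 x : \prod_(y <- kl) K (x - y.1 + y.2) = K (x + B) * \prod_(r <- rs) K (x - r).
  rewrite /kl big_cons /= addrA subrK; congr (_ * _).
  rewrite big_map /= -[in RHS](unzip2_zip (s := ps) (t := rs)) ?sz // big_map.
  by apply: eq_bigr => y _ /=; rewrite addrA subrK.
have gk x : x \in kl -> gen x.2.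
  rewrite inE => /orP[/eqP -> /=|/mapP[[p r] pr ->] /=].
    have := Hg 0%N; rewrite drop0 sumzip => /(_ isT).
    by rewrite /B big_cons; congr gen; ring.
  apply: ann_gen; apply: Hpr; first by have := map_f fst pr; rewrite /= -/(unzip1 _) unzip1_zip ?sz.
  by have := map_f snd pr; rewrite /= -/(unzip2 _) unzip2_zip ?sz.
have kA : \prod_(y <- kl) K y.2 != 0.
  by rewrite prodf_seq_neq0; apply/allP => x xk; apply/implyP => _; apply/prime_neq0/gk.
have := @kron_prod kl z isT.
have h1 x : x \in kl -> ann (z - x.1) by move=> xk; apply: Hz; rewrite -e1; apply: map_f.
have h2 : pairwise (fun x y : C * C => ann (x.1 - y.1)) kl.
  by have := Hp; rewrite -e1 pairwise_map.
have h3 k : (0 < k <= size kl)%N -> gen (\sum_(y <- take k kl) y.2).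
  case: k => // k /andP[_]; rewrite /kl /= ltnS size_map size_zip sz minnn => kr.
  have := Hg k; rewrite sz => /(_ kr).
  have := sumzip; rewrite -{1}(cat_take_drop k (zip ps rs)) big_cat /= => hs.
  rewrite big_cons /= -map_take big_map /=.
  have <- : p0 + B + \sum_(y <- take k (zip ps rs)) (y.1 - y.2) = t' - \sum_(y <- drop k (zip ps rs)) (y.1 - y.2).
    apply/eqP; rewrite -subr_eq0; apply/eqP.
    rewrite /B big_cons; have -> : \sum_(p <- ps) p = \sum_(r <- rs) r + (\sum_(y <- take k (zip ps rs)) (y.1 - y.2) + \sum_(y <- drop k (zip ps rs)) (y.1 - y.2)).
      by rewrite hs; ring.
    by ring.
  by [].
move=> /(_ h1 h2 gk h3) H.
have kz : \prod_(y <- kl) K (z - y.1) = \prod_(p <- p0 :: ps) K (z - p) by rewrite -e1 big_map.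
have kr1 : \prod_(x <- kl) kron (z - x.1) x.2 =
   K (z + B) * \prod_(r <- rs) K (z - r) / \prod_(p <- p0 :: ps) K (z - p) / \prod_(y <- kl) K y.2.
  rewrite -e3 -kz; under eq_bigr do rewrite kron_prime.
  rewrite [LHS]big_split /=.
  rewrite prodfV.
  rewrite [X in _ * X^-1 = _]big_split /=.
  move: (\prod_(y <- kl) K (z - y.1 + y.2)) (\prod_(y <- kl) K (z - y.1)) (\prod_(y <- kl) K y.2) => a b c.
  by rewrite invfM mulrA.
have kx x : \prod_(y <- kl | y.1 != x) kron (x - y.1) y.2 =
    K (x + B) * \prod_(r <- rs) K (x - r) / \prod_(y <- p0 :: ps | y != x) K (x - y) / \prod_(y <- kl) K y.2.
  rewrite -(e3 x) -e1 big_map.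
  rewrite (bigID (fun y : C * C => y.1 != x) predT (fun y => K (x - y.1 + y.2))) /=.
  rewrite (bigID (fun y : C * C => y.1 != x) predT (fun y => K y.2)) /=.
  have -> : \prod_(y <- kl | ~~ (y.1 != x)) K (x - y.1 + y.2) = \prod_(y <- kl | ~~ (y.1 != x)) K y.2.
    by apply: eq_bigr => y; rewrite negbK => /eqP ->; rewrite subrr add0r.
  have k0 : \prod_(y <- kl | ~~ (y.1 != x)) K y.2 != 0.
    by rewrite prodf_seq_neq0; apply/allP => y yk; apply/implyP => _; apply/prime_neq0/gk.
  under eq_bigr do rewrite kron_prime.
  rewrite [LHS]big_split /= prodfV [X in _ * X^-1 = _]big_split /=.
  move: k0; move: (\prod_(y <- kl | ~~ (y.1 != x)) K y.2) => a.
  move: (\prod_(y <- kl | y.1 != x) K (x - y.1 + y.2)) => b.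
  move: (\prod_(y <- kl | y.1 != x) K (x - y.1)) => c.
  move: (\prod_(y <- kl | y.1 != x) K y.2) => d.
  move=> a0; rewrite !invfM.
  have -> : b * a / c * (d^-1 / a) = (a / a) * (b * (c^-1 * d^-1)) by ring.
  by rewrite mulfV // mul1r.
apply: (mulIf (invr_neq0 kA)); rewrite -kr1 H e2 mulr_suml -e1 big_map.
apply: eq_bigr => x _; rewrite kx kron_prime e1.
move: (\prod_(y <- kl) K y.2) (\prod_(r <- rs) K (x.1 - r)) (\prod_(y <- _ | _) _) => e f g.
move: (K (z - x.1 + t')) (K t') (K (z - x.1)) (K (x.1 + B)) => a b c d.
by rewrite [c * b]mulrC !mulrA.
Qed.

End PartialFractions.

(** * Words of insertions *)
Section Words.
Variable R : realType.
Local Notation C := R[i].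
Variable tau : C.
Hypothesis tau_gt0 : 0 < complex.Im tau.
Local Notation L := (nome_rate tau).
Local Notation ipi := (ipi R).
Local Notation gen := (gen tau).
Local Notation ann := (ann tau).
Local Notation K u := (prime_form u tau).
Implicit Types (w : seq (bool * C)) (x y : bool * C).

Definition sgc (e : bool) : C := if e then 1 else -1.

Lemma sgcN e : sgc (~~ e) = - sgc e.
Proof. by case: e; rewrite /sgc ?opprK. Qed.

Lemma sgc_sqr e u : sgc e * (sgc e * u) = u.
Proof. by case: e; rewrite /sgc ?mul1r // mulrA mulrNN !mul1r. Qed.

(* A word lists insertions: [(true, z)] is psi^+ at [z] and [(false, z)] is
   psi^- at [z]. *)
Definition kpair (e e' : bool) (u : C) : C := if e == e' then K u else (K u)^-1.

Fixpoint wprod w : C :=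
  if w is x :: w' then \prod_(y <- w') kpair x.1 y.1 (x.2 - y.2) * wprod w' else 1.

Definition wsum w : C := \sum_(x <- w) sgc x.1 * x.2.

(** The convergence region in logarithmic form. Being stated for all pairs, it passes to subwords,
    as the recursion requires. *)
Definition region w : bool := pairwise (fun x y => annulus tau true (x.2 - y.2)) w.

Lemma kpairN e e' u : kpair e e' (- u) = - kpair e' e u.
Proof. by rewrite /kpair eq_sym primeN //; case: ifP => _ //; rewrite invrN. Qed.

Lemma kpairV e e' u : (kpair e e' u)^-1 = kpair (~~ e) e' u.
Proof. by rewrite /kpair; case: e e' => [] [] /=; rewrite ?invrK. Qed.

Lemma annulus_ann b u : annulus tau b u -> ann u.
Proof.
have L0 := nome_rate_gt0 tau_gt0.
by case: b => /andP[h1 h2]; rewrite /Submission.ann ?(gt_eqF h1) ?(lt_eqF h2) andbT; apply/andP; split; lra.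
Qed.

Lemma kpair_neq0 e e' u : ann u -> kpair e e' u != 0.
Proof.
move=> /(ann_gen tau_gt0)/(prime_neq0 tau_gt0) h.
by rewrite /kpair; case: ifP => _ //; rewrite invr_neq0.
Qed.

Lemma region_cat w1 w2 : region (w1 ++ w2) -> forall x y, x \in w1 -> y \in w2 -> ann (x.2 - y.2).
Proof.
rewrite /region pairwise_cat => /and3P[/allrelP h _ _] x y xw yw.
exact: (@annulus_ann true) (h _ _ xw yw).
Qed.

Lemma region_cons x w : region (x :: w) -> region w /\ forall y, y \in w -> ann (x.2 - y.2).
Proof.
rewrite /region /= => /andP[/allP h ->]; split=> // y /h; exact: (@annulus_ann true).
Qed.

Lemma wprod_neq0 w : region w -> wprod w != 0.
Proof.
elim: w => [|x w IH] /=; first by rewrite oner_neq0.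
move=> /region_cons[/IH h0 h]; rewrite mulf_neq0 // prodf_seq_neq0; apply/allP => y yw.
by apply/implyP => _; apply: kpair_neq0; apply: h.
Qed.

Lemma wprod_front w1 y w2 : wprod (w1 ++ y :: w2) =
  (-1) ^+ size w1 * (\prod_(x <- w1 ++ w2) kpair y.1 x.1 (y.2 - x.2) * wprod (w1 ++ w2)).
Proof.
elim: w1 => [|x w1 IH] /=; first by rewrite expr0 mul1r.
rewrite IH big_cons !big_cat big_cons /=.
rewrite -[x.2 - y.2]opprB kpairN exprS.
move: (kpair y.1 x.1 _) (wprod _) (\prod_(j <- w1) kpair x.1 _ _) (\prod_(j <- w2) kpair x.1 _ _) => a b c d.
move: (\prod_(j <- w1) _) (\prod_(j <- w2) _) ((-1) ^+ _) => f g h.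
ring.
Qed.

Definition remove (T : Type) (j : nat) (s : seq T) := take j s ++ drop j.+1 s.

Lemma remove_split (T : Type) (x0 : T) j (s : seq T) : (j < size s)%N ->
  s = take j s ++ nth x0 s j :: drop j.+1 s.
Proof. by move=> js; rewrite -drop_nth // cat_take_drop. Qed.

Lemma size_remove (T : Type) j (s : seq T) : (j < size s)%N -> size (remove j s) = (size s).-1.
Proof. by move=> js; rewrite size_cat size_drop size_take js; lia. Qed.

Lemma region_remove j w : region w -> region (remove j w).
Proof.
rewrite /region; apply: subseq_pairwise; rewrite -{2}(cat_take_drop j w) cat_subseq //.
by rewrite -add1n -drop_drop drop_subseq.
Qed.

Lemma wsum_remove x0 j w : (j < size w)%N ->
  wsum (remove j w) = wsum w - sgc (nth x0 w j).1 * (nth x0 w j).2.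
Proof.
move=> jw; have -> := congr1 wsum (remove_split x0 jw).
rewrite /wsum !big_cat big_cons /=.
by move: (sgc _ * _) (\sum_(_ <- _) _) (\sum_(_ <- _) _) => a b c; ring.
Qed.

Lemma ann_neq (a b : C) : ann (a - b) -> a != b.
Proof. by apply: contraTneq => ->; rewrite subrr /Submission.ann /= eqxx andbF. Qed.

Lemma region_prod_remove w1 y w2 (F : bool * C -> C) : region (w1 ++ y :: w2) ->
  \prod_(x <- w1 ++ y :: w2 | x.2 != y.2) F x = \prod_(x <- w1 ++ w2) F x.
Proof.
move=> reg; rewrite !big_cat big_cons eqxx /=; congr (_ * _).
  rewrite big_seq_cond [RHS]big_seq; apply: eq_bigl => x.
  case: (boolP (x \in w1)) => //= xw; apply: ann_neq.
  by apply: (region_cat reg xw); rewrite inE eqxx.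
rewrite big_seq_cond [RHS]big_seq; apply: eq_bigl => x.
case: (boolP (x \in w2)) => //= xw; apply: ann_neq; rewrite annB.
move: reg; rewrite /region pairwise_cat => /and3P[_ _ reg].
by have [_] := region_cons reg; apply.
Qed.

Section ThetaFactor.
Variables (beta alpha : R).

Definition Th (u : C) : C := theta (- beta + 1 / 2) (alpha + 1 / 2) u tau.
(** The twist: [Th u] is [th (u + tparam)] up to an exponential factor. *)
Definition tparam : C := 2 * ipi * alpha%:C - 2 * ipi * tau * beta%:C.

Lemma Th_prime : exists2 c : C, c != 0 & forall e u,
  Th (sgc e * u) = c * sgc e * cexp (- beta%:C * (sgc e * u)) * K (u + sgc e * tparam).
Proof.
have r2 : (1 / 2 : R)%:C = 1 / 2 :> C by rewrite rmorphM /= fmorphV rmorph_nat rmorph1.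
pose a : C := 1 / 2 - beta%:C; pose b : C := alpha%:C + 1 / 2.
exists (dth tau 0 * cexp (ipi * tau * a ^+ 2 + 2 * ipi * a * b - tparam / 2)).
  by rewrite mulf_neq0 ?cexp_neq0 ?dth_neq0.
have main u : Th u = dth tau 0 * cexp (ipi * tau * a ^+ 2 + 2 * ipi * a * b - tparam / 2) * cexp (- beta%:C * u) * K (u + tparam).
  rewrite /Th thetaE // prime_formE //.
  have -> : (- beta + 1 / 2)%:C = a by rewrite rmorphD rmorphN /= r2 /a addrC.
  have -> : (alpha + 1 / 2)%:C = b by rewrite rmorphD /= r2.
  have -> : u + 2 * ipi * (b - 1 / 2) + 2 * ipi * tau * (a - 1 / 2) = u + tparam.
    by rewrite /a /b /tparam; ring.
  have -> : cexp (ipi * tau * a ^+ 2 + a * (u + 2 * ipi * b)) =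
    cexp (ipi * tau * a ^+ 2 + 2 * ipi * a * b - tparam / 2) * cexp (- beta%:C * u) * cexp ((u + tparam) / 2).
    by rewrite -!cexpD; congr cexp; rewrite /a; field.
  have d0 := dth_neq0 tau_gt0.
  move: (cexp _) (cexp _) (cexp _) (th _ _) (dth _ _) d0 => x1 x2 x3 x4 x5 x0.
  by field.
move=> [] u; rewrite main; first by rewrite /sgc !mul1r mulr1.
have -> : sgc false * u + tparam = - (u + sgc false * tparam) by rewrite /sgc; ring.
rewrite primeN //; move: (K _) (cexp _) (cexp _) (dth _ _) => x1 x2 x3 x4.
by rewrite /sgc; ring.
Qed.

End ThetaFactor.

Lemma kpair_prod e p (P : pred C) w :
  \prod_(x <- w | P x.2) kpair e x.1 (p - x.2) =
  \prod_(r <- [seq x.2 | x <- w & x.1 == e] | P r) K (p - r) /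
  \prod_(y <- [seq x.2 | x <- w & x.1 != e] | P y) K (p - y).
Proof.
elim: w => [|x w IH] /=; first by rewrite !big_nil invr1 mulr1.
rewrite big_cons IH /kpair (eq_sym e).
case: (x.1 == e) => /=; rewrite big_cons; case: (P x.2) => //.
  by rewrite mulrA.
move: (K _) (\prod_(r <- _ | _) _) (\prod_(r <- _ | _) _) => a b c.
by rewrite invfM mulrCA.
Qed.

Lemma sum_remove (V : nmodType) (T : Type) (x0 : T) (s : seq T) (F : T -> V) :
  \sum_(j < size s) F (nth x0 s j) = \sum_(x <- s) F x.
Proof. by rewrite (big_nth x0) big_mkord. Qed.

(** This is [prime_partial_fractions] with poles at the letters of charge opposite to e and zeros at
    the others. The shifts [cs] are chosen before alpha: they depend only on the positions, so alpha
    can later be moved to satisfy all the conditions. *)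
Lemma word_recursion beta e z w : region ((e, z) :: w) ->
  count (fun x => x.1 != e) w = (count (fun x => x.1 == e) w).+1 ->
  exists cs : seq C, forall alpha,
    (forall c, c \in cs -> gen (sgc e * tparam beta alpha + c)) ->
  Th beta alpha (wsum ((e, z) :: w)) * wprod ((e, z) :: w) =
  \sum_(j < size w) (-1) ^+ j * (if (nth (e, z) w j).1 != e then
     Th beta alpha (sgc e * (z - (nth (e, z) w j).2)) / (Th beta alpha 0 * K (z - (nth (e, z) w j).2)) *
     (Th beta alpha (wsum (remove j w)) * wprod (remove j w)) else 0).
Proof.
move=> reg ct; pose rs := [seq x.2 | x <- w & x.1 == e].
have [p0 [ps eps]] : exists p0 ps, [seq x.2 | x <- w & x.1 != e] = p0 :: ps.
  case E: [seq x.2 | x <- w & x.1 != e] => [|p0 ps]; last by exists p0, ps.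
  by move: ct; rewrite -size_filter -(size_map snd) /= E.
have sz : size ps = size rs.
  by move: ct; rewrite -!size_filter -(size_map snd) eps /= => -[->]; rewrite size_map.
have [rw hw] := region_cons reg.
(* One shift for each suffix of the pairing of poles with zeros; the empty suffix gives genericity
   of t' itself. *)
exists [seq - \sum_(y <- drop k (zip ps rs)) (y.1 - y.2) | k <- iota 0 (size ps).+1] => alpha hg.
set t' := sgc e * tparam beta alpha in hg.
have {}hg k : (k <= size ps)%N -> gen (t' - \sum_(y <- drop k (zip ps rs)) (y.1 - y.2)).
  by move=> ks; apply: hg; apply/mapP; exists k => //; rewrite mem_iota.
have gt : gen t'.
  have := hg _ (leqnn _); rewrite drop_oversize ?size_zip ?geq_minl //.
  by rewrite big_nil subr0.
have psw p : p \in p0 :: ps -> exists2 x, x \in w & x.1 != e /\ x.2 = p.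
  by rewrite -eps => /mapP[x]; rewrite mem_filter => /andP[xe xw] ->; exists x.
have rsw r : r \in rs -> exists2 x, x \in w & x.1 == e /\ x.2 = r.
  by move=> /mapP[x]; rewrite mem_filter => /andP[xe xw] ->; exists x.
have hz p : p \in p0 :: ps -> ann (z - p).
  by move=> /psw[x xw [_ <-]]; exact: hw.
have pairw : pairwise (fun a b : C => ann (a - b)) [seq x.2 | x <- w].
  rewrite pairwise_map; apply: sub_pairwise rw => x y; exact: (@annulus_ann true).
have hp : pairwise (fun a b : C => ann (a - b)) (p0 :: ps).
  by rewrite -eps; apply: subseq_pairwise pairw; apply: map_subseq; apply: filter_subseq.
have hdiff x y : x \in w -> y \in w -> x != y -> ann (x.2 - y.2).
  move=> /(nthP x)[i iw <-] /(nthP x)[j jw <-] ij.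
  have /(pairwiseP 0) hP := pairw.
  have [lt|lt|eq] := ltngtP i j; last by rewrite eq eqxx in ij.
    by have := hP i j; rewrite !inE size_map => /(_ iw jw lt); rewrite !(nth_map x).
  by have := hP j i; rewrite !inE size_map => /(_ jw iw lt); rewrite !(nth_map x) // annB.
have hpr p r : p \in ps -> r \in rs -> ann (p - r).
  move=> pp /rsw[y yw [ye <-]].
  have /psw[x xw [xe <-]] : p \in p0 :: ps by rewrite inE pp orbT.
  by apply: hdiff => //; apply: contraNneq xe => ->.
have := prime_partial_fractions tau_gt0 sz hz hp hg hpr.
set B := _ + t'; rewrite /= => PF.
have hB : sgc e * wsum w + t' = B.
  rewrite /B; congr (_ + _); rewrite -eps /wsum /rs !big_map !big_filter mulr_sumr.
  rewrite (bigID (fun x : bool * C => x.1 == e)) /= -sumrN; congr (_ + _); apply: eq_bigr => x.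
    by move=> /eqP ->; rewrite sgc_sqr.
  by case: x => [[] x] /=; case: (e) => //= _; rewrite /sgc; ring.
have [c c0 hc] := Th_prime beta alpha.
pose H p := Th beta alpha (sgc e * (z - p)) / (Th beta alpha 0 * K (z - p)) *
  Th beta alpha (wsum w + sgc e * p) *
  (\prod_(r <- rs) K (p - r) / \prod_(y <- p0 :: ps | y != p) K (p - y)).
(* Bringing the letter j to the front of w costs (-1)^j. Its factors with the remaining letters then
   cancel the residue in the partial fractions, as the charges e and y.1 are opposite. *)
have step (j : 'I_(size w)) : (-1) ^+ j * (if (nth (e, z) w j).1 != e then
     Th beta alpha (sgc e * (z - (nth (e, z) w j).2)) / (Th beta alpha 0 * K (z - (nth (e, z) w j).2)) *
     (Th beta alpha (wsum (remove j w)) * wprod (remove j w)) else 0) =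
   if (nth (e, z) w j).1 != e then H (nth (e, z) w j).2 * wprod w else 0.
  set y := nth (e, z) w j; case: ifP => ye; last by rewrite mulr0.
  have ew : w = take j w ++ y :: drop j.+1 w by apply: remove_split.
  have yw : y \in w by apply: mem_nth.
  have ey : y.1 = ~~ e by case: (y.1) (e) ye => [] [].
  rewrite (wsum_remove (e, z)) // -/y ey sgcN mulNr opprK /H.
  have -> : \prod_(r <- rs) K (y.2 - r) / \prod_(p <- p0 :: ps | p != y.2) K (y.2 - p) =
      \prod_(x <- remove j w) kpair e x.1 (y.2 - x.2).
    have -> : \prod_(r <- rs) K (y.2 - r) = \prod_(r <- rs | r != y.2) K (y.2 - r).
      rewrite big_seq [RHS]big_seq_cond; apply: eq_bigl => r.
      case: (boolP (r \in rs)) => //= /rsw[x xw [xe <-]]; apply/esym.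
      have : ann (x.2 - y.2) by apply: hdiff => //; apply: contraNneq ye => <-; rewrite xe.
      exact: ann_neq.
    rewrite -eps -kpair_prod /remove -(region_prod_remove (y := y)) -?ew //.
  have ewp : wprod w = (-1) ^+ j * (\prod_(x <- remove j w) kpair y.1 x.1 (y.2 - x.2) * wprod (remove j w)).
    by have := wprod_front (take j w) y (drop j.+1 w); rewrite -ew size_take ltn_ord.
  have eV : \prod_(x <- remove j w) kpair e x.1 (y.2 - x.2) = (\prod_(x <- remove j w) kpair y.1 x.1 (y.2 - x.2))^-1.
    by rewrite -prodfV; apply: eq_bigr => x _; rewrite kpairV ey negbK.
  have k0 : \prod_(x <- remove j w) kpair y.1 x.1 (y.2 - x.2) != 0.
    have := wprod_neq0 rw; rewrite ewp; apply: contraNneq => ->; by rewrite mul0r mulr0.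
  rewrite eV ewp; move: k0.
  move: (\prod_(x <- _) _) (wprod _) ((Th beta alpha 0 * K (z - y.2))^-1)
    (Th beta alpha (sgc e * (z - y.2))) (Th beta alpha (wsum w + sgc e * y.2)) ((-1) ^+ j) => x1 x2 x3 x4 x5 x6 x10.
  by field.
rewrite (eq_bigr _ (fun j _ => step j)) (sum_remove (e, z) w (fun y => if y.1 != e then H y.2 * wprod w else 0)).
rewrite -big_mkcond -[RHS]big_filter -(big_map snd xpredT (fun p => H p * wprod w)) eps.
rewrite -mulr_suml /= mulrA; congr (_ * _).
have -> : \prod_(y <- w) kpair e y.1 (z - y.2) = \prod_(r <- rs) K (z - r) / \prod_(p <- p0 :: ps) K (z - p).
  by rewrite (kpair_prod e z xpredT) eps.
have hT u : Th beta alpha u = c * sgc e * cexp (- beta%:C * u) * K (sgc e * u + t').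
  by rewrite -{1}(sgc_sqr e u) hc sgc_sqr.
have -> : wsum ((e, z) :: w) = sgc e * (z + sgc e * wsum w).
  by rewrite /wsum big_cons /= mulrDr sgc_sqr.
rewrite hT sgc_sqr -addrA hB.
have -> : \sum_(p <- p0 :: ps) H p = c * sgc e * cexp (- beta%:C * (sgc e * (z + sgc e * wsum w))) *
   (K (z + B) * \prod_(r <- rs) K (z - r) / \prod_(p <- p0 :: ps) K (z - p)); last first.
  move: (\prod_(r <- rs) K (z - r)) (\prod_(p <- p0 :: ps) K (z - p)) (K (z + B)) => x1 x2 x3.
  by move: (cexp _) => x4; ring.
rewrite PF mulr_sumr; apply: eq_bigr => p _; rewrite /H !hT !mulr0 add0r cexp0 mulr1 sgc_sqr.
have -> : sgc e * (wsum w + sgc e * p) + t' = p + B.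
  by rewrite -hB mulrDr sgc_sqr; ring.
have -> : cexp (- beta%:C * (sgc e * (z + sgc e * wsum w))) =
   cexp (- beta%:C * (sgc e * (z - p))) * cexp (- beta%:C * (wsum w + sgc e * p)).
  rewrite -cexpD; congr cexp; rewrite mulrDr sgc_sqr; ring.
have cs0 : c * sgc e != 0 by rewrite mulf_neq0 // /sgc; case: (e); rewrite ?oppr_eq0 oner_neq0.
move: (\prod_(r <- rs) K (p - r)) (\prod_(y <- p0 :: ps | y != p) K (p - y)) => x1 x2.
move: (K t') (K (z - p)) (K (z - p + t')) (K (p + B)) => x3 x4 x5 x6.
move: (cexp (- beta%:C * (sgc e * (z - p)))) (cexp (- beta%:C * (wsum w + sgc e * p))) (c * sgc e) cs0 => x7 x8 x9 x90.
rewrite !invfM.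
have -> : x9 * x7 * x5 * (x9^-1 * x3^-1 * x4^-1) * (x9 * x8 * x6) * (x1 / x2) =
  (x9 / x9) * (x9 * (x7 * x8) * (x5 * (x3^-1 * x4^-1) * x6 * (x1 / x2))) by ring.
by rewrite mulfV // mul1r.
Qed.

(** The shift is purely imaginary, so it does not change |e^A q^m|, and at most one m has this
    modulus equal to 1. Only that m has to be avoided. *)
Lemma gen_eventually e (A : C) : exists N, forall n, (N <= n)%N ->
  gen (A + sgc e * (2 * ipi * (1 / n.+1%:R))).
Proof.
have Rsg (x : R) : complex.Re (sgc e * (ipi * x%:C)) = 0.
  have h : complex.Re (ipi * x%:C) = 0 by rewrite Re_ipi /= mulr0.
  by rewrite /sgc; case: e; rewrite ?mul1r // mulN1r; case: (ipi * _) h => a b /= ->; rewrite oppr0.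
have e1 n : sgc e * (2 * ipi * (1 / n.+1%:R)) = sgc e * (ipi * (2 / n.+1%:R)%:C).
  by rewrite rmorphM /= fmorphV !rmorph_nat mulrA [2 * _]mulrC; move: (sgc e) => s; ring.
have [[m hm]|nm] := pselect (exists m : int, complex.Re A = L * m%:~R); last first.
  exists 0%N => n _; apply: gen_Re => m; rewrite e1 raddfD /= Rsg addr0.
  by apply/negP => /eqP h; apply: nm; exists m.
have L0 := nome_rate_gt0 tau_gt0.
pose v := cexp (A + 2 * ipi * tau * m%:~R).
pose u (n : nat) := cexp (sgc e * (ipi * (2 / n.+1%:R)%:C)).
suff [N hN] : exists N, forall n, (N <= n)%N -> v * u n != 1.
  exists N => n nN k; rewrite e1; have [->|km] := eqVneq k m.
    by rewrite addrAC cexpD; apply: hN.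
  apply/negP => /eqP h; have := nm_cexp_tau tau (A + sgc e * (ipi * (2 / n.+1%:R)%:C)) k.
  rewrite h nm1 raddfD /= Rsg addr0 hm -mulrBr -[LHS]expR0 => /expR_inj/esym/eqP.
  rewrite mulf_eq0 (gt_eqF L0) /= subr_eq0 eqr_int => /eqP mk.
  by rewrite mk eqxx in km.
have [v1|v1] := eqVneq v 1.
  (* From n = 2 on, 2/(n+1) < 1, so the angle of the shift lies strictly between 0 and pi in
     absolute value and its sine does not vanish. *)
  exists 2%N => n n2; rewrite v1 mul1r /u; apply/negP => /eqP.
  set x : R := 2 / n.+1%:R.
  have x0 : 0 < x by rewrite divr_gt0.
  have x1 : x < 1 by rewrite ltr_pdivrMr ?ltr0n // mul1r ltr_nat.
  have sx : 0 < sin (pi * x).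
    by apply: sin_gt0_pi; rewrite mulr_gt0 ?pi_gt0 //= gtr_pMr ?pi_gt0.
  have -> : sgc e * (ipi * x%:C) = (0 +i* ((if e then 1 else -1) * (pi * x))).
    by rewrite /sgc /Submission.ipi; case: (e); simpc.
  rewrite /cexp /= expR0 mul1r => -[_].
  by case: (e); rewrite ?mul1r ?mulN1r ?sinN => h; move: sx; lra.
have cu : ((u : nat -> C^o) @ \oo --> (1 : C^o))%classic.
  have -> : (1 : C) = cexp (sgc e * (ipi * 0)) by rewrite !mulr0 cexp0.
  apply: cvgs_cexp; apply: (@cvgM C); first exact: cvg_cst.
  apply: (@cvgM C); first exact: cvg_cst.
  exact: cvgs_inv_succ.
have d0 : 0 < nm (v - 1) by rewrite nm_gt0 subr_eq0.
have [N hN] := (cvgsP _ _).1 cu _ d0; exists N => n /hN h.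
apply/negP => /eqP h1; move: h; have -> : v - 1 = v * (1 - u n) by rewrite mulrBr h1 mulr1.
rewrite nmM /v nm_cexp_tau hm subrr expR0 mul1r ltxx //.
Qed.

End Words.

(** * Fermions on the Fock space *)
Lemma anticomm_comb (K : comNzRingType) (V : lmodType K) (A B : V -> V) (d c : K) (b v : V) :
  {morph A : x y / x + y} -> {morph B : x y / x + y} ->
  (forall k x, A (k *: x) = k *: A x) -> (forall k x, B (k *: x) = k *: B x) ->
  A (B b) = - B (A b) + d *: b -> A (B v) = - B (A v) + d *: v ->
  A (B (c *: b + v)) = - B (A (c *: b + v)) + d *: (c *: b + v).
Proof.
move=> AD BD AZ BZ; rewrite BD BZ AD AZ AD AZ BD BZ => -> ->.
move: (B (A b)) (B (A v)) => x y.
by rewrite [c *: (_ + _)]scalerDr scalerN [d *: (_ + _)]scalerDr !scalerA [d * c]mulrC addrACA -opprD.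
Qed.

Section FockSpace.
Variable R : realType.
Local Notation C := R[i].
Local Notation fock := (fock R).
Local Notation basis := (@Defs.basis R).
Implicit Types (S : fstate) (p r : fmode) (v : fock).

Lemma mcoeff_basis S S' : mcoeff S' (basis S : {malg C[fstate]}) = (S == S')%:R :> C.
Proof. by rewrite /Defs.basis mcoeffU. Qed.

Lemma linear_extE (F : fstate -> fock) v (D : {fset fstate}) :
  (msupp (v : {malg C[fstate]}) `<=` D)%fset ->
  linear_ext F v = \sum_(S <- D) mcoeff S (v : {malg C[fstate]}) *: F S.
Proof.
move=> sD; rewrite /linear_ext; apply: big_fset_incl => // S _ nS.
by rewrite mcoeff_outdom // scale0r.
Qed.

Lemma linear_ext_basis (F : fstate -> fock) S : linear_ext F (basis S) = F S.
Proof.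
rewrite (linear_extE _ (D := [fset S]%fset)); last by rewrite /Defs.basis msuppU oner_eq0.
by rewrite big_seq_fset1 mcoeff_basis eqxx scale1r.
Qed.

Lemma linear_extZ (F : fstate -> fock) (c : C) v : linear_ext F (c *: v) = c *: linear_ext F v.
Proof.
rewrite (linear_extE _ (msuppZ_le _ _)) /linear_ext scaler_sumr.
by apply: eq_bigr => S _; rewrite mcoeffZ scalerA.
Qed.

Lemma linear_extD (F : fstate -> fock) v w : linear_ext F (v + w) = linear_ext F v + linear_ext F w.
Proof.
pose D := (msupp (v : {malg C[fstate]}) `|` msupp (w : {malg C[fstate]}))%fset.
rewrite (linear_extE F (D := D) (msuppD_le _ _)).
rewrite (linear_extE F (v := v) (D := D)) ?fsubsetUl // (linear_extE F (v := w) (D := D)) ?fsubsetUr //.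
by rewrite -big_split; apply: eq_bigr => S _; rewrite mcoeffD scalerDl.
Qed.

Lemma linear_ext0 (F : fstate -> fock) : linear_ext F 0 = 0.
Proof. by rewrite /linear_ext msupp0 big_seq_fset0. Qed.

Lemma fock_ind (P : fock -> Prop) : P 0 -> (forall c S v, P v -> P (c *: basis S + v)) -> forall v, P v.
Proof.
move=> P0 PS v; have -> : v = \sum_(S <- msupp (v : {malg C[fstate]})) mcoeff S (v : {malg C[fstate]}) *: basis S.
  rewrite {1}[v](monalgE v); apply: eq_bigr => S _; apply/malgP => S'.
  by rewrite mcoeffZ mcoeff_basis mcoeffU mulr_natr.
elim: (enum_fset _) => [|S s IH]; first by rewrite big_nil.
by rewrite big_cons; apply: PS.
Qed.

Lemma psiZ e n (c : C) v : psi e n (c *: v) = c *: psi e n v.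
Proof. exact: linear_extZ. Qed.
Lemma psiD e n v w : psi e n (v + w) = psi e n v + psi e n w.
Proof. exact: linear_extD. Qed.
Lemma psi0 e n : psi e n 0 = 0 :> fock.
Proof. exact: linear_ext0. Qed.

(** The creation mode that psi^e(n) inserts or removes. For n >= 0 it is the mode of opposite charge
    with which psi^e(n) is paired; either way the effect on a state is [toggle]. *)
Definition mode_loc (e : bool) (n : int) : fmode :=
  match n with Posz i => (~~ e, i) | Negz i => (e, i) end.
Definition creates (n : int) : bool := if n is Negz _ then true else false.
Definition toggle p S : fstate := if p \in S then (S `\ p)%fset else (p |` S)%fset.

Lemma psi_basis e n S : psi e n (basis S) =
  if (mode_loc e n \in S) == ~~ creates n then koszul R (mode_loc e n) S *: basis (toggle (mode_loc e n) S) else 0.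
Proof.
rewrite /psi linear_ext_basis /toggle; case: n => i /=; case: ifP => //.
Qed.

Lemma in_toggle p r S : (r \in toggle p S) = if r == p then p \notin S else r \in S.
Proof.
rewrite /toggle; case: ifPn => pS; rewrite !inE; have [->|rp] //= := eqVneq r p.
Qed.

Lemma toggleK p : involutive (toggle p).
Proof.
move=> S; apply/fsetP => r; rewrite !in_toggle eqxx negbK.
by have [->|] := eqVneq r p.
Qed.

Lemma toggleC p r S : toggle p (toggle r S) = toggle r (toggle p S).
Proof.
have [->//|pr] := eqVneq p r.
apply/fsetP => x; rewrite !in_toggle (negPf pr) (eq_sym r p) (negPf pr).
by have [->|_] := eqVneq x p; rewrite ?(negPf pr).
Qed.

Lemma koszulE p S : koszul R p S = \prod_(r <- S) (if (r != p) && fmode_le r p then -1 else 1).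
Proof.
rewrite /koszul; elim: (enum_fset S) => [|x s IH]; first by rewrite big_nil expr0.
by rewrite big_cons /= exprD IH; case: ifP => _; rewrite ?expr1 ?expr0.
Qed.

Lemma prod_toggle p S (F : fmode -> C) : F p * F p = 1 ->
  \prod_(r <- toggle p S) F r = F p * \prod_(r <- S) F r.
Proof.
move=> F1; rewrite /toggle; case: ifPn => pS; last by rewrite big_fsetU1.
by rewrite [in RHS](big_fsetD1 p) //= mulrA F1 mul1r.
Qed.

Lemma koszul_toggle p r S : koszul R p (toggle r S) =
  (if (r != p) && fmode_le r p then -1 else 1) * koszul R p S.
Proof. by rewrite !koszulE prod_toggle //; case: ifP => _; rewrite ?mulrNN mul1r. Qed.

Lemma koszul_sqr p S : koszul R p S * koszul R p S = 1.
Proof. by rewrite /koszul -expr2 sqrr_sign. Qed.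

Lemma fmode_le_total p r : p != r -> fmode_le p r = ~~ fmode_le r p.
Proof.
case: p r => [e i] [f j]; rewrite /fmode_le xpair_eqE /= (eq_sym f e).
have [_|fe] := eqVneq e f; first by case: ltngtP.
by case: e f fe => [] [].
Qed.

Lemma psi_psi_basis e n f m S (p := mode_loc e n) (r := mode_loc f m) :
  psi e n (psi f m (basis S)) =
  if ((r \in S) == ~~ creates m) && ((p \in toggle r S) == ~~ creates n)
  then (koszul R r S * koszul R p (toggle r S)) *: basis (toggle p (toggle r S)) else 0.
Proof.
rewrite [psi f m _]psi_basis -/r; case: ((r \in S) == ~~ creates m) => /=; last exact: psi0.
rewrite [LHS]psiZ.
rewrite [psi e n _]psi_basis -/p.
case: ((p \in toggle r S) == ~~ creates n); [exact: scalerA|exact: scaler0].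
Qed.

Definition pairing (e : bool) (n : int) (f : bool) (m : int) : C :=
  if (e != f) && (n + m == -1) then 1 else 0.

Lemma psi_anticomm e n f m v :
  psi e n (psi f m v) = - psi f m (psi e n v) + pairing e n f m *: v.
Proof.
elim/fock_ind: v => [|c S v IH]; first by rewrite !psi0 scaler0 oppr0 addr0.
apply: (@anticomm_comb _ fock (psi e n) (psi f m)) IH;
  [exact: psiD|exact: psiD|exact: psiZ|exact: psiZ|move=> {c v}].
rewrite (psi_psi_basis e n) (psi_psi_basis f m) !in_toggle.
(* At distinct locations exactly one precedes the other, so the two orders of application differ by
   one sign. At a common location the operators are equal or mutually inverse, and one of the two
   products restores the state. *)
have [ep|np] := eqVneq (mode_loc e n) (mode_loc f m); last first.
  have -> : pairing e n f m = 0.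
    rewrite /pairing; case: ifP => // /andP[ef /eqP nm]; case/eqP: np.
    have {nm} -> : m = -1 - n by rewrite -nm; lia.
    case: n => i.
      have -> : -1 - i%:Z = Negz i by lia.
      by rewrite /=; case: e f ef => [] [].
    have -> : -1 - Negz i = i%:Z by lia.
    by rewrite /=; case: e f ef => [] [].
  have np' : (mode_loc f m == mode_loc e n) = false by rewrite eq_sym (negPf np).
  rewrite [toggle (mode_loc f m) (toggle _ _)]toggleC !koszul_toggle np' (negPf np) /=.
  rewrite [X in _ = - (if X then _ else _) + _]andbC (fmode_le_total np).
  move: (basis _) => b; rewrite scale0r addr0.
  case: (_ && _); last by rewrite oppr0.
  rewrite -scaleNr; congr (_ *: b); move: (koszul _ _ _) (koszul _ _ _) => x y.
  by case: (fmode_le _ _) => /=; ring.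
rewrite ep ?eqxx toggleK koszul_toggle eqxx mul1r koszul_sqr scale1r /pairing.
case: n m ep => i [j|j] /= [ef ij]; rewrite -ij.
- have -> : e = f by case: (e) (f) ef => [] [].
  by rewrite eqxx /= scale0r addr0; case: (_ \in S); rewrite oppr0.
- have -> : e != f by case: (e) (f) ef => [] [].
  have -> : i%:Z + Negz i == -1 by rewrite NegzE; lia.
  by rewrite scale1r; case: (_ \in S) => /=; rewrite ?addNr ?oppr0 ?add0r.
- have -> : e != f by case: (e) (f) ef => [] [].
  have -> : Negz i + i%:Z == -1 by rewrite NegzE; lia.
  by rewrite scale1r; case: (_ \in S) => /=; rewrite ?addNr ?oppr0 ?add0r.
by rewrite ef eqxx /= scale0r addr0; case: (_ \in S); rewrite oppr0.
Qed.

(** Read on the output state, a mode has at most one possible preimage. This lets the first operator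
    of a product act on the bra. *)
Lemma psi_adjoint e n S v : mcoeff S (psi e n v : {malg C[fstate]}) =
  if (mode_loc e n \in S) == creates n
  then koszul R (mode_loc e n) S * mcoeff (toggle (mode_loc e n) S) (v : {malg C[fstate]}) else 0.
Proof.
elim/fock_ind: v => [|c S' v IH]; first by rewrite psi0 !mcoeff0 mulr0; case: ifP.
rewrite psiD psiZ !mcoeffD IH !mcoeffZ psi_basis mcoeff_basis.
set p := mode_loc e n.
have tS : (S' == toggle p S) = (toggle p S' == S).
  by apply/eqP/eqP => [->|<-]; rewrite toggleK.
rewrite tS; case h: ((p \in S) == creates n); case h': ((p \in S') == ~~ creates n).
- rewrite mcoeffZ mcoeff_basis mulrDr; congr (_ + _); have [<-|_] := eqVneq (toggle p S') S.
    by rewrite koszul_toggle eqxx mul1r; ring.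
  by rewrite !mulr0.
- have -> : (toggle p S' == S) = false.
    by apply: contraFF h' => /eqP eS; move: h; rewrite -eS in_toggle eqxx; case: (p \in S'); case: (creates n).
  by rewrite mcoeff0 !mulr0 !add0r.
- have eF : (toggle p S' == S) = false.
    by apply: contraFF h => /eqP <-; rewrite in_toggle eqxx; move: h'; case: (p \in S'); case: (creates n).
  by rewrite mcoeffZ mcoeff_basis eF !mulr0 add0r.
by rewrite mcoeff0 mulr0 add0r.
Qed.

End FockSpace.

(** * Charge, energy and the modes of the generators *)

Section ModeOperators.
Variable R : realType.
Local Notation C := R[i].
Local Notation fock := (fock R).
Local Notation basis := (@Defs.basis R).
Local Notation vac := (@Defs.vac R).
Implicit Types (S : fstate) (p r : fmode) (v x : fock).

Lemma fsum_finite (V : nmodType) (F : nat -> V) N : (forall j, (N <= j)%N -> F j = 0) ->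
  (\sum_(j \in [set: nat]) F j)%classic = \sum_(j < N) F j.
Proof.
move=> h; rewrite (fsbigTE (below N)) ?sum_below // => j; rewrite in_below -leqNgt; exact: h.
Qed.

Lemma fsum_single (V : nmodType) (F : nat -> V) k : (forall j, j != k -> F j = 0) ->
  (\sum_(j \in [set: nat]) F j)%classic = F k.
Proof.
by move=> h; rewrite (fsbigTE [fset k]%fset) ?big_seq_fset1 // => j; rewrite inE; apply: h.
Qed.

Lemma fsum_zero (V : nmodType) (F : nat -> V) : (forall j, F j = 0) ->
  (\sum_(j \in [set: nat]) F j)%classic = 0.
Proof. by move=> h; rewrite (fsum_finite (N := 0)) ?big_ord0. Qed.

Let sterm e i n x (j : nat) : fock :=
  ('C(i + j, j)%:R : C) *: (psi e (- (i%:Z + 1) - j%:Z) (if n + j%:Z == -1 then x else 0)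
    + ((-1) ^+ (i + 0) : C) *: (if n - (i%:Z + 1) - j%:Z == -1 then psi e j%:Z x else 0)).

Let sterm0 e i n x j : n + j%:Z != -1 -> n - (i%:Z + 1) - j%:Z != -1 -> sterm e i n x j = 0.
Proof. by move=> /negPf h1 /negPf h2; rewrite /sterm h1 h2 psi0 scaler0 addr0 scaler0. Qed.

Lemma monomial_mode_single0 e n x : monomial_mode [:: (e, 0%N)] n x = psi e n x.
Proof.
rewrite -[LHS]/((\sum_(j \in [set: nat]) sterm e 0 n x j)%classic).
case: n => k.
  rewrite (fsum_single (k := k)) => [|j jk]; last by apply: sterm0; lia.
  rewrite /sterm; have -> : (k%:Z + k%:Z == -1) = false by lia.
  have -> : k%:Z - (0%:Z + 1) - k%:Z == -1 by lia.
  by rewrite psi0 add0r expr0 scale1r add0n binn scale1r.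
rewrite (fsum_single (k := k)) => [|j jk]; last by apply: sterm0; lia.
rewrite /sterm; have -> : Negz k + k%:Z == -1 by lia.
have -> : (Negz k - (0%:Z + 1) - k%:Z == -1) = false by lia.
by rewrite scaler0 addr0 add0n binn scale1r; congr (psi e _ x); lia.
Qed.

(** The field of psi(-2)1 is the derivative of psi(z), whence the coefficient -n and the shifted
    mode; in the iterate formula only one j contributes. *)
Lemma monomial_mode_single1 e n x : monomial_mode [:: (e, 1%N)] n x = (- n%:~R : C) *: psi e (n - 1) x.
Proof.
rewrite -[LHS]/((\sum_(j \in [set: nat]) sterm e 1 n x j)%classic).
case: n => [[|k]|k].
- rewrite fsum_zero => [|j]; last by apply: sterm0; lia.
  by rewrite mulr0z oppr0 scale0r.
- rewrite (fsum_single (k := k)) => [|j jk]; last by apply: sterm0; lia.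
  rewrite /sterm; have -> : (k.+1%:Z + k%:Z == -1) = false by lia.
  have -> : k.+1%:Z - (1%:Z + 1) - k%:Z == -1 by lia.
  have -> : k.+1%:Z - 1 = k%:Z by lia.
  rewrite psi0 add0r expr1 scaleN1r scalerN -scaleNr add1n binSn //.
rewrite (fsum_single (k := k)) => [|j jk]; last by apply: sterm0; lia.
rewrite /sterm; have -> : Negz k + k%:Z == -1 by lia.
have -> : (Negz k - (1%:Z + 1) - k%:Z == -1) = false by lia.
rewrite scaler0 addr0 add1n binSn; congr (_ *: psi e _ x); last by lia.
by rewrite NegzE mulrNz opprK.
Qed.

Definition addf (f : fmode -> R) S : R := \sum_(p <- S) f p.

(** Rewrites a sum over occupied modes through occupation numbers, the form in which mode expansions
    of quadratic fields produce it. *)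
Lemma addf_modes (f : fmode -> R) S : exists N, forall n, (N <= n)%N ->
  \sum_(j < n) ((((true, nat_of_ord j) \in S)%:R * f (true, nat_of_ord j)) +
     (((false, nat_of_ord j) \in S)%:R * f (false, nat_of_ord j))) = addf f S /\
  forall e j, (n <= j)%N -> ((e, j) : fmode) \notin S.
Proof.
have [N hN] := below_cofinal [fset p.2 | p in S]%fset.
exists N => n /hN sS.
have hS p : p \in S -> (p.2 < n)%N.
  by move=> pS; rewrite -in_below; apply: (fsubsetP sS); apply: in_imfset.
split; last by move=> e j nj; apply/negP => /hS /=; rewrite ltnNge nj.
rewrite -(sum_below n (fun j => (((true, j) \in S)%:R * f (true, j)) + (((false, j) \in S)%:R * f (false, j)))).
rewrite big_split /=.
pose G (p : bool * nat) : R := ((p : fmode) \in S)%:R * f p.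
have -> : addf f S = \sum_(p <- S) G p.
  by rewrite /addf big_seq [RHS]big_seq; apply: eq_bigr => p; rewrite /G => ->; rewrite mul1r.
rewrite (big_fset_incl _ (B := ([fset true; false] `*` below n)%fset)).
- by rewrite sum_fsetM big_fsetU1 ?inE // big_seq_fset1.
- by apply/fsubsetP => -[e j] /hS /= jn; rewrite in_fsetM /= in_below jn andbT; case: e; rewrite !inE.
by move=> p _ /negPf pS; rewrite /G pS mul0r.
Qed.

Definition occ S e j : C := (((e, j) : fmode) \in S)%:R.

Lemma psi_occ S (c : C) e j : psi e (Negz j) (psi (~~ e) (Posz j) (c *: basis S)) = occ S e j *: (c *: basis S).
Proof.
rewrite [psi (~~ e) _ _]psiZ [LHS]psiZ psi_psi_basis /= negbK in_toggle eqxx /occ.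
case: ((e, j) \in S) => /=; last by rewrite scaler0 scale0r.
by rewrite toggleK koszul_toggle eqxx mul1r koszul_sqr scale1r scale1r.
Qed.

Lemma monomial_pair p r : p != r -> fmode_le p r -> monomial [fset p; r]%fset = [:: p; r].
Proof.
move=> pr le; apply: (@sorted_eq _ fmode_le).
- move=> [e i] [f j] [g k]; rewrite /fmode_le /=; case: e f g => [] [] [] //=; lia.
- move=> [e i] [f j]; rewrite /fmode_le /= (eq_sym f e); have [->|] := eqVneq e f.
    by rewrite -eqn_leq => /eqP ->.
  by case: e f => [] [].
- apply: sort_sorted => -[e i] [f j]; rewrite /fmode_le /= (eq_sym f e).
  by have [_|] := eqVneq e f; [exact: leq_total|case: e f => [] []].
- by rewrite /= le.
rewrite perm_sort; apply: uniq_perm; rewrite ?fset_uniq //= ?inE ?pr //.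
by move=> x; rewrite !inE.
Qed.

Lemma psi_vac e i : psi e (Negz i) vac = basis [fset (e, i)]%fset.
Proof.
rewrite psi_basis /= /toggle inE /=.
by rewrite koszulE big_seq_fset0 scale1r fsetU0.
Qed.

Let creation_pair p r : p != r ->
  psi p.1 (Negz p.2) (psi r.1 (Negz r.2) vac) =
  (if fmode_le r p then -1 else 1 : C) *: basis [fset p; r]%fset.
Proof.
case: p r => [e i] [f j] pr /=; rewrite psi_vac psi_basis /= inE (negPf pr) /=.
rewrite /toggle inE (negPf pr) koszulE big_seq_fset1 eq_sym pr /=.
by congr (_ *: Defs.basis _ _).
Qed.

Lemma heisE : heis R = basis [fset (true, 0%N); (false, 0%N)]%fset.
Proof.
by rewrite /heis (@creation_pair (true, 0%N) (false, 0%N)) // /fmode_le /= scale1r.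
Qed.

Lemma conformalE : conformal R = (1 / 2 : C) *: (basis [fset (true, 1%N); (false, 0%N)]%fset
   + (-1 : C) *: basis [fset (true, 0%N); (false, 1%N)]%fset).
Proof.
have e1 : psi true (- 2) (psi false (- 1) vac) = (1 : C) *: basis [fset (true, 1%N); (false, 0%N)]%fset.
  exact: (@creation_pair (true, 1%N) (false, 0%N) isT).
have e2 : psi false (- 2) (psi true (- 1) vac) = (-1 : C) *: basis [fset (true, 0%N); (false, 1%N)]%fset.
  have := @creation_pair (false, 1%N) (true, 0%N) isT.
  by rewrite (fsetUC [fset (false, 1%N)]%fset).
rewrite /conformal e1 e2 [1 *: _]scale1r.
reflexivity.
Qed.

Let chg (p : fmode) : R := if p.1 then 1 else -1.
Let eng (p : fmode) : R := p.2%:R + 1 / 2.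
Definition fcharge S : R := addf chg S.
Definition energy S : R := addf eng S.

Lemma a0_basis S (c : C) : a0 (c *: basis S) = (fcharge S)%:C *: (c *: basis S).
Proof.
set x := c *: basis S.
rewrite /a0 heisE /vmode linear_ext_basis monomial_pair //.
pose F (j : nat) : fock := ('C(0 + j, j)%:R : C) *:
   (psi true (- (0%:Z + 1) - j%:Z) (monomial_mode [:: (false, 0%N)] (0 + j%:Z) x)
    + ((-1) ^+ (0 + 1) : C) *: monomial_mode [:: (false, 0%N)] (0 - (0%:Z + 1) - j%:Z) (psi true j%:Z x)).
rewrite -[LHS]/((\sum_(j \in [set: nat]) F j)%classic).
have FE j : F j = (occ S true j - occ S false j) *: x.
  rewrite /F !monomial_mode_single0 add0n binn scale1r.
  have -> : - (0%:Z + 1) - j%:Z = Negz j by lia.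
  rewrite add0r (psi_occ S c true) (psi_occ S c false) -/x expr1 scaleN1r.
  by rewrite [RHS]scalerBl.
have [N hN] := addf_modes chg S; have [hs h0] := hN N (leqnn _).
rewrite (fsum_finite (N := N)) => [|j Nj]; last first.
  by rewrite FE /occ (negPf (h0 _ _ Nj)) (negPf (h0 _ _ Nj)) subrr scale0r.
under eq_bigr do rewrite FE.
rewrite -scaler_suml; congr (_ *: x).
rewrite /fcharge -hs rmorph_sum; apply: eq_bigr => j _.
by rewrite /occ /chg /= mulr1 mulrN1 rmorphB /= !rmorph_nat.
Qed.

Lemma L0_basis S (c : C) : L0 (c *: basis S) = (energy S)%:C *: (c *: basis S).
Proof.
set x := c *: basis S.
have m1 := @monomial_pair (true, 1%N) (false, 0%N) isT isT.
have m2 := @monomial_pair (true, 0%N) (false, 1%N) isT isT.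
rewrite /L0 conformalE /vmode linear_extZ linear_extD linear_extZ !linear_ext_basis m1 m2.
pose F (j : nat) : fock := ('C(1 + j, j)%:R : C) *:
   (psi true (- (1%:Z + 1) - j%:Z) (monomial_mode [:: (false, 0%N)] (1 + j%:Z) x)
    + ((-1) ^+ (1 + 1) : C) *: monomial_mode [:: (false, 0%N)] (1 - (1%:Z + 1) - j%:Z) (psi true j%:Z x)).
pose G (j : nat) : fock := ('C(0 + j, j)%:R : C) *:
   (psi true (- (0%:Z + 1) - j%:Z) (monomial_mode [:: (false, 1%N)] (1 + j%:Z) x)
    + ((-1) ^+ (0 + 1) : C) *: monomial_mode [:: (false, 1%N)] (1 - (0%:Z + 1) - j%:Z) (psi true j%:Z x)).
rewrite -[LHS]/((1 / 2 : C) *: ((\sum_(j \in [set: nat]) F j)%classic + (-1 : C) *: (\sum_(j \in [set: nat]) G j)%classic)).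
have FE j : F j = (j.+1%:R * (occ S true j.+1 + occ S false j)) *: x.
  rewrite /F !monomial_mode_single0 add1n binSn.
  have -> : - (1%:Z + 1) - j%:Z = Negz j.+1 by lia.
  have -> : 1 - (1%:Z + 1) - j%:Z = Negz j by lia.
  have -> : 1 + j%:Z = j.+1%:Z by lia.
  rewrite (psi_occ S c true) (psi_occ S c false) -/x addn1 sqrrN expr1n scale1r.
  by rewrite -scalerDl scalerA.
have GE j : G j = (- (j.+1%:R * occ S true j + j%:R * occ S false j)) *: x.
  rewrite /G !monomial_mode_single1 add0n binn scale1r.
  have -> : - (0%:Z + 1) - j%:Z = Negz j by lia.
  have -> : 1 - (0%:Z + 1) - j%:Z = - j%:Z by lia.
  have -> : - j%:Z - 1 = Negz j by lia.
  have -> : 1 + j%:Z - 1 = j%:Z by lia.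
  have -> : 1 + j%:Z = j.+1%:Z by lia.
  rewrite [psi true _ (_ *: _)]psiZ (psi_occ S c true) (psi_occ S c false) -/x expr1 scaleN1r.
  rewrite [_ *: (_ *: x)]scalerA [X in _ - X]scalerA -scalerBl; congr (_ *: x).
  by rewrite rmorphN /= opprK; ring.
clearbody F G; move: x FE GE => x FE GE.
have [N hN] := addf_modes eng S; have [hs h0] := hN N (leqnn _).
have occ0 e j : (N <= j)%N -> occ S e j = 0 by move=> Nj; rewrite /occ (negPf (h0 _ _ Nj)).
have sF : (\sum_(j \in [set: nat]) F j)%classic = (\sum_(j < N) j.+1%:R * (occ S true j.+1 + occ S false j)) *: x.
  rewrite (fsum_finite (F := F) (N := N)) => [|j Nj]; last first.
    have e : j.+1%:R * (occ S true j.+1 + occ S false j) = 0.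
      by rewrite (occ0 true j.+1) ?leqW // (occ0 false j) // addr0 mulr0.
    by rewrite FE e; exact: scale0r.
  by rewrite scaler_suml; apply: eq_bigr => j _; exact: FE.
have sG : (\sum_(j \in [set: nat]) G j)%classic = (\sum_(j < N) - (j.+1%:R * occ S true j + j%:R * occ S false j)) *: x.
  rewrite (fsum_finite (F := G) (N := N)) => [|j Nj]; last first.
    have e : - (j.+1%:R * occ S true j + j%:R * occ S false j) = 0.
      by rewrite (occ0 true j) // (occ0 false j) // !mulr0 addr0 oppr0.
    by rewrite GE e; exact: scale0r.
  by rewrite scaler_suml; apply: eq_bigr => j _; exact: GE.
rewrite sF sG [(-1) *: _]scalerA -scalerDl [LHS]scalerA; congr (_ *: x).
rewrite /energy -hs rmorph_sum /=.
(* After this shift of index each mode (e, j) receives j from one half of the conformal vector and j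
   + 1 from the other; the factor 1/2 makes it j + 1/2. *)
have -> : \sum_(j < N) j.+1%:R * (occ S true j.+1 + occ S false j) =
   \sum_(j < N) j%:R * occ S true j + \sum_(j < N) j.+1%:R * occ S false j.
  under eq_bigr do rewrite mulrDr; rewrite big_split /=; congr (_ + _).
  have h : \sum_(j < N.+1) j%:R * occ S true j = \sum_(j < N) j.+1%:R * occ S true j.+1.
    by rewrite big_ord_recl mul0r add0r.
  by rewrite -h big_ord_recr /= occ0 // mulr0 addr0.
rewrite mulN1r -sumrN -!big_split mulr_sumr; apply: eq_bigr => j _ /=.
rewrite rmorphD !rmorphM /= !rmorph_nat -/(occ S true j) -/(occ S false j) /eng /=.
have -> : (j%:R + 1 / 2 : R)%:C = j%:R + 1 / 2 :> C by rewrite rmorphD rmorphM /= fmorphV !rmorph_nat.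
by rewrite -[j.+1]addn1 natrD /occ; field.
Qed.

(** [opexp] picks a vector by its coordinates, so convergence of the exponential series and
    uniqueness of limits both enter. *)
Lemma opexp_eigen (t lambda : C) (A : fock -> fock) v :
  (forall k, iter k A v = lambda ^+ k *: v) -> opexp t A v = cexp (t * lambda) *: v.
Proof.
move=> h; have cv S : ((fun N : nat => mcoeff S (\sum_(k < N) (t ^+ k / (k`!)%:R) *: iter k A v : {malg C[fstate]}) : C^o)
      @ \oo --> (mcoeff S (cexp (t * lambda) *: v : {malg C[fstate]}) : C^o))%classic.
  have -> : (fun N : nat => mcoeff S (\sum_(k < N) (t ^+ k / (k`!)%:R) *: iter k A v : {malg C[fstate]}) : C^o) =
     fun N : nat => (\sum_(k < N) (t * lambda) ^+ k / (k`!)%:R) * mcoeff S (v : {malg C[fstate]}).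
    apply/funext => N; rewrite raddf_sum mulr_suml; apply: eq_bigr => k _.
    rewrite h scalerA [LHS]mcoeffZ exprMn.
    by congr (_ * _); rewrite mulrAC.
  rewrite mcoeffZ; apply: cvgsM; last exact: cvg_cst.
  exact: cvgs_cexp_series.
apply: xget_unique => [S|w hw]; first exact: cv.
apply/malgP => S; exact: cvgs_unique (hw S) (cv S).
Qed.

Lemma iter_eigen (A : fock -> fock) (lambda : C) v : (forall c : C, A (c *: v) = lambda *: (c *: v)) ->
  forall k (c : C), iter k A (c *: v) = lambda ^+ k *: (c *: v).
Proof.
move=> h; elim=> [|k IH] c /=; first by rewrite expr0 scale1r.
by rewrite IH [X in A X]scalerA h -scalerA [LHS]scalerA exprS.
Qed.

Definition psiv (e : bool) : fock := basis [fset (e, 0%N)]%fset.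

Lemma psipE : psip R = psiv true. Proof. exact: psi_vac. Qed.
Lemma psimE : psim R = psiv false. Proof. exact: psi_vac. Qed.

Lemma vmode_psiv e (c : C) n x : vmode (c *: psiv e) n x = c *: psi e n x.
Proof.
rewrite /vmode linear_extZ /psiv linear_ext_basis.
suff -> : monomial [fset (e, 0%N)]%fset = [:: (e, 0%N)] by rewrite monomial_mode_single0.
by apply: perm_small_eq => //; rewrite perm_sort; apply: uniq_perm; rewrite ?fset_uniq // => y; rewrite !inE.
Qed.

Lemma fcharge_psiv e : fcharge [fset (e, 0%N)]%fset = if e then 1 else -1.
Proof. by rewrite /fcharge /addf big_seq_fset1. Qed.
Lemma energy_psiv e : energy [fset (e, 0%N)]%fset = 1 / 2.
Proof. by rewrite /energy /addf big_seq_fset1 /eng add0r. Qed.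

Lemma Lh0_basis kappa S (c : C) :
  Lh0 kappa (c *: basis S) = (energy S - kappa * fcharge S)%:C *: (c *: basis S).
Proof.
rewrite /Lh0 L0_basis a0_basis; move: (c *: basis S) => x.
by rewrite [X in _ - X]scalerA -scalerBl rmorphB rmorphM.
Qed.

End ModeOperators.

(** * Traces and contraction *)
Section Contraction.
Variables (K : comNzRingType) (V : lmodType K) (I : Type).
Variables (P : I -> V -> V) (d : I -> I -> K).
Hypothesis PD : forall i, {morph P i : x y / x + y}.
Hypothesis PZ : forall i k x, P i (k *: x) = k *: P i x.
Hypothesis PP : forall i j x, P i (P j x) = - P j (P i x) + d i j *: x.

Definition ops (s : seq I) (x : V) : V := foldr P x s.

Lemma opsZ s k x : ops s (k *: x) = k *: ops s x.
Proof. by elim: s => //= i s ->; rewrite PZ. Qed.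

Let P_sum i n (F : 'I_n -> V) : P i (\sum_(j < n) F j) = \sum_(j < n) P i (F j).
Proof.
have P0 : P i 0 = 0 by have := PZ i 0 0; rewrite !scale0r.
exact: (big_morph _ (PD i) P0).
Qed.

Lemma ops_contract i s x0 x : P i (ops s x) =
  (-1) ^+ size s *: ops s (P i x) +
  \sum_(j < size s) ((-1) ^+ j * d i (nth x0 s j)) *: ops (remove j s) x.
Proof.
elim: s => [|k s IH]; first by rewrite /= big_ord0 addr0 expr0 scale1r.
rewrite [ops (k :: s) x]/= PP IH PD PZ P_sum big_ord_recl /= expr0 mul1r.
rewrite /remove /= drop0 opprD -scaleNr -mulN1r -exprS -addrA; congr (_ + _).
rewrite addrC; congr (_ + _); rewrite -sumrN; apply: eq_bigr => j _.
by rewrite PZ -scaleNr /= exprS mulN1r mulNr.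
Qed.

End Contraction.

Section Trace.
Variable R : realType.
Local Notation C := R[i].
Local Notation fock := (fock R).
Local Notation basis := (@Defs.basis R).
Variable tau : C.
Hypothesis tau_gt0 : 0 < complex.Im tau.
Local Notation L := (nome_rate tau).
Local Notation ipi := (ipi R).
Variables (alpha kappa : R).
Implicit Types (S : fstate) (v x : fock) (ps : seq (bool * int)).

Definition opm ps v : fock := foldr (fun p => psi p.1 p.2) v ps.

Lemma opm_basis ps S : exists c S', nm c <= 1 /\ opm ps (basis S) = c *: basis S'.
Proof.
elim: ps => [|[e n] ps [c [S' [c1 IH]]]] /=.
  by exists 1, S; rewrite nm1 lexx; split=> //; exact/esym/scale1r.
case h : ((mode_loc e n \in S') == ~~ creates n).
  exists (c * koszul R (mode_loc e n) S'), (toggle (mode_loc e n) S'); split.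
    rewrite nmM (_ : nm (koszul _ _ _) = 1) ?mulr1 //.
    by apply/eqP; rewrite -(@eqrXn2 _ 2) ?nm_ge0 // expr1n expr2 -nmM koszul_sqr nm1.
  by rewrite IH psiZ psi_basis h; exact: scalerA.
exists 0, S'; split; first by rewrite nm0 ler01.
by rewrite IH psiZ psi_basis h scaler0; exact/esym/scale0r.
Qed.

Lemma nm_opm ps S S' : nm (mcoeff S (opm ps (basis S') : {malg C[fstate]})) <= 1.
Proof.
have [c [T [c1 ->]]] := opm_basis ps S'; rewrite mcoeffZ mcoeff_basis nmM.
by case: (T == S); rewrite ?nm1 ?mulr1 // nm0 mulr0 ler01.
Qed.

Definition grade (p : fmode) : C := p.2%:R + 1 / 2 - kappa%:C * sgc R p.1.
(** The contribution of one occupied mode to the diagonal of f q^(L_h(0)); the minus sign is the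
    parity of the supertrace. *)
Definition xi (p : fmode) : C :=
  - cexp (2 * ipi * alpha%:C * sgc R p.1 + 2 * ipi * tau * grade p).
Definition weight S : C := \prod_(p <- S) xi p.
(** The factor by which applying psi^e(n) changes the weight of a state. [kap_arg] is chosen so that
    minus its inverse is e^([kap_arg]) q^n. *)
Definition multiplier (e : bool) (n : int) : C :=
  - cexp (2 * ipi * alpha%:C * sgc R e - 2 * ipi * tau * (n%:~R + 1 / 2 + kappa%:C * sgc R e)).
Definition kap_arg (e : bool) : C :=
  - 2 * ipi * alpha%:C * sgc R e + 2 * ipi * tau * (1 / 2 + kappa%:C * sgc R e).

Lemma sgc_real e : sgc R e = (if e then 1 else -1 : R)%:C.
Proof. by case: e; rewrite /sgc ?rmorphN rmorph1. Qed.

Lemma nm_xi p : nm (xi p) = expR (- L * (p.2%:R + 1 / 2 - kappa * (if p.1 then 1 else -1))).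
Proof.
rewrite /xi nmN nm_cexp; congr expR.
have -> : 2 * ipi * alpha%:C * sgc R p.1 = (alpha * (if p.1 then 1 else -1))%:C * (ipi + ipi).
  by rewrite rmorphM /= -sgc_real; ring.
have ReD (x y : C) : complex.Re (x + y) = complex.Re x + complex.Re y by case: x; case: y.
have -> : grade p = (p.2%:R + 1 / 2 - kappa * (if p.1 then 1 else -1))%:C.
  rewrite /grade sgc_real rmorphB rmorphM rmorphD /= rmorph_nat; congr (_ + _ - _).
  by rewrite rmorphM /= fmorphV rmorph_nat rmorph1.
move: (p.2%:R + _ - _) => x; rewrite ReD Re_realM (_ : complex.Re (ipi + ipi) = 0) ?mulr0 ?add0r; last by rewrite /= addr0.
have -> : 2 * ipi * tau * x%:C = x%:C * (2 * ipi * tau * 1%:~R) by ring.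
by rewrite Re_realM Re_2ipitau mulr1 mulrC.
Qed.

Lemma summ_expR_grade (rho : R) : 0 < rho ->
  summ (fun p : fmode => (expR (- rho * (p.2%:R + 1 / 2 - kappa * (if p.1 then 1 else -1))))%:C : C).
Proof.
move=> r0; pose b (e : bool) : R := expR (- rho * (1 / 2 - kappa * (if e then 1 else -1))).
apply: (@summ_pair _ _ _ _ (fun e => b e * (1 - expR (- rho))^-1) (\sum_(e <- [fset true; false]%fset) b e * (1 - expR (- rho))^-1)) => [e B|A].
  under eq_bigr => i _.
    rewrite nm_real ger0_norm ?expR_ge0 //=.
    have -> : - rho * (i%:R + 1 / 2 - kappa * (if e then 1 else -1)) =
      - rho * (1 / 2 - kappa * (if e then 1 else -1)) + i%:R * (- rho) by ring.
    rewrite expRD expRM_natl -/(b e); over.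
  rewrite -mulr_sumr ler_wpM2l ?expR_ge0 //; apply: geometric_sum_le.
  by rewrite expR_ge0 expR_lt1 oppr_lt0.
apply: sum_fset_le => [e|]; last by apply/fsubsetP => e _; rewrite !inE; case: e.
by rewrite mulr_ge0 ?expR_ge0 // invr_ge0 subr_ge0 expR_le1 oppr_le0 ltW.
Qed.

Lemma summ_xi : summ xi.
Proof.
apply: (summ_le (k := 1) (summ_expR_grade (nome_rate_gt0 tau_gt0))) => p.
by rewrite nm_xi nm_real (ger0_norm (expR_ge0 _)) !mul1r lexx.
Qed.

Lemma summ_weight : summ weight.
Proof. exact: summ_subset_prod summ_xi. Qed.

Lemma xi_multiplier e n : xi (mode_loc e n) = if creates n then multiplier e n else (multiplier e n)^-1.
Proof.
rewrite /xi /multiplier /grade; case: n => i /=; last first.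
  by congr (- cexp _); rewrite NegzE mulrNz -pmulrn -[i.+1]addn1 natrD; move: (i%:R) (sgc R e) => x y; field.
by rewrite invrN -cexpN; congr (- cexp _); rewrite sgcN -pmulrn; move: (i%:R) (sgc R e) => x y; field.
Qed.

Lemma multiplier_neq0 e n : multiplier e n != 0.
Proof. by rewrite oppr_eq0 cexp_neq0. Qed.

Lemma weight_toggle e n S : (mode_loc e n \in S) == ~~ creates n ->
  weight (toggle (mode_loc e n) S) = multiplier e n * weight S.
Proof.
have m0 := multiplier_neq0 e n; rewrite /weight /toggle => /eqP.
have := xi_multiplier e n; case: (creates n) => /= ex pS.
  by rewrite pS big_fsetU1 ?pS // ex.
by rewrite pS [in RHS](big_fsetD1 _ pS) /= ex mulrA mulfV // mul1r.
Qed.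

Definition tracet ps S : C := weight S * mcoeff S (opm ps (basis S) : {malg C[fstate]}).
Definition trace ps : C := csum (tracet ps).

Lemma summ_tracet ps : summ (tracet ps).
Proof.
apply: (summ_le (k := 1) summ_weight) => S; rewrite mul1r /tracet nmM.
by rewrite ler_piMr ?nm_ge0 // nm_opm.
Qed.

Definition pairp (p r : bool * int) : C := pairing R p.1 p.2 r.1 r.2.

Lemma opm_contract e n ps v : psi e n (opm ps v) =
  (-1) ^+ size ps *: opm ps (psi e n v) +
  \sum_(j < size ps) ((-1) ^+ j * pairp (e, n) (nth (e, n) ps j)) *: opm (remove j ps) v.
Proof.
apply: (@ops_contract _ fock _ (fun p => psi p.1 p.2) pairp _ _ _ (e, n) ps (e, n) v).
- by move=> p x y; exact: psiD.
- by move=> p k x; exact: psiZ.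
by move=> p r x; exact: psi_anticomm.
Qed.

Lemma opmZ ps (c : C) v : opm ps (c *: v) = c *: opm ps v.
Proof. by apply: (@opsZ _ fock) => p k x; exact: psiZ. Qed.

Lemma mcoeff_sumZ (I : Type) (r : seq I) (c : I -> C) (v : I -> fock) S :
  mcoeff S (\sum_(j <- r) c j *: v j : {malg C[fstate]}) =
  \sum_(j <- r) c j * mcoeff S (v j : {malg C[fstate]}).
Proof.
elim: r => [|i r IH]; first by rewrite !big_nil; exact: mcoeff0.
by rewrite !big_cons mcoeffD mcoeffZ IH.
Qed.

(* The first operator is moved around the trace: its mode toggles one location,
   a bijection of the states that multiplies the weight by [multiplier]. *)
Lemma trace_recursion e n ps : odd (size ps) -> gen tau (kap_arg e) ->
  trace ((e, n) :: ps) = kap tau (kap_arg e) n *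
    \sum_(j < size ps) (-1) ^+ j * pairp (e, n) (nth (e, n) ps j) * trace (remove j ps).
Proof.
move=> od ge; set p := mode_loc e n.
(* The diagonal entries after psi^e(n) has been moved to the right end of the product. *)
pose h S : C := weight S * mcoeff S (opm ps (psi e n (basis S)) : {malg C[fstate]}).
have hE S : h S = (multiplier e n)^-1 * tracet ((e, n) :: ps) (toggle p S).
  rewrite /h /tracet /= [mcoeff (toggle _ _) _]psi_adjoint -/p in_toggle eqxx toggleK psi_basis -/p.
  case hp: ((p \in S) == ~~ creates n); last first.
    have -> : ((p \notin S) == creates n) = false by move: hp; case: (p \in S); case: (creates n).
    by have := opmZ ps 0 0; rewrite !scale0r => ->; rewrite mcoeff0 !mulr0.
  have -> : ((p \notin S) == creates n) by move: hp; case: (p \in S); case: (creates n).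
  rewrite opmZ [X in weight S * X]mcoeffZ weight_toggle // koszul_toggle eqxx mul1r.
  by rewrite -[multiplier e n * _ * _]mulrA mulKf ?multiplier_neq0.
have hh : has_sum h ((multiplier e n)^-1 * trace ((e, n) :: ps)).
  have ti : injective (toggle p) := inv_inj (@toggleK p).
  have H : has_sum (fun S => tracet ((e, n) :: ps) (toggle p S)) (trace ((e, n) :: ps)).
    apply/(has_sum_inj _ ti) => [S _|]; first by exists (toggle p S); rewrite toggleK.
    exact: has_csum (summ_tracet _).
  by apply: eq_has_sum (has_sumZ (multiplier e n)^-1 H) => S; rewrite hE.
(* Passing an odd number of operators gives the sign -1, so the trace T satisfies T = -
   T/[multiplier] + contractions, to be solved for T. *)
have ht : has_sum (tracet ((e, n) :: ps)) (- ((multiplier e n)^-1 * trace ((e, n) :: ps)) +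
    \sum_(j < size ps) (-1) ^+ j * pairp (e, n) (nth (e, n) ps j) * trace (remove j ps)).
  have H j : has_sum (fun S => (-1) ^+ j * pairp (e, n) (nth (e, n) ps j) * tracet (remove j ps) S)
      ((-1) ^+ j * pairp (e, n) (nth (e, n) ps j) * trace (remove j ps)).
    by apply: has_sumZ; apply: has_csum (summ_tracet _).
  have HS := @has_sum_sum R _ _ (index_enum 'I_(size ps)) xpredT (fun (j : 'I_(size ps)) S => (-1) ^+ j * pairp (e, n) (nth (e, n) ps j) * tracet (remove j ps) S) _ (fun j _ => H j).
  have := has_sumD (has_sumZ (-1) hh) HS; rewrite mulN1r.
  apply: eq_has_sum => S; rewrite /tracet /= opm_contract mcoeffD mcoeffZ -signr_odd od expr1.
  rewrite mulrDr /h; congr (_ + _); first by ring.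
  rewrite mcoeff_sumZ mulr_sumr; apply: eq_bigr => j _; ring.
have := has_sum_unique (has_csum (summ_tracet ((e, n) :: ps))) ht.
rewrite -/(trace _); set X := \sum_(j < _) _; move: (trace _) => T eT.
have -> : kap tau (kap_arg e) n = (1 + (multiplier e n)^-1)^-1.
  rewrite /kap /multiplier invrN -cexpN; congr (_ - cexp _)^-1.
  by rewrite /kap_arg; field.
have m1 : 1 + (multiplier e n)^-1 != 0.
  have := ge n; rewrite eq_sym -subr_eq0 /multiplier invrN -cexpN.
  by congr (_ - cexp _ != 0); rewrite /kap_arg; field.
apply: (mulfI m1); rewrite mulrA mulfV // mul1r mulrDl mul1r {1}eT.
by rewrite addrAC addNr add0r.
Qed.

End Trace.

(** * Summability of the supertrace *)
Section Correlator.
Variable R : realType.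
Local Notation C := R[i].
Local Notation fock := (fock R).
Local Notation basis := (@Defs.basis R).
Variable tau : C.
Hypothesis tau_gt0 : 0 < complex.Im tau.
Local Notation L := (nome_rate tau).
Local Notation ipi := (ipi R).
Variables (alpha kappa : R).
Implicit Types (S : fstate) (v : fock) (w : seq (bool * C)) (ms : seq int).
Local Notation xi := (xi tau alpha kappa).
Local Notation weight := (weight tau alpha kappa).

(** The exponent multiplying z is the change of L_h(0)-degree caused by the mode; it unites the
    power of e^z in the vertex operator with the rescaling of the inserted vector. *)
Definition wt (x : bool * C) (m : int) : C := cexp (x.2 * (- m%:~R - 1 / 2 - kappa%:C * sgc R x.1)).
Definition modes w ms : seq (bool * int) := zip (map fst w) ms.
Definition wts w ms : C := \prod_(p <- zip w ms) wt p.1 p.2.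
(** A value 0 on sequences of the wrong length replaces tuples by plain sequences, so that induction
    on the word does not change the index type. *)
Definition entry w S0 S ms : C :=
  if size ms == size w then wts w ms * mcoeff S0 (opm (modes w ms) (basis S) : {malg C[fstate]}) else 0.
Definition shifted S : R := energy R S - kappa * fcharge R S.
Definition shift1 (p : fmode) : R := p.2%:R + 1 / 2 - kappa * (if p.1 then 1 else -1).

Lemma shiftedE S : shifted S = \sum_(p <- S) shift1 p.
Proof. by rewrite /shifted mulr_sumr -sumrB. Qed.

Lemma opexp_basis (t lambda : C) (A : fock -> fock) S (c : C) :
  (forall c : C, A (c *: basis S) = lambda *: (c *: basis S)) ->
  opexp t A (c *: basis S) = cexp (t * lambda) *: (c *: basis S).
Proof. by move=> h; apply: opexp_eigen => k; apply: iter_eigen. Qed.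

Lemma opexp_Lh0_psiv e z : opexp z (Lh0 kappa) (psiv R e) = cexp (z * (1 / 2 - kappa%:C * sgc R e)) *: psiv R e.
Proof.
have := @opexp_basis z (1 / 2 - kappa%:C * sgc R e) (Lh0 kappa) [fset (e, 0%N)]%fset 1.
have -> : (1 : C) *: basis [fset (e, 0%N)]%fset = psiv R e by exact: scale1r.
apply=> c; rewrite Lh0_basis fcharge_psiv energy_psiv sgc_real rmorphB rmorphM /=.
by congr (_ *: _); rewrite rmorphM /= fmorphV rmorph_nat rmorph1.
Qed.

Lemma foldr_insertions w ms v :
  foldr (fun (vzm : fock * C * int) u => let: (v, z, m) := vzm in
      (cexp z ^ (- m - 1)) *: vmode (opexp z (Lh0 kappa) v) m u)
    v (zip [seq (psiv R x.1, x.2) | x <- w] ms) =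
  wts w ms *: opm (modes w ms) v.
Proof.
elim: w ms => [|[e z] w IH] [|m ms] /=; rewrite ?/wts ?big_nil; try exact/esym/scale1r.
rewrite IH opexp_Lh0_psiv vmode_psiv big_cons -/(wts w ms) psiZ /=.
set c1 := cexp z ^ _; set c2 := cexp _.
have -> : wt (e, z) m = c1 * c2.
  by rewrite /wt /c1 /c2 -cexpMz -cexpD; congr cexp; rewrite rmorphB rmorphN rmorph1 /=; move: (m%:~R) (sgc R e) (kappa%:C) => a b c; field.
move: c1 c2 (wts _ _) (psi e m _) => a b c y.
by rewrite [LHS]scalerA [LHS]scalerA.
Qed.

Lemma weightE S : weight S =
  (-1) ^+ #|` S| * cexp (twopii R * alpha%:C * (fcharge R S)%:C) * cexp (twopii R * tau * (shifted S)%:C).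
Proof.
rewrite shiftedE /fcharge /addf !rmorph_sum !mulr_sumr !cexp_sum.
have -> : (-1) ^+ #|` S| = \prod_(p <- S) (-1 : C).
  by rewrite big_const_seq count_predT iter_mulr_1.
rewrite -!big_split; apply: eq_bigr => p _ /=; rewrite mulN1r mulNr -cexpD /xi; congr (- cexp _).
rewrite /grade sgc_real /shift1 twopiiE rmorphB rmorphD /=.
have -> : (1 / 2 : R)%:C = 1 / 2 :> C by rewrite rmorphM /= fmorphV rmorph_nat rmorph1.
rewrite rmorphM /= rmorph_nat.
by move: (if p.1 then _ else _) => s; ring.
Qed.

Lemma STr_termE w S (t : (size [seq (psiv R x.1, x.2) | x <- w]).-tuple int) :
  STr_term (opexp (twopii R * alpha%:C) (@a0 R)) kappa tau (S, t) =
  cexp (- (twopii R * tau * ((ch kappa)%:C / 24%:R))) * (weight S * entry w S S t).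
Proof.
rewrite /STr_term /=.
have -> : opexp (twopii R * tau) (fun v => Lh0 kappa v - ((ch kappa)%:C / 24%:R) *: v) (basis S) =
    cexp (twopii R * tau * ((shifted S)%:C - (ch kappa)%:C / 24%:R)) *: basis S.
  have := @opexp_basis (twopii R * tau) ((shifted S)%:C - (ch kappa)%:C / 24%:R)
     (fun v => Lh0 kappa v - ((ch kappa)%:C / 24%:R) *: v) S 1.
  have -> : (1 : C) *: basis S = basis S by exact: scale1r.
  by apply=> c; rewrite Lh0_basis; exact/esym/scalerBl.
rewrite foldr_insertions opmZ.
have -> : entry w S S t = wts w t * mcoeff S (opm (modes w t) (basis S) : {malg C[fstate]}).
  by rewrite /entry ifT //; apply/eqP; exact: etrans (size_tuple t) (size_map _ _).
have [c [S' [_ ->]]] := opm_basis R (modes w t) S.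
set d := cexp _; move: (wts w t) => u.
have -> : u *: (d *: (c *: basis S')) = (u * d * c) *: basis S'.
  by rewrite [LHS]scalerA [LHS]scalerA mulrA.
rewrite (opexp_basis _ _ (fun c => a0_basis S' c)).
rewrite [X in _ * X = _]mcoeffZ [X in _ * (_ * X) = _]mcoeffZ [X in _ = _ * (_ * (_ * X))]mcoeffZ mcoeff_basis.
have [->|_] := eqVneq S' S; last by rewrite !mulr0.
rewrite weightE mulrBr cexpD in d *; rewrite /d.
move: ((-1) ^+ _) (cexp _) (cexp _) (cexp _) => a1 a2 a3 a4; ring.
Qed.

Lemma shifted_toggle e n S : (mode_loc e n \in S) == creates n ->
  shifted S - shifted (toggle (mode_loc e n) S) = - n%:~R - 1 / 2 - kappa * (if e then 1 else -1).
Proof.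
have s1 : shift1 (mode_loc e n) = if creates n then - n%:~R - 1 / 2 - kappa * (if e then 1 else -1)
   else - (- n%:~R - 1 / 2 - kappa * (if e then 1 else -1)).
  rewrite /shift1; case: n => i /=; last first.
    by rewrite NegzE mulrNz -pmulrn -[i.+1]addn1 natrD; move: (if e then _ else _) => s; field.
  by rewrite -pmulrn if_neg; case: e; field.
rewrite !shiftedE /toggle; move: s1; case: (creates n) => e1 /eqP pS.
  by rewrite pS (big_fsetD1 _ pS) /= e1 /=; ring.
by rewrite pS big_fsetU1 ?pS //= e1 /=; ring.
Qed.

Lemma entry_cons x w S0 S m ms : entry (x :: w) S0 S (m :: ms) =
  (if (mode_loc x.1 m \in S0) == creates m then wt x m * koszul R (mode_loc x.1 m) S0 else 0) *
  entry w (toggle (mode_loc x.1 m) S0) S ms.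
Proof.
rewrite /entry /= eqSS; case: (size ms == size w); last by rewrite mulr0.
rewrite psi_adjoint /wts /= big_cons /=.
case: (_ == creates m); last by rewrite mulr0 mul0r.
by rewrite mulrACA.
Qed.

Lemma nm_koszul p S : nm (koszul R p S) = 1.
Proof. by apply/eqP; rewrite -(@eqrXn2 _ 2) ?nm_ge0 // expr1n expr2 -nmM koszul_sqr nm1. Qed.

Lemma nm_entry_cons x w S0 S m ms (p := mode_loc x.1 m) : nm (entry (x :: w) S0 S (m :: ms)) <=
  expR (complex.Re x.2 * (shifted S0 - shifted (toggle p S0))) * nm (entry w (toggle p S0) S ms).
Proof.
rewrite entry_cons nmM -/p ler_wpM2r ?nm_ge0 //.
case: ifP => h; last by rewrite nm0 expR_ge0.
rewrite nmM nm_koszul mulr1 /wt nm_cexp shifted_toggle // sgc_real.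
have -> : - m%:~R - 1 / 2 - kappa%:C * (if x.1 then 1 else -1 : R)%:C =
    (- m%:~R - 1 / 2 - kappa * (if x.1 then 1 else -1))%:C :> C.
  by rewrite !rmorphB !rmorphN !rmorphM /= fmorphV rmorph_nat rmorph1 rmorph_int.
by rewrite mulrC Re_realM mulrC.
Qed.

Lemma toggle_inj e S : injective (fun n => toggle (mode_loc e n) S).
Proof.
have ti p r : toggle p S = toggle r S -> p = r.
  move=> /fsetP/(_ p); rewrite !in_toggle eqxx.
  by have [//|_] := eqVneq p r; case: (p \in S).
by move=> n m /ti; case: n m => i [j|j] [] //; [|case: e..|]; move=> // ->.
Qed.

Lemma summ_expR_shifted (rho : R) : 0 < rho -> exists2 M : R, 0 <= M &
  forall A : {fset fstate}, \sum_(S <- A) expR (- rho * shifted S) <= M.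
Proof.
move=> r0; have [M hM] := summ_subset_prod (summ_expR_grade kappa r0).
exists M => [|A]; first by have := hM fset0; rewrite big_seq_fset0.
apply: le_trans (hM A); rewrite le_eqVlt; apply/orP; left; apply/eqP/eq_bigr => S _.
rewrite nm_prod shiftedE mulr_sumr expR_sum; apply: eq_bigr => p _.
by rewrite nm_real ger0_norm ?expR_ge0.
Qed.

Lemma sum_seq_cons_le (I : choiceType) (F : seq I -> R) (g : I -> R) (M : R) :
  (forall s, 0 <= F s) -> F [::] = 0 -> 
  (forall i (B : {fset seq I}), \sum_(s <- B) F (i :: s) <= g i) ->
  (forall A : {fset I}, \sum_(i <- A) g i <= M) ->
  forall A : {fset seq I}, \sum_(s <- A) F s <= M.
Proof.
move=> F0 Fn hg hM A.
pose h (p : I * seq I) := p.1 :: p.2; have hi : injective h by move=> [? ?] [? ?] [-> ->].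
pose A1 := [fset x in pmap ohead A]%fset; pose A2 := (behead @` A)%fset.
have AB : (A `<=` [::] |` h @` (A1 `*` A2))%fset.
  apply/fsubsetP => -[|x s] sA; rewrite !inE //=; apply/imfsetP; exists (x, s) => //=.
  rewrite !inE mem_pmap /=; apply/andP; split.
    by apply/mapP; exists (x :: s).
  by apply/imfsetP; exists (x :: s).
apply: le_trans (sum_fset_le F0 AB) _; rewrite big_fsetU1 /=; last by apply/imfsetP => -[].
rewrite Fn add0r sum_imfset // sum_fsetM; apply: le_trans (hM A1).
by apply: ler_sum => i _; exact: hg.
Qed.

(* A nonzero term is a path of states; summation by parts of the exponents
   [Re z_i * (shifted S_(i-1) - shifted S_i)] turns it into a product of factors
   [expR (- (Re z_i - Re z_(i+1)) * shifted S_i)], summable over all states. *)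
Lemma entry_bound w (zeta : R) :
  sorted >%R (rcons [seq complex.Re x.2 | x <- w] zeta) ->
  exists2 B : R, 0 <= B & forall S0 S (A : {fset seq int}),
    \sum_(ms <- A) nm (entry w S0 S ms) <=
    B * expR (head zeta [seq complex.Re x.2 | x <- w] * shifted S0 - zeta * shifted S).
Proof.
elim: w => [_|x w IH].
  exists 1 => // S0 S A; rewrite mul1r /=.
  have e0 ms : ms != [::] -> entry [::] S0 S ms = 0 by case: ms.
  apply: (@le_trans _ _ (nm (entry [::] S0 S [::]))).
    have [nA|nA] := boolP ([::] \in A).
      rewrite (big_fsetD1 _ nA) /= big_seq big1 ?addr0 // => ms; rewrite !inE => /andP[/e0 -> _].
      by rewrite nm0.
    by rewrite big_seq big1 ?nm_ge0 // => ms mA; rewrite e0 ?nm0 //; apply: contraNneq nA => <-.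
  rewrite /entry /= /wts big_nil mul1r mcoeff_basis.
  have [->|_] := eqVneq S S0; first by rewrite subrr expR0 nm1.
  by rewrite nm0 expR_ge0.
rewrite /= => hs; have [B B0 hB] := IH (path_sorted hs).
set r1 := head zeta [seq complex.Re y.2 | y <- w] in hB.
have rho0 : 0 < complex.Re x.2 - r1.
  by rewrite subr_gt0 /r1; case: (w) hs => [|y w'] /= /andP[].
have [M M0 hM] := summ_expR_shifted rho0.
exists (M * B) => [|S0 S A]; first exact: mulr_ge0.
set E := expR _.
have -> : M * B * E = B * E * M by ring.
apply: (@sum_seq_cons_le _ (fun ms => nm (entry (x :: w) S0 S ms))
  (fun m => B * E * expR (- (complex.Re x.2 - r1) * shifted (toggle (mode_loc x.1 m) S0)))).
- by move=> s; exact: nm_ge0.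
- by rewrite /entry nm0.
- move=> m D; apply: le_trans (ler_sum _ (fun ms _ => nm_entry_cons x w S0 S m ms)) _.
  rewrite -mulr_sumr; apply: le_trans (ler_wpM2l (expR_ge0 _) (hB _ _ _)) _.
  rewrite le_eqVlt; apply/orP; left; apply/eqP.
  rewrite mulrCA -!mulrA -!expRD; congr (_ * expR _); ring.
move=> D; rewrite -mulr_sumr ler_wpM2l //; first by rewrite mulr_ge0 ?expR_ge0.
(* Distinct modes lead from [S0] to distinct states, so the sum over the first mode is bounded by a
   sum over all states. *)
by rewrite -(sum_imfset _ (fun S => expR (- (complex.Re x.2 - r1) * shifted S)) (@toggle_inj x.1 S0)).
Qed.

Lemma nm_weight S : nm (weight S) = expR (- L * shifted S).
Proof.
by rewrite nm_prod shiftedE mulr_sumr expR_sum; apply: eq_bigr => p _; rewrite nm_xi.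
Qed.

Definition terms w (p : fstate * seq int) : C := weight p.1 * entry w p.1 p.1 p.2.

Lemma region_sorted w : region tau w -> exists2 zeta : R,
  sorted >%R (rcons [seq complex.Re x.2 | x <- w] zeta) &
  head zeta [seq complex.Re x.2 | x <- w] - zeta < L.
Proof.
have L0 := nome_rate_gt0 tau_gt0.
case: w => [|x w] reg; first by exists 0 => //=; rewrite subrr.
pose rN := last (complex.Re x.2) [seq complex.Re y.2 | y <- w].
have ReB (u v : C) : complex.Re (u - v) = complex.Re u - complex.Re v by case: u; case: v.
have rx : complex.Re x.2 - rN < L.
  move: reg; rewrite /region /= => /andP[/allP h _]; rewrite /rN.
  case/lastP: (w) h => [|w' y] h; first by rewrite /= subrr.
  rewrite map_rcons last_rcons -ReB.
  by have /h /andP[] : y \in rcons w' y by rewrite mem_rcons mem_head.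
(* The midpoint of Re z_1 - L and the last Re z_i: a strict gap remains on both sides, one for
   [entry_bound] and one for the weight of the trace. *)
exists ((complex.Re x.2 - L + rN) / 2); last by rewrite /=; lra.
rewrite /= rcons_path -/rN; apply/andP; split; last by rewrite /=; lra.
have := reg; rewrite -[path _ _ _]/(sorted >%R [seq complex.Re y.2 | y <- x :: w]) /region.
rewrite sorted_map => /pairwise_sorted; apply: sub_sorted => u v /andP[+ _] /=.
by rewrite ReB subr_gt0.
Qed.

Lemma summ_terms w : region tau w -> summ (terms w).
Proof.
move=> /region_sorted[zeta sw hz]; have [B B0 hB] := entry_bound sw.
set r1 := head _ _ in hB hz.
(* On the diagonal the bound grows at rate r1 - zeta in the shifted energy, and the weight decays at
   rate L. *)
have rho0 : 0 < L - (r1 - zeta) by rewrite subr_gt0.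
have [M M0 hM] := summ_expR_shifted rho0.
apply: (@summ_pair _ _ _ _ (fun S => B * expR (- (L - (r1 - zeta)) * shifted S)) (B * M)) => [S D|A].
  rewrite /terms /=; under eq_bigr => ms _ do rewrite nmM.
  rewrite -mulr_sumr nm_weight; apply: le_trans (ler_wpM2l (expR_ge0 _) (hB _ _ _)) _.
  rewrite le_eqVlt; apply/orP; left; apply/eqP.
  rewrite mulrCA -expRD; congr (_ * expR _); ring.
by rewrite -mulr_sumr ler_wpM2l.
Qed.

End Correlator.

(** * From mode traces to kernels *)

Section Recursion.
Variable R : realType.
Local Notation C := R[i].
Local Notation fock := (fock R).
Local Notation basis := (@Defs.basis R).
Variable tau : C.
Hypothesis tau_gt0 : 0 < complex.Im tau.
Local Notation L := (nome_rate tau).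
Local Notation ipi := (ipi R).
Local Notation th := (Submission.th tau).
Local Notation K u := (prime_form u tau).
Local Notation gen := (gen tau).
Variables (alpha beta : R).
Implicit Types (S : fstate) (w : seq (bool * C)) (ms : seq int).
Local Notation kappa := (beta + 1 / 2).
Local Notation wt := (wt kappa).
Local Notation wts := (wts kappa).
Local Notation trace := (trace tau alpha kappa).
Local Notation tracet := (tracet tau alpha kappa).
Local Notation terms := (terms tau alpha kappa).
Local Notation kap_arg := (kap_arg tau alpha kappa).
Local Notation Th := (Th tau beta alpha).

Definition corr w : C := csum (terms w).
Definition mode_sum w ms : C := if size ms == size w then wts w ms * trace (modes w ms) else 0.

(** The double sum with the states summed first, which is the order in which the trace recursion
    applies. *)
Lemma has_sum_mode w : region tau w -> summ (mode_sum w) /\ has_sum (mode_sum w) (corr w).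
Proof.
move=> reg; have sF := summ_terms tau_gt0 alpha kappa reg.
pose h (p : seq int * fstate) := (p.2, p.1).
have hi : injective h by move=> [? ?] [? ?] [-> ->].
have sG := summ_inj hi sF.
have hG : has_sum (fun p => terms w (h p)) (corr w).
  by apply/(has_sum_inj _ hi); [move=> [S ms] _; exists (ms, S)|exact: has_csum sF].
have e : mode_sum w = fun ms => csum (fun S => terms w (h (ms, S))); last first.
  by rewrite e; split; [exact: summ_fubini sG|exact: has_sum_fubini sG hG].
apply/funext => ms; rewrite /mode_sum; apply/esym/csumE; rewrite /h /Submission.terms /entry /=.
case: eqP => _; last by apply: eq_has_sum (@has_sum0 R _) => S; rewrite mulr0.
by apply: eq_has_sum (has_sumZ _ (has_csum (summ_tracet tau_gt0 alpha kappa _))) => S; rewrite mulrCA.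
Qed.

Lemma annulusN u : annulus tau true u -> annulus tau false (- u).
Proof.
have -> : annulus tau false (- u) = (- L < - complex.Re u < 0) by case: u.
by rewrite ltrN2 oppr_lt0 andbC.
Qed.

(** The modes n and -1 - n of opposite charges have opposite degrees, so only the difference z - y
    survives, and each such pair is one term of the kernel. *)
Lemma pairing_kterm e z f y n : f != e ->
  wt (e, z) n * wt (f, y) (- 1 - n) * kap tau (kap_arg e) n =
  cexp (- (1 / 2 + kappa%:C * sgc R e) * (z - y)) * kterm tau false (- (z - y)) (kap_arg e) n.
Proof.
move=> fe; rewrite /kterm /Submission.wt subr0 mulrA -!cexpD; congr (cexp _ * _) => /=.
have -> : sgc R f = - sgc R e by move: fe; case: f; case: e => //= _; rewrite /sgc ?opprK.
by rewrite rmorphB rmorphN rmorph1 /=; move: (n%:~R : C) (sgc R e) (_%:C) => a b c; field.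
Qed.

Definition insert_at (T : Type) j (m : T) (s : seq T) := take j s ++ m :: drop j s.

Lemma insert_at_inj (T : eqType) j (m m' : T) s s' : insert_at j m s = insert_at j m' s' -> m = m' /\ s = s'.
Proof.
rewrite /insert_at => e; have := congr1 size e.
rewrite !size_cat /= !addnS -!size_cat !cat_take_drop => -[sz].
move/eqP: e; rewrite eqseq_cat ?size_take ?sz // eqseq_cons => /and3P[/eqP e1 /eqP -> /eqP e2].
by split=> //; rewrite -(cat_take_drop j s) e1 e2 cat_take_drop.
Qed.

(** The anticommutator forces the mode of the partner x to be -1 - n. What remains is a free sum
    over n and over the modes of the shorter word, a product of two series. *)
Lemma has_sum_pairing e z w1 x w2 (w := w1 ++ x :: w2) (j := size w1) :
  region tau ((e, z) :: w) -> gen (kap_arg e) ->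
  has_sum (fun ms => if ms is n :: ms' then
      if size ms' == size w then
        wt (e, z) n * wts w ms' * kap tau (kap_arg e) n *
        ((-1) ^+ j * pairp R (e, n) (nth (e, n) (modes w ms') j) * trace (remove j (modes w ms')))
      else 0 else 0)
    ((-1) ^+ j * (if x.1 != e then
      cexp (- (1 / 2 + kappa%:C * sgc R e) * (z - x.2)) * skernel tau false (- (z - x.2)) (kap_arg e)
      * corr (w1 ++ w2) else 0)).
Proof.
move=> reg ge.
have reg' : region tau (w1 ++ w2).
  have /(region_remove j) : region tau w by case/andP: reg.
  by rewrite /remove /w take_size_cat // -cat_rcons drop_size_cat // size_rcons.
have an : annulus tau true (z - x.2).
  by move: reg; rewrite /region /= => /andP[/allP h _]; apply: h; rewrite mem_cat mem_head orbT.
have split_ms ms : size ms = size w -> exists t1 m t2, [/\ ms = t1 ++ m :: t2, size t1 = j & size t2 = size w2].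
  move=> sm; have jm : (j < size ms)%N by rewrite sm /w size_cat /= /j; lia.
  exists (take j ms), (nth 0 ms j), (drop j.+1 ms); split; first exact: remove_split.
    by rewrite size_take jm.
  by rewrite size_drop sm /w size_cat /= /j; lia.
have modesE t1 m t2 : size t1 = j -> modes w (t1 ++ m :: t2) = modes w1 t1 ++ (x.1, m) :: modes w2 t2.
  by move=> s1; rewrite /modes /w map_cat zip_cat ?size_map // -s1.
have szm t1 : size t1 = j -> size (modes w1 t1) = j by move=> s1; rewrite size_zip size_map s1 minnn.
set F := (fun ms => _ : C).
case: ifPn => xe; last first.
  rewrite mulr0; apply: eq_has_sum (@has_sum0 R _) => -[|n ms] //; rewrite /F.
  case: eqP => // /split_ms[t1 [m [t2 [-> s1 s2]]]].
  rewrite modesE // nth_cat szm // ltnn subnn /= /pairp /pairing /=.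
  by rewrite negbK in xe; rewrite (eqP xe) eqxx mulr0 mul0r mulr0.
pose h (p : int * seq int) := p.1 :: insert_at j (- 1 - p.1) p.2.
have hi : injective h.
  by move=> [n s] [n' s']; rewrite /h => /= -[<-] /insert_at_inj[_ ->].
apply/(has_sum_inj _ hi) => [[|n ms]|].
- by rewrite /F eqxx.
- rewrite /F; case: (size ms =P size w) => [/split_ms[t1 [m [t2 [-> s1 s2]]]]|_]; last by rewrite eqxx.
  rewrite modesE // nth_cat szm // ltnn subnn /= /pairp /pairing /=.
  case: ifP => [/andP[_ /eqP nm] _|_]; last by rewrite mulr0 mul0r mulr0 eqxx.
  exists (n, t1 ++ t2); rewrite /h /insert_at /= take_size_cat // drop_size_cat //.
  by congr (_ :: _ ++ _ :: _); rewrite -nm; ring.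
set c := cexp _; set sk := skernel _ _ _ _.
have sk1 := summ_kterm tau_gt0 (annulusN an) ge.
have [sm hm] := has_sum_mode reg'.
have := has_sumZ ((-1) ^+ j * c) (has_sumM sk1 sm (has_csum sk1) hm).
rewrite -[csum _]/sk -[_ * c * _]mulrA -[c * sk * _]mulrA; apply: eq_has_sum => -[n s] /=.
rewrite /F /h /= /mode_sum.
have -> : (size (insert_at j (- 1 - n) s) == size w) = (size s == size (w1 ++ w2)).
  by rewrite /insert_at !size_cat /= !addnS eqSS -size_cat cat_take_drop.
case: eqP => [es|_]; last by rewrite !mulr0.
have s1 : size (take j s) = j by rewrite size_take es size_cat; case: ifP => //; rewrite /j; lia.
rewrite /insert_at modesE // nth_cat szm // ltnn subnn /= /pairp /pairing /=.
have -> : (e != x.1) && (n + (- 1 - n) == - 1) by rewrite eq_sym xe /=; apply/eqP; ring.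
have -> : remove j (modes w1 (take j s) ++ (x.1, - 1 - n) :: modes w2 (drop j s)) = modes (w1 ++ w2) s.
  rewrite /remove take_size_cat ?szm // -cat_rcons drop_size_cat ?size_rcons ?szm //.
  by rewrite -zip_cat ?size_map // -map_cat cat_take_drop.
have -> : wts w (take j s ++ - 1 - n :: drop j s) = wt x (- 1 - n) * wts (w1 ++ w2) s.
  rewrite /Submission.wts /w -[in RHS](cat_take_drop j s) !zip_cat // !big_cat /= big_cons /=.
  by rewrite mulrCA.
have := pairing_kterm z x.2 n xe; rewrite -surjective_pairing -/c.
move: c (kterm _ _ _ _ _) (wt _ _) (wt _ _) (kap _ _ _) (wts _ _) (trace _) ((-1) ^+ j).
by move=> a2 a1 a3 a4 a5 a6 a7 a8 ea; rewrite mulr1; transitivity (a8 * (a2 * a1) * (a6 * a7)); [ring|rewrite -ea; ring].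
Qed.

Definition skern e u : C := cexp (- (1 / 2 + kappa%:C * sgc R e) * u) * skernel tau false (- u) (kap_arg e).

Lemma corr_recursion e z w : region tau ((e, z) :: w) -> odd (size w) -> gen (kap_arg e) ->
  corr ((e, z) :: w) = \sum_(j < size w) (-1) ^+ j *
    (if (nth (e, z) w j).1 != e then skern e (z - (nth (e, z) w j).2) * corr (remove j w) else 0).
Proof.
move=> reg od ge; apply: has_sum_unique (has_sum_mode reg).2 _.
pose F (j : nat) ms := if ms is n :: ms' then
      if size ms' == size w then
        wt (e, z) n * wts w ms' * kap tau (kap_arg e) n *
        ((-1) ^+ j * pairp R (e, n) (nth (e, n) (modes w ms') j) * trace (remove j (modes w ms')))
      else 0 else 0.
have hF (j : 'I_(size w)) : has_sum (F j) ((-1) ^+ j *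
    (if (nth (e, z) w j).1 != e then skern e (z - (nth (e, z) w j).2) * corr (remove j w) else 0)).
  have ew := remove_split (e, z) (ltn_ord j); set x := nth _ _ _ in ew *.
  have sj : size (take j w) = j by rewrite size_take ltn_ord.
  have := @has_sum_pairing e z (take j w) x (drop j.+1 w); rewrite -ew sj; apply=> //.
have := @has_sum_sum R _ _ (index_enum 'I_(size w)) xpredT (fun (j : 'I_(size w)) => F j) _ (fun j _ => hF j).
apply: eq_has_sum => -[|n ms] /=; first by rewrite big1.
rewrite /mode_sum /= eqSS; case: eqP => [es|_]; last by rewrite big1.
rewrite /Submission.wts /= big_cons -/(wts w ms).
have sz : size (modes w ms) = size w by rewrite size_zip size_map es minnn.
rewrite trace_recursion ?sz // !mulr_sumr; apply: eq_bigr => j _.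
by rewrite !mulrA.
Qed.

Lemma skern_Th e u : annulus tau true u -> gen (tparam tau beta alpha) -> gen (kap_arg e) ->
  skern e u = Th (sgc R e * u) / (Th 0 * K u).
Proof.
move=> an gt ge; set t := tparam _ _ _ in gt.
have r2 : (1 / 2 : R)%:C = 1 / 2 :> C by rewrite rmorphM /= fmorphV rmorph_nat rmorph1.
have tu := th_neq0 tau_gt0 (gen_annulus tau_gt0 an).
have tu' := th_neq0 tau_gt0 (gen_annulus tau_gt0 (annulusN an)).
have tA := th_neq0 tau_gt0 ge; have tt := th_neq0 tau_gt0 gt.
have ThE v : Th v = cexp (ipi * tau * (- beta + 1 / 2)%:C ^+ 2 + (- beta + 1 / 2)%:C * (2 * ipi * (alpha + 1 / 2)%:C))
    * (cexp ((1 / 2 - beta%:C) * v) * th (v + t)).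
  rewrite /Submission.Th thetaE // mulrA -cexpD; congr (cexp _ * th _).
    by rewrite !rmorphD rmorphN /= r2; move: (beta%:C) (alpha%:C) => a b; ring.
  by rewrite /t /tparam !rmorphD rmorphN /= r2; move: (beta%:C) (alpha%:C) => a b; field.
set A := kap_arg e in ge tA *.
(* For e = [false] the argument A is the twist t itself. For e = [true] it is 2 pi i tau - t, and
   reflection with quasi-periodicity brings it back to t. *)
have key : cexp (- (1 / 2 + kappa%:C * sgc R e) * u) * th (- u + A) * th t * cexp (u / 2) =
    cexp ((1 / 2 - beta%:C) * (sgc R e * u)) * th (sgc R e * u + t) * cexp u * th A.
  have kE : kappa%:C = beta%:C + 1 / 2 :> C by rewrite rmorphD /= r2.
  have quasi s : th (- s + 2 * ipi * tau) = cexp (2 * s - 2 * ipi * tau) * th s.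
    rewrite th_quasi // [th (- s)]thN // opprK mulNr mulNr mulrN opprK mulrA -cexpD; congr (cexp _ * _); ring.
  case: (e) @A ge tA => A _ _.
    have -> : A = - t + 2 * ipi * tau.
      by rewrite /A /kap_arg kE /t /tparam /sgc; move: (beta%:C) (alpha%:C) => a b; field.
    have -> : - u + (- t + 2 * ipi * tau) = - (t + u) + 2 * ipi * tau by ring.
    rewrite !quasi kE /sgc [1 * u]mul1r [u + t]addrC.
    have -> : cexp (- (1 / 2 + (beta%:C + 1 / 2) * 1) * u) * (cexp (2 * (t + u) - 2 * ipi * tau) * th (t + u)) * th t *
      cexp (u / 2) = cexp (- (1 / 2 + (beta%:C + 1 / 2) * 1) * u + (2 * (t + u) - 2 * ipi * tau) + u / 2) * (th (t + u) * th t).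
      rewrite !cexpD; move: (th _) (th _) (cexp _) (cexp _) (cexp _) => a1 a2 a3 a4 a5; ring.
    have -> : cexp ((1 / 2 - beta%:C) * u) * th (t + u) * cexp u * (cexp (2 * t - 2 * ipi * tau) * th t) =
      cexp ((1 / 2 - beta%:C) * u + u + (2 * t - 2 * ipi * tau)) * (th (t + u) * th t).
      rewrite !cexpD; move: (th _) (th _) (cexp _) (cexp _) (cexp _) => a1 a2 a3 a4 a5; ring.
    by congr (cexp _ * _); field.
  have -> : A = t by rewrite /A /kap_arg kE /t /tparam /sgc; move: (beta%:C) (alpha%:C) => a b; field.
  rewrite kE /sgc mulN1r mulrN1.
  have -> : cexp (- (1 / 2 - (beta%:C + 1 / 2)) * u) * th (- u + t) * th t * cexp (u / 2) =
    cexp (- (1 / 2 - (beta%:C + 1 / 2)) * u + u / 2) * (th (- u + t) * th t).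
    rewrite cexpD; move: (th _) (th _) (cexp _) (cexp _) => a1 a2 a3 a4; ring.
  have -> : cexp ((1 / 2 - beta%:C) * - u) * th (- u + t) * cexp u * th t =
    cexp ((1 / 2 - beta%:C) * - u + u) * (th (- u + t) * th t).
    rewrite cexpD; move: (th _) (th _) (cexp _) (cexp _) => a1 a2 a3 a4; ring.
  by congr (cexp _ * _); field.
rewrite /skern skernelE ?annulusN // /kron !ThE thN // prime_formE // mulr0 cexp0 add0r.
have c0 := cexp_neq0 (ipi * tau * (- beta + 1 / 2)%:C ^+ 2 + (- beta + 1 / 2)%:C * (2 * ipi * (alpha + 1 / 2)%:C)).
have d0 := dth_neq0 tau_gt0; have u0 := cexp_neq0 u; have u20 := cexp_neq0 (u / 2).
move: key c0 u0 u20 tu tA tt d0.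
move: (cexp (ipi * _ * _ + _)) (cexp (- (1 / 2 + _) * u)) (cexp ((1 / 2 - _) * _)) (cexp u) (cexp (u / 2))
  (th (- u + A)) (th (sgc R e * u + t)) (th u) (th A) (th t) (dth _ _).
move=> c x1 x2 x3 x4 h1 h2 h3 h4 h5 d key c0 u0 u20 tu tA tt d0.
apply: (mulfI tt); apply: (mulfI u20).
have -> : x4 * (h5 * (x1 * - (d * h1 / (- x3 * h3 * h4)))) = (x1 * h1 * h5 * x4) * d / (x3 * h3 * h4).
  by field; rewrite tA tu u0.
by rewrite key; field; rewrite tA tu u0 u20 d0 c0 tt.
Qed.

End Recursion.

(** * The correlation functions *)
Section Eventually.
Implicit Types P Q : nat -> Prop.

Definition cofinitely P := exists N, forall n, (N <= n)%N -> P n.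

Lemma cofinitelyW P Q : (forall n, P n -> Q n) -> cofinitely P -> cofinitely Q.
Proof. by move=> PQ [N hN]; exists N => n /hN/PQ. Qed.

Lemma cofinitely_and P Q : cofinitely P -> cofinitely Q -> cofinitely (fun n => P n /\ Q n).
Proof.
move=> [N hN] [M hM]; exists (maxn N M) => n; rewrite geq_max => /andP[h1 h2].
by split; [exact: hN|exact: hM].
Qed.

Lemma cofinitely_all (T : eqType) (s : seq T) (P : T -> nat -> Prop) :
  (forall x, x \in s -> cofinitely (P x)) -> cofinitely (fun n => forall x, x \in s -> P x n).
Proof.
elim: s => [|x s IH] h; first by exists 0%N.
have h1 : cofinitely (P x) by apply: h; rewrite mem_head.
have h2 : cofinitely (fun n => forall x, x \in s -> P x n) by apply: IH => y ys; apply: h; rewrite inE ys orbT.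
by apply: cofinitelyW (cofinitely_and h1 h2) => n [a b] y; rewrite inE => /orP[/eqP->|/b].
Qed.

Lemma cvgs_cofinitely_eq (R : realType) (u v : nat -> R[i]) (l : R[i]) : cofinitely (fun n => u n = v n) ->
  ((u : nat -> R[i]^o) @ \oo --> (l : R[i]^o))%classic ->
  ((v : nat -> R[i]^o) @ \oo --> (l : R[i]^o))%classic.
Proof.
move=> [N hN] /cvgsP hu; apply/cvgsP => e /hu[M hM]; exists (maxn N M) => n.
by rewrite geq_max => /andP[/hN <- /hM].
Qed.
End Eventually.

Section Correlation.
Variable R : realType.
Local Notation C := R[i].
Local Notation basis := (@Defs.basis R).
Variable tau : C.
Hypothesis tau_gt0 : 0 < complex.Im tau.
Local Notation L := (nome_rate tau).
Local Notation ipi := (ipi R).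
Local Notation th := (Submission.th tau).
Local Notation gen := (gen tau).
Local Notation q := (nome tau).
Variable beta : R.
Implicit Types (S : fstate) (w : seq (bool * C)) (ms : seq int) (alpha : R).
Local Notation kappa := (beta + 1 / 2).
Local Notation corr := (corr tau).
Local Notation Th alpha := (Th tau beta alpha).

Let r2 : (1 / 2 : R)%:C = 1 / 2 :> C.
Proof. by rewrite rmorphM /= fmorphV rmorph_nat rmorph1. Qed.

Lemma corr_nil alpha : corr alpha beta [::] = th (- tparam tau beta alpha) / euler tau.
Proof.
set t := tparam _ _ _; have reg : region tau ([::] : seq (bool * C)) by [].
have -> : corr alpha beta [::] = csum (weight tau alpha kappa).
  apply: has_sum_unique (has_sum_mode tau_gt0 alpha beta reg).2 _.
  have := @has_sum_finite R _ (mode_sum tau alpha beta [::]) [fset [::]]%fset.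
  rewrite big_seq_fset1 /mode_sum /= /wts /= big_nil [1 * Submission.trace _ _ _ _]mul1r.
  have -> : Submission.trace tau alpha kappa (modes [::] [::]) = csum (weight tau alpha kappa).
    suff e : tracet tau alpha kappa [::] = weight tau alpha kappa by rewrite -e.
    by apply/funext => S; rewrite /tracet /= mcoeff_basis eqxx mulr1.
  by move=> h; apply: (h _) => ms; rewrite inE /mode_sum; case: ms.
pose s n : seq fmode := [seq (true, k) | k <- iota 0 n] ++ [seq (false, k) | k <- iota 0 n].
have in_s p n : (p \in s n) = (p.2 < n)%N.
  case: p => e k; rewrite mem_cat; apply/orP/idP => [[] /mapP[k' + [_ ->]]|kn].
  - by rewrite mem_iota add0n.
  - by rewrite mem_iota add0n.
  by case: e kn => kn; [left|right]; apply/mapP; exists k; rewrite ?mem_iota ?add0n.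
have us n : uniq (s n).
  rewrite cat_uniq !map_inj_uniq ?iota_uniq; try by move=> ? ? [].
  by rewrite andbT; apply/hasPn => p /mapP[k _ ->]; apply/mapP => -[].
(* All modes of index below n and of either charge: the subsets of [U n] exhaust the states, and
   their weights add up to a partial triple product. *)
pose U n : {fset fmode} := [fset p in s n]%fset.
have inU p n : (p \in U n) = (p.2 < n)%N by rewrite -in_s; apply/imfsetP/idP => [[x + ->]|h]; [|exists p].
have UE n (F : fmode -> C) : \prod_(p <- U n) F p = \prod_(k < n) (F (true, val k) * F (false, val k)).
  have -> : \prod_(p <- U n) F p = \prod_(p <- s n) F p.
    by apply: perm_big; apply: uniq_perm; rewrite ?fset_uniq // => p; rewrite inU in_s.
  rewrite big_cat !big_map big_split /=; congr (_ * _).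
    by rewrite -(big_mkord xpredT (fun k => F (true, k))) /index_iota subn0.
  by rewrite -(big_mkord xpredT (fun k => F (false, k))) /index_iota subn0.
have cof (A : {fset fstate}) : exists N, forall n, (N <= n)%N -> (A `<=` fpowerset (U n))%fset.
  have [N hN] := below_cofinal (snd @` (\bigcup_(S <- A) S))%fset.
  exists N => n /hN/fsubsetP h; apply/fsubsetP => S SA; rewrite fpowersetE.
  apply/fsubsetP => p pS; rewrite inU -in_below; apply: h; apply/imfsetP; exists p => //=.
  by apply/bigfcupP; exists S => //; rewrite SA.
have h := cvgs_has_sum (has_csum (summ_weight tau_gt0 alpha kappa)) cof.
apply: cvgs_unique h _; move: (@triple_product R tau tau_gt0 t).
set u := (fun N : nat => _ : C^o); set v := (fun n => _ : C^o); suff -> : v = u by [].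
apply/funext => n; rewrite /u /v.
have -> : \sum_(S <- fpowerset (U n)) weight tau alpha kappa S = \prod_(p <- U n) (1 + xi tau alpha kappa p).
  by rewrite prod_fset_expand.
rewrite UE; apply: eq_bigr => k _; rewrite !nomeX -!cexpD.
have xiE e : 1 + xi tau alpha kappa (e, val k) = 1 - cexp (2 * ipi * alpha%:C * sgc R e + 2 * ipi * tau * (k%:R + 1 / 2 - kappa%:C * sgc R e)).
  by [].
rewrite (xiE true) (xiE false) /t /tparam /sgc; congr ((1 - cexp _) * (1 - cexp _)); rewrite !rmorphD /= r2.
  by move: (k%:R : C) (beta%:C) (alpha%:C) => x b a; field.
by rewrite -[k.+1]addn1 natrD; move: (k%:R : C) (beta%:C) (alpha%:C) => x b a; field.
Qed.

Definition normalization alpha : C :=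
  cexp (twopii R * (alpha + 1 / 2)%:C * (beta + 1 / 2)%:C) / dedekind_eta tau.
Definition vacuum_shift : C := cexp (- (twopii R * tau * ((ch kappa)%:C / 24%:R))).

(** With kappa = beta + 1/2, -c_h/24 = -1/24 + kappa^2/2. The first term is the one in eta; the
    reflection of th contributes - beta, and kappa^2/2 - beta = (1/2 - beta)^2/2 is the Gaussian
    exponent of theta. *)
Lemma vacuum_correlation alpha :
  vacuum_shift * corr alpha beta [::] = normalization alpha * Th alpha 0.
Proof.
rewrite corr_nil /normalization dedekind_etaE // /Submission.Th thetaE // thN // /vacuum_shift /qpow twopiiE.
have e0 := euler_neq0 tau_gt0.
set t := tparam _ _ _.
have -> : 0 + 2 * ipi * ((alpha + 1 / 2)%:C - 1 / 2) + 2 * ipi * tau * ((- beta + 1 / 2)%:C - 1 / 2) = t.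
  by rewrite /t /tparam !rmorphD rmorphN /= r2; move: (alpha%:C) (beta%:C) => a b; field.
have -> : cexp (2 * ipi * (alpha + 1 / 2)%:C * kappa%:C) / (cexp (2 * ipi * tau * (1 / 24%:R)) * euler tau) *
  (cexp (ipi * tau * (- beta + 1 / 2)%:C ^+ 2 + (- beta + 1 / 2)%:C * (0 + 2 * ipi * (alpha + 1 / 2)%:C)) * th t) =
  cexp (2 * ipi * (alpha + 1 / 2)%:C * kappa%:C - 2 * ipi * tau * (1 / 24%:R) +
   (ipi * tau * (- beta + 1 / 2)%:C ^+ 2 + (- beta + 1 / 2)%:C * (0 + 2 * ipi * (alpha + 1 / 2)%:C))) * (th t / euler tau).
  rewrite [in RHS]cexpD [in RHS]cexpB; move: (cexp_neq0 (2 * ipi * tau * (1 / 24%:R))).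
  move: (cexp _) (cexp _) (cexp _) (th t) (euler tau) e0 => a b c d e e0 a0.
  by field; rewrite ?a0 ?e0.
have -> x : cexp (- x) * (- cexp t * th t / euler tau) = cexp (- x + t + ipi) * (th t / euler tau).
  rewrite !cexpD cexp_ipi; move: (cexp _) (cexp _) (th t) (euler tau)^-1 => a b c d; ring.
congr (cexp _ * _).
have chE : (ch kappa)%:C = 1 - 12%:R * kappa%:C ^+ 2 :> C.
  by rewrite /ch rmorphB rmorph1 rmorphM rmorphXn /= rmorph_nat.
have kE : kappa%:C = beta%:C + 1 / 2 :> C by rewrite rmorphD /= r2.
have bE : (- beta + 1 / 2)%:C = - beta%:C + 1 / 2 :> C by rewrite rmorphD rmorphN /= r2.
have aE : (alpha + 1 / 2)%:C = alpha%:C + 1 / 2 :> C by rewrite rmorphD /= r2.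
by rewrite chE kE bE aE /t /tparam; move: (alpha%:C) (beta%:C) => a b; field.
Qed.

(* The contraction of a trace needs [tparam] to avoid the period lattice; this is
   achieved by approximating [alpha]. *)
Definition alpha_seq alpha (n : nat) : R := alpha + 1 / n.+1%:R.

Lemma alpha_seqC alpha n : (alpha_seq alpha n)%:C = alpha%:C + 1 / n.+1%:R :> C.
Proof. by rewrite rmorphD rmorphM /= fmorphV rmorph_nat rmorph1. Qed.

Lemma cvgs_alpha_seq alpha : ((fun n => (alpha_seq alpha n)%:C : C^o) @ \oo --> (alpha%:C : C^o))%classic.
Proof.
apply: cvgs_real; rewrite -[X in (_ --> X)%classic](addr0 alpha); apply: cvgD; first exact: cvg_cst.
have -> : (fun n => 1 / n.+1%:R : R) = (fun n => n.+1%:R^-1) by apply/funext => n; rewrite mul1r.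
exact: cvg_harmonic.
Qed.

Lemma tparam_seq alpha n e c : sgc R e * tparam tau beta (alpha_seq alpha n) + c =
  (sgc R e * tparam tau beta alpha + c) + sgc R e * (2 * ipi * (1 / n.+1%:R)).
Proof. by rewrite /tparam alpha_seqC; move: (_ / n.+1%:R) => x; ring. Qed.

Lemma kap_arg_seq alpha n e : kap_arg tau (alpha_seq alpha n) kappa e =
  kap_arg tau alpha kappa e + sgc R (~~ e) * (2 * ipi * (1 / n.+1%:R)).
Proof. by rewrite /kap_arg alpha_seqC sgcN; move: (_ / n.+1%:R) => x; ring. Qed.

Definition neutral w := count (fun x => x.1) w == count (fun x => ~~ x.1) w.

(** Both sides obey the same recursion. The threshold on n depends on the word, and only the
    finitely many subwords [remove j w] are needed at each stage, so the thresholds combine. *)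
Lemma generic_correlation alpha w : region tau w -> neutral w ->
  cofinitely (fun n => vacuum_shift * corr (alpha_seq alpha n) beta w =
    normalization (alpha_seq alpha n) * (Th (alpha_seq alpha n) (wsum w) * wprod tau w)).
Proof.
have [k] := ubnP (size w); elim: k w => // k IH [|[e z] w].
  move=> _ _ _; exists 0%N => n _.
  by rewrite vacuum_correlation /wsum big_nil mulr1.
rewrite ltnS => sw reg neu.
have [ct szw] : count (fun x => x.1 != e) w = (count (fun x => x.1 == e) w).+1 /\ odd (size w).
  have c1 : count (fun x => x.1 != e) w = (count (fun x => x.1 == e) w).+1.
    move: neu; rewrite /neutral /=; have eT := eq_count (fun x : bool * C => eqb_id x.1).
    have eF := eq_count (fun x : bool * C => eqbF_neg x.1).
    have nT := eq_count (fun x : bool * C => congr1 negb (eqb_id x.1)).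
    have nF := eq_count (fun x : bool * C => etrans (congr1 negb (eqbF_neg x.1)) (negbK x.1)).
    clear sw reg; by case: e => /= /eqP; rewrite ?add0n ?add1n; [rewrite eT nT => <-|rewrite eF nF => ->].
  split=> //; rewrite -(count_predC (fun x => x.1 == e)) -[count (predC _) _]/(count (fun x => x.1 != e) w) c1.
  by rewrite addnS /= oddD addbb.
have [cs hcs] := word_recursion tau_gt0 beta reg ct.
have regw : region tau w by case/andP: reg.
have H1 : cofinitely (fun n => gen (kap_arg tau (alpha_seq alpha n) kappa e)).
  have [N hN] := gen_eventually tau_gt0 (~~ e) (kap_arg tau alpha kappa e).
  by exists N => n /hN; rewrite kap_arg_seq.
have H2 : cofinitely (fun n => gen (tparam tau beta (alpha_seq alpha n))).
  have [N hN] := gen_eventually tau_gt0 true (sgc R true * tparam tau beta alpha + 0).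
  by exists N => n /hN; rewrite -tparam_seq addr0 /sgc mul1r.
have H3 : cofinitely (fun n => forall c, c \in cs -> gen (sgc R e * tparam tau beta (alpha_seq alpha n) + c)).
  apply: cofinitely_all => c _; have [N hN] := gen_eventually tau_gt0 e (sgc R e * tparam tau beta alpha + c).
  by exists N => n /hN; rewrite -tparam_seq.
have H4 : cofinitely (fun n => forall j, j \in enum 'I_(size w) -> (nth (e, z) w j).1 != e ->
    vacuum_shift * corr (alpha_seq alpha n) beta (remove j w) =
    normalization (alpha_seq alpha n) * (Th (alpha_seq alpha n) (wsum (remove j w)) * wprod tau (remove j w))).
  apply: cofinitely_all => j _; case: (boolP (_ != e)) => [je|_]; last by exists 0%N.
  have s1 : (size (remove j w) < k)%N.
    by rewrite (size_remove tau_gt0 (ltn_ord j)); exact: leq_ltn_trans (leq_pred _) sw.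
  have n1 : neutral (remove j w).
    have cw (p : pred (bool * C)) : count p w = (count p (remove j w) + p (nth (e, z) w j))%N.
      by rewrite {1}(remove_split (e, z) (ltn_ord j)) /remove !count_cat /= addnAC addnA.
    move: neu; rewrite /neutral /= !cw; move: (nth _ _ _).1 je => f; clear.
    by case: e; case: f => //= _; lia.
  have [N hN] := IH _ s1 (region_remove j regw) n1.
  by exists N => n /hN h _.
apply: cofinitelyW (cofinitely_and (cofinitely_and H1 H2) (cofinitely_and H3 H4)) => n [[h1 h2] [h3 h4]].
rewrite corr_recursion // hcs // !mulr_sumr; apply: eq_bigr => j _.
have := h4 j (mem_enum _ _); case: (boolP (_ != e)) => [je /(_ isT) h|_ _]; last by rewrite !mulr0.
rewrite skern_Th //; last first.
  by move: reg; rewrite /region /= => /andP[/allP + _]; apply; exact: mem_nth.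
move: h; move: (Th _ (sgc R e * _) / _) (corr _ _ _) vacuum_shift (normalization _) (Th _ _ * _) => a b c d f h.
by rewrite [LHS]mulrCA [RHS]mulrCA; congr (_ * _); rewrite [LHS]mulrCA h mulrCA.
Qed.

End Correlation.

(** * Continuity in alpha *)

Section Limit.
Variable R : realType.
Local Notation C := R[i].
Variable tau : C.
Hypothesis tau_gt0 : 0 < complex.Im tau.
Local Notation ipi := (ipi R).
Local Notation th := (Submission.th tau).
Variable beta : R.
Implicit Types (S : fstate) (w : seq (bool * C)) (ms : seq int) (alpha : R).
Local Notation kappa := (beta + 1 / 2).
Local Notation corr := (corr tau).
Local Notation Th alpha := (Th tau beta alpha).
Local Notation normalization := (normalization tau beta).
Local Notation vacuum_shift := (vacuum_shift tau beta).

Lemma cvgs_cst (c : C) : ((fun _ : nat => c : C^o) @ \oo --> (c : C^o))%classic.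
Proof. exact: cvg_cst. Qed.

Lemma cvgs_affine alpha (a b : C) :
  ((fun n => a * (alpha_seq alpha n)%:C + b : C^o) @ \oo --> (a * alpha%:C + b : C^o))%classic.
Proof.
apply: (@cvgD C^o); last exact: cvg_cst.
by apply: cvgsM; [exact: cvgs_cst|exact: cvgs_alpha_seq].
Qed.

Lemma cvgs_weight alpha S :
  ((fun n => weight tau (alpha_seq alpha n) kappa S : C^o) @ \oo --> (weight tau alpha kappa S : C^o))%classic.
Proof.
have e a : weight tau a kappa S =
  ((-1) ^+ #|` S| * cexp (twopii R * tau * (shifted kappa S)%:C)) * cexp (twopii R * (fcharge R S)%:C * a%:C + 0).
  by rewrite weightE addr0 mulrAC [twopii R * a%:C * _]mulrAC.
rewrite e; under eq_fun do rewrite e.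
by apply: cvgsM; [exact: cvgs_cst|apply: cvgs_cexp; exact: cvgs_affine].
Qed.

(** Changing alpha only changes phases of the weights, so the moduli of the terms at alpha dominate
    the whole sequence. *)
Lemma cvgs_corr alpha w : region tau w ->
  ((fun n => corr (alpha_seq alpha n) beta w : C^o) @ \oo --> (corr alpha beta w : C^o))%classic.
Proof.
move=> reg; have [M hM] := summ_terms tau_gt0 alpha kappa reg.
apply: (tannery hM _ _).2 => [n p|p].
  by rewrite /terms !nmM !nm_weight.
by apply: cvgsM; [exact: cvgs_weight|exact: cvgs_cst].
Qed.

Lemma cvgs_normalization alpha :
  ((fun n => normalization (alpha_seq alpha n) : C^o) @ \oo --> (normalization alpha : C^o))%classic.
Proof.
apply: cvgsM; last exact: cvgs_cst.
have e a : twopii R * (a + 1 / 2)%:C * kappa%:C = twopii R * kappa%:C * a%:C + twopii R * (1 / 2 : R)%:C * kappa%:C.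
  by rewrite rmorphD /=; ring.
rewrite e; under eq_fun do rewrite e.
by apply: cvgs_cexp; exact: cvgs_affine.
Qed.

Lemma cvgs_Th alpha u :
  ((fun n => Th (alpha_seq alpha n) u : C^o) @ \oo --> (Th alpha u : C^o))%classic.
Proof.
pose b : C := (- beta + 1 / 2)%:C.
have e a : Th a u = cexp (b * (2 * ipi) * a%:C + (ipi * tau * b ^+ 2 + b * u + b * ipi)) *
    th (2 * ipi * a%:C + (u + 2 * ipi * tau * (b - 1 / 2))).
  rewrite /Submission.Th thetaE // -/b.
  have -> : (a + 1 / 2)%:C = a%:C + 1 / 2 :> C by rewrite rmorphD rmorphM /= fmorphV rmorph_nat rmorph1.
  by congr (cexp _ * th _); move: b (a%:C) => x y; field.
rewrite e; under eq_fun do rewrite e.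
apply: cvgsM; first by apply: cvgs_cexp; exact: cvgs_affine.
set z := 2 * ipi * alpha%:C + _.
have -> : (fun n => th (2 * ipi * (alpha_seq alpha n)%:C + (u + 2 * ipi * tau * (b - 1 / 2)))) =
   fun n => th (z + (2 * ipi * (alpha_seq alpha n)%:C + - (2 * ipi * alpha%:C))).
  by apply/funext => n; congr th; rewrite /z; ring.
apply: (quad_cvg (th_quad tau_gt0 z)).
by rewrite -(subrr (2 * ipi * alpha%:C)); exact: cvgs_affine.
Qed.

Lemma correlation_function alpha w : region tau w -> neutral w ->
  vacuum_shift * corr alpha beta w = normalization alpha * (Th alpha (wsum w) * wprod tau w).
Proof.
move=> reg neu.
have h1 := cvgsM (@cvgs_cst vacuum_shift) (@cvgs_corr alpha w reg).
have h2 := cvgsM (@cvgs_normalization alpha) (cvgsM (@cvgs_Th alpha (wsum w)) (@cvgs_cst (wprod tau w))).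
apply: cvgs_unique h2; apply: cvgs_cofinitely_eq h1.
exact: generic_correlation.
Qed.

Lemma has_STr_correlation alpha w : region tau w -> neutral w ->
  has_STr (opexp (twopii R * alpha%:C) (@a0 R)) kappa tau [seq (psiv R x.1, x.2) | x <- w]
    (normalization alpha * (Th alpha (wsum w) * wprod tau w)).
Proof.
move=> reg neu; rewrite -correlation_function //.
pose h (p : fstate * (size [seq (psiv R x.1, x.2) | x <- w]).-tuple int) := (p.1, tval p.2).
have hi : injective h by move=> [S s] [T t] [-> /val_inj ->].
have H : has_sum (fun p => terms tau alpha kappa w (h p)) (corr alpha beta w).
  apply/(has_sum_inj _ hi) => [[S ms]|]; last exact: has_csum (summ_terms tau_gt0 alpha kappa reg).
  rewrite /terms /entry /=; case: (size ms =P size w) => [sm _|_]; last by rewrite mulr0 eqxx.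
  have sm' : size ms == size [seq (psiv R x.1, x.2) | x <- w] by rewrite size_map sm.
  by exists (S, Tuple sm').
apply: eq_has_sum (has_sumZ vacuum_shift H) => -[S t].
by rewrite STr_termE.
Qed.

End Limit.

(** * Meromorphy and the alternating word *)
Section Meromorphy.
Variable R : realType.
Local Notation C := R[i].
Variable tau : C.
Hypothesis tau_gt0 : 0 < complex.Im tau.
Local Notation ipi := (ipi R).
Local Notation th := (Submission.th tau).
Local Notation K u := (prime_form u tau).

Lemma quad_differentiable (f : C -> C) (z l : C) : quad f z l -> differentiable (f : C^o -> C^o) (z : C^o).
Proof. by move=> /quad_derive[h _]; apply/derivable1_diffP. Qed.

Lemma quad_comp_add (f : C -> C) (z l d : C) : quad f (z + d) l -> quad (fun w => f (w + d)) z l.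
Proof. by move=> [M hM]; exists M => h /hM; rewrite (addrAC z d h). Qed.

Lemma differentiable_prime (z : C) : differentiable ((fun u => K u) : C^o -> C^o) (z : C^o).
Proof.
have -> : (fun u => K u) = fun u => cexp (1 / 2 * u) * (th u * (dth tau 0)^-1).
  by apply/funext => u; rewrite prime_formE // [_ * u]mulrC mul1r mulrA.
apply: quad_differentiable; apply: quadM (quad_cexpM (1 / 2) z) _.
exact: quadM (th_quad tau_gt0 z) (quad_cst _ z).
Qed.

Lemma differentiable_theta (a b : R) (z : C) : differentiable ((fun u => theta a b u tau) : C^o -> C^o) (z : C^o).
Proof.
set d := 2 * ipi * (b%:C - 1 / 2) + 2 * ipi * tau * (a%:C - 1 / 2).
have -> : (fun u => theta a b u tau) = fun u => cexp (ipi * tau * a%:C ^+ 2 + a%:C * (2 * ipi * b%:C)) *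
    (cexp (a%:C * u) * th (u + d)).
  apply/funext => u; rewrite thetaE // mulrA -cexpD addrA; congr (cexp _ * _); ring.
apply: quad_differentiable; apply: quadM (quad_cst _ z) _.
apply: quadM (quad_cexpM _ z) _; apply: quad_comp_add; exact: th_quad.
Qed.

Variable n : nat.
Local Notation W := (('rV[C]_n * 'rV[C]_n)%type : normedModType C).
Local Notation rV := ('rV[C]_n : normedModType C).

Lemma differentiable_fst_coord (i : 'I_n) (p : W) : differentiable ((fun p => p.1 0 i) : W -> C^o) p.
Proof.
apply: (@differentiable_comp _ _ _ _ (fst : W -> rV) (fun v : rV => v 0 i : C^o)).
  by apply: linear_differentiable => q; exact: cvg_fst.
exact: differentiable_coord.
Qed.

Lemma differentiable_snd_coord (i : 'I_n) (p : W) : differentiable ((fun p => p.2 0 i) : W -> C^o) p.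
Proof.
apply: (@differentiable_comp _ _ _ _ (snd : W -> rV) (fun v : rV => v 0 i : C^o)).
  by apply: linear_differentiable => q; exact: cvg_snd.
exact: differentiable_coord.
Qed.

Lemma differentiable_bigprod (V : normedModType C) (I : Type) (r : seq I) (P : pred I) (F : I -> V -> C^o) (p : V) :
  (forall i, differentiable (F i) p) ->
  differentiable ((fun x => \prod_(i <- r | P i) F i x) : V -> C^o) p.
Proof.
move=> h; elim: r => [|i r IH].
  under eq_fun do rewrite big_nil; exact: differentiable_cst.
have -> : (fun x => \prod_(j <- i :: r | P j) F j x) =
    fun x => (if P i then F i x else 1) * \prod_(j <- r | P j) F j x.
  by apply/funext => x; rewrite big_cons; case: ifP => // _; rewrite mul1r.
by apply: (@differentiableM C) IH; case: (P i); [exact: h|exact: differentiable_cst].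
Qed.

Lemma differentiable_bigsum (V : normedModType C) (I : Type) (r : seq I) (P : pred I) (F : I -> V -> C^o) (p : V) :
  (forall i, differentiable (F i) p) ->
  differentiable ((fun x => \sum_(i <- r | P i) F i x) : V -> C^o) p.
Proof.
move=> h; elim: r => [|i r IH].
  under eq_fun do rewrite big_nil; exact: differentiable_cst.
have -> : (fun x => \sum_(j <- i :: r | P j) F j x) =
    fun x => (if P i then F i x else 0) + \sum_(j <- r | P j) F j x.
  by apply/funext => x; rewrite big_cons; case: ifP => // _; rewrite add0r.
by apply: (@differentiableD C) IH; case: (P i); [exact: h|exact: differentiable_cst].
Qed.

End Meromorphy.

(** * Common denominator and the alternating order *)

Section AlternatingWord.
Variable R : realType.
Local Notation C := R[i].
Variable tau : C.
Hypothesis tau_gt0 : 0 < complex.Im tau.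
Local Notation L := (nome_rate tau).
Local Notation ipi := (ipi R).
Local Notation K u := (prime_form u tau).

Section Denominator.
Variable n : nat.
Local Notation W := (('rV[C]_n * 'rV[C]_n)%type : normedModType C).

Definition denominator (p : W) : C := \prod_(i < n) \prod_(j < n) K (p.1 0 i - p.2 0 j).

(* Small imaginary shifts of all the [x_i] move every [x_i - y_j] off the lattice. *)
Lemma denominator_not_locally_zero (w : W) : ~ (\forall w' \near w, denominator w' = 0).
Proof.
move=> h; pose d (k : nat) : C := 2 * ipi * (1 / k.+1%:R).
pose v : W := (const_mx 1, 0); pose u (k : nat) : W := w + d k *: v.
have hd : ((d : nat -> C^o) @ \oo --> (0 : C^o))%classic.
  rewrite -(mulr0 (2 * ipi)); apply: cvgsM; first exact: cvgs_cst.
  have -> : (fun k => 1 / k.+1%:R : C) = fun k => (1 / k.+1%:R : R)%:C.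
    by apply/funext => k; rewrite rmorphM /= fmorphV rmorph_nat rmorph1.
  exact: cvgs_inv_succ.
have hu : (u @ \oo --> w)%classic.
  rewrite -[X in (_ --> X)%classic](addr0 w) -(scale0r v); apply: (@cvgD C); first exact: cvg_cst.
  exact: (@cvgZr_tmp C).
have [N _ hN] := hu _ h.
have [M hM] : cofinitely (fun k => forall i, i \in enum 'I_n -> forall j, j \in enum 'I_n ->
    gen tau (w.1 0 i - w.2 0 j + sgc R true * d k)).
  pose A i j : C := w.1 0 i - w.2 0 j.
  apply: (@cofinitely_all _ (enum 'I_n) (fun i k => forall j, j \in enum 'I_n -> gen tau (A i j + sgc R true * d k))) => i _.
  apply: (@cofinitely_all _ (enum 'I_n) (fun j k => gen tau (A i j + sgc R true * d k))) => j _.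
  exact: (gen_eventually tau_gt0 true (A i j)).
have := hN (maxn N M) (leq_maxl _ _); rewrite /= => /eqP; apply/negP.
rewrite /denominator prodf_seq_neq0; apply/allP => i _ /=.
rewrite prodf_seq_neq0; apply/allP => j _ /=; apply: prime_neq0 => //.
have := hM _ (leq_maxr N M) i (mem_enum _ _) j (mem_enum _ _).
suff -> : (u (maxn N M)).1 0 i - (u (maxn N M)).2 0 j = w.1 0 i - w.2 0 j + sgc R true * d (maxn N M) by [].
rewrite /u /v /= !mxE /sgc; move: (d _) (w.1 0 i) (w.2 0 j) => a b c.
ring.
Qed.

Lemma meromorphic_ratio (G : W -> C^o) (N : W -> C^o) :
  (forall p, differentiable N p) -> (forall p, G p = N p / denominator p) -> meromorphic G.
Proof.
move=> dN GE p; exists N, (denominator : W -> C^o); split.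
- by near=> w; exact: dN.
- near=> w; apply: differentiable_bigprod => i; apply: differentiable_bigprod => j.
  apply: (@differentiable_comp _ _ _ _ (fun p : W => p.1 0 i - p.2 0 j : C^o) (fun u : C^o => K u : C^o)).
    by apply: (@differentiableB C); [exact: differentiable_fst_coord|exact: differentiable_snd_coord].
  exact: differentiable_prime.
- by near=> w; exact: denominator_not_locally_zero.
by near=> w => _; exact: GE.
Unshelve. all: by end_near.
Qed.

End Denominator.

Definition alternating_word n (X Y : 'I_n -> C) : seq (bool * C) :=
  flatten [seq [:: (true, X i); (false, Y i)] | i <- enum 'I_n].

Lemma big_alternating (T : Type) (idx : T) (op : Monoid.com_law idx) n (X Y : 'I_n -> C) (F : bool * C -> T) :
  \big[op/idx]_(x <- alternating_word X Y) F x = \big[op/idx]_(i < n) op (F (true, X i)) (F (false, Y i)).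
Proof.
rewrite /alternating_word big_flatten big_map big_enum /=; apply: eq_bigr => i _.
by rewrite !big_cons big_nil Monoid.mulm1.
Qed.

Lemma wsum_alternating n (X Y : 'I_n -> C) : wsum (alternating_word X Y) = \sum_(i < n) (X i - Y i).
Proof.
rewrite /wsum big_alternating; apply: eq_bigr => i _ /=.
by rewrite /sgc /= mul1r mulN1r.
Qed.

Lemma neutral_alternating n (X Y : 'I_n -> C) : neutral (alternating_word X Y).
Proof.
apply/eqP; rewrite -!sum1_count big_mkcond big_alternating [RHS]big_mkcond [RHS]big_alternating.
exact: eq_bigr.
Qed.

Lemma alternatingS n (X Y : 'I_n.+1 -> C) : alternating_word X Y =
  (true, X ord0) :: (false, Y ord0) :: alternating_word (X \o lift ord0) (Y \o lift ord0).
Proof. by rewrite /alternating_word enum_ordSl /= -map_comp. Qed.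

(** The word order yields K(y_i - x_j) for i < j where the formula has K(x_j - y_i). Each of these
    n(n-1)/2 factors changes sign by oddness. *)
Lemma wprod_alternating n (X Y : 'I_n -> C) : wprod tau (alternating_word X Y) =
  (-1) ^+ 'C(n, 2) * ((\prod_(i < n) \prod_(j < n | (i < j)%N) (K (X i - X j) * K (Y i - Y j)))
    / \prod_(i < n) \prod_(j < n) K (X i - Y j)).
Proof.
elim: n X Y => [|n IH] X Y.
  by rewrite /alternating_word enum_ord0 /= !big_ord0 invr1 !mulr1.
rewrite alternatingS /= big_cons !big_alternating IH /kpair /=.
have -> : \prod_(i < n.+1) \prod_(j < n.+1 | (i < j)%N) (K (X i - X j) * K (Y i - Y j)) =
   \prod_(j < n) (K (X ord0 - X (lift ord0 j)) * K (Y ord0 - Y (lift ord0 j))) *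
   \prod_(i < n) \prod_(j < n | (i < j)%N) (K (X (lift ord0 i) - X (lift ord0 j)) * K (Y (lift ord0 i) - Y (lift ord0 j))).
  rewrite big_ord_recl; congr (_ * _).
    by rewrite big_mkcond big_ord_recl /= mul1r.
  by apply: eq_bigr => i _; rewrite big_mkcond big_ord_recl /= mul1r -big_mkcond.
have -> : \prod_(i < n.+1) \prod_(j < n.+1) K (X i - Y j) =
   K (X ord0 - Y ord0) * \prod_(j < n) K (X ord0 - Y (lift ord0 j)) *
   (\prod_(i < n) K (X (lift ord0 i) - Y ord0) * \prod_(i < n) \prod_(j < n) K (X (lift ord0 i) - Y (lift ord0 j))).
  rewrite big_ord_recl big_ord_recl -big_split; congr (_ * _).
  by apply: eq_bigr => i _; rewrite big_ord_recl.
have -> : \prod_(i < n) ((K (Y ord0 - X (lift ord0 i)))^-1 * K (Y ord0 - Y (lift ord0 i))) =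
  (-1) ^+ n * ((\prod_(i < n) K (X (lift ord0 i) - Y ord0))^-1 * \prod_(i < n) K (Y ord0 - Y (lift ord0 i))).
  rewrite -prodfV -big_split -[X in (-1) ^+ X]card_ord -prodr_const -big_split.
  by apply: eq_bigr => i _ /=; rewrite -[Y ord0 - X _]opprB primeN // invrN mulN1r mulNr.
have -> : \prod_(i < n) (K (X ord0 - X (lift ord0 i)) * (K (X ord0 - Y (lift ord0 i)))^-1) =
  \prod_(i < n) K (X ord0 - X (lift ord0 i)) * (\prod_(i < n) K (X ord0 - Y (lift ord0 i)))^-1.
  by rewrite -prodfV -big_split.
have -> : \prod_(j < n) (K (X ord0 - X (lift ord0 j)) * K (Y ord0 - Y (lift ord0 j))) =
  \prod_(i < n) K (X ord0 - X (lift ord0 i)) * \prod_(i < n) K (Y ord0 - Y (lift ord0 i)).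
  by rewrite -big_split.
rewrite binS bin1 addnC exprD.
move: (K (X ord0 - Y ord0)) ((-1) ^+ n) ((-1) ^+ 'C(n, 2)) (\prod_(i < n) K (X ord0 - X (lift ord0 i)))
  (\prod_(i < n) K (X ord0 - Y (lift ord0 i))) (\prod_(i < n) K (X (lift ord0 i) - Y ord0))
  (\prod_(i < n) K (Y ord0 - Y (lift ord0 i)))
  (\prod_(i < n) \prod_(j < n) K (X (lift ord0 i) - Y (lift ord0 j)))
  (\prod_(i < n) \prod_(j < n | (i < j)%N) _).
move=> a s1 s2 b c d e f g; rewrite !invfM; move: a^-1 c^-1 d^-1 f^-1 => a' c' d' f'; ring.
Qed.

(** Since |e^z| = e^(Re z), the chain says that the real parts decrease, and its last link, with |q
    q_1|, bounds every difference by L. *)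
Lemma region_sorted_modulus (w : seq (bool * C)) :
  convergence_region tau [seq x.2 | x <- w] -> region tau w.
Proof.
case: w => [|x w] //; rewrite /convergence_region.
have tr : transitive (fun u v : C => v < u) by move=> y z t /[swap]; exact: lt_trans.
have ltE (z z' : C) : (`|cexp z| < `|cexp z'|) = (complex.Re z < complex.Re z').
  by rewrite !nmE ltcR !nm_cexp ltr_expR.
have qE (z : C) : `|qpow tau 1 * cexp z| = `|cexp (2 * ipi * tau + z)|.
  by rewrite /qpow twopiiE mulr1 -cexpD.
rewrite qE sorted_pairwise // -map_comp -cats1 pairwise_cat allrel1r pairwise_map.
case/and3P => /allP hL pw _.
have ReqE (z : C) : complex.Re (2 * ipi * tau + z) = complex.Re z - L.
  have := Re_2ipitau tau 1; rewrite mulr1 mulr1; case: (2 * ipi * tau) z => a b [c d] /= ->; ring.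
have hL' y : y \in x :: w -> complex.Re x.2 - L < complex.Re y.2.
  by move=> yw; rewrite -ReqE -ltE; apply: hL; apply/mapP; exists y.
have hx y : y \in x :: w -> complex.Re y.2 <= complex.Re x.2.
  rewrite inE => /orP[/eqP -> //|yw].
  by move: pw => /= /andP[/allP/(_ _ yw) /= + _]; rewrite ltE => /ltW.
rewrite /region; apply: (sub_in_pairwise _ _ pw); last by apply/allP => y; exact: id.
move=> y z yw zw /=; rewrite ltE => yz; have h1 := hx _ yw; have h2 := hL' _ zw.
have -> : complex.Re (y.2 - z.2) = complex.Re y.2 - complex.Re z.2 by case: (y.2) (z.2) => ? ? [].
by apply/andP; split; lra.
Qed.

End AlternatingWord.

(* The factor (-1)^(n(n-1)/2) is needed for the alternating order of the
   insertions psi^+, psi^-, psi^+, psi^-, ...: already for n = 2 the product of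
   prime forms with K(y_i - y_j), i < j, tends to minus the value dictated by
   Y(psi^+,z) Y(psi^-,w) ~ 1/(z - w) when x_i -> y_i. *)
Theorem proposition6p7 (R : realType) (alpha beta : R) (tau : R[i])
    (htau : 0 < complex.Im tau) (n : nat) :
  let kappa := beta + 1 / 2 in
  let f := opexp (twopii R * alpha%:C) (@a0 R) in
  is_G2n f kappa tau
    (fun x y : 'rV[R[i]]_n =>
       (-1) ^+ 'C(n, 2)
       * (cexp (twopii R * (alpha + 1 / 2)%:C * (beta + 1 / 2)%:C)
          / dedekind_eta tau
          * theta (- beta + 1 / 2) (alpha + 1 / 2)
                  (\sum_(i < n) (x 0 i - y 0 i)) tau
          * ((\prod_(i < n) \prod_(j < n | (i < j)%N)
                (prime_form (x 0 i - x 0 j) tau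
                 * prime_form (y 0 i - y 0 j) tau))
             / \prod_(i < n) \prod_(j < n)
                 prime_form (x 0 i - y 0 j) tau))).
Proof.
move=> kappa f; split.
  (* All factors that are entire in (x, y) go into the numerator; only the mixed prime forms stay in
     [denominator]. *)
  pose N (p : 'rV[R[i]]_n * 'rV[R[i]]_n) : R[i] := (-1) ^+ 'C(n, 2)
    * (cexp (twopii R * (alpha + 1 / 2)%:C * (beta + 1 / 2)%:C) / dedekind_eta tau)
    * (theta (- beta + 1 / 2) (alpha + 1 / 2) (\sum_(i < n) (p.1 0 i - p.2 0 i)) tau
    * \prod_(i < n) \prod_(j < n | (i < j)%N)
        (prime_form (p.1 0 i - p.1 0 j) tau * prime_form (p.2 0 i - p.2 0 j) tau)).
  apply: (@meromorphic_ratio R tau htau n _ N) => [p|[x y]]; last first.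
    rewrite /N /denominator /=; move: (\prod_(i < n) _) (\prod_(i < n) \prod_(j < n) _)^-1 => a b.
    move: (cexp _ / _) (theta _ _ _ _) => c d; ring.
  pose W := (('rV[R[i]]_n * 'rV[R[i]]_n)%type : normedModType R[i]).
  have d1 (i j : 'I_n) : differentiable ((fun q => prime_form (q.1 0 i - q.1 0 j) tau) : W -> R[i]^o) p.
    apply: (@differentiable_comp _ _ _ _ (fun q : W => q.1 0 i - q.1 0 j : R[i]^o) (fun u : R[i]^o => prime_form u tau : R[i]^o)).
      by apply: (@differentiableB R[i]); exact: differentiable_fst_coord.
    exact: differentiable_prime.
  have d2 (i j : 'I_n) : differentiable ((fun q => prime_form (q.2 0 i - q.2 0 j) tau) : W -> R[i]^o) p.
    apply: (@differentiable_comp _ _ _ _ (fun q : W => q.2 0 i - q.2 0 j : R[i]^o) (fun u : R[i]^o => prime_form u tau : R[i]^o)).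
      by apply: (@differentiableB R[i]); exact: differentiable_snd_coord.
    exact: differentiable_prime.
  apply: (@differentiableM R[i]); first exact: differentiable_cst.
  apply: (@differentiableM R[i]).
    apply: (@differentiable_comp _ _ _ _ (fun q : W => \sum_(i < n) (q.1 0 i - q.2 0 i) : R[i]^o)
      (fun u : R[i]^o => theta (- beta + 1 / 2) (alpha + 1 / 2) u tau : R[i]^o)).
      apply: differentiable_bigsum => i.
      by apply: (@differentiableB R[i]); [exact: differentiable_fst_coord|exact: differentiable_snd_coord].
    exact: differentiable_theta.
  apply: differentiable_bigprod => i; apply: differentiable_bigprod => j.
  by apply: (@differentiableM R[i]); [exact: d1|exact: d2].
move=> x y cr.
have wE : insertions x y = [seq (psiv R z.1, z.2) | z <- alternating_word (fun i => x 0 i) (fun i => y 0 i)].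
  rewrite /insertions /alternating_word map_flatten -map_comp; congr flatten.
  by apply: eq_map => i /=; rewrite psipE psimE.
have reg : region tau (alternating_word (fun i => x 0 i) (fun i => y 0 i)).
  by apply: region_sorted_modulus; move: cr; rewrite wE -map_comp.
have H := @has_STr_correlation R tau htau beta alpha _ reg (neutral_alternating _ _).
rewrite wE; refine (eq_ind _ (has_STr f kappa tau _) H _ _).
rewrite wsum_alternating wprod_alternating // /Th /normalization.
move: (cexp _ / _) (theta _ _ _ _) ((-1) ^+ _) (_ / \prod_(i < n) \prod_(j < n) _) => a b c d.
by rewrite mulrA mulrCA.
Qed.
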